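(* The following are equivalent over $\mathsf{RCA}_0$: (i) The principle of arithmetical comprehension holds. (ii) For any continuous function $f\colon[0,1]\to[0,1]$ and any $x\in[0,1]$, there is a sequence $(x_n)_{n\in\mathbb N}$ of reals with $x_0=x$ and $x_{n+1}=f(x_n)$ for all $n\in\mathbb N$.
   Context: $\mathsf{RCA}_0$ is the usual base system of second-order arithmetic (basic arithmetic axioms, $\Sigma^0_1$-induction, $\Delta^0_1$-comprehension). ''Equivalent over $\mathsf{RCA}_0$'' means that the equivalence, formalized in second-order arithmetic, is provable in $\mathsf{RCA}_0$. Arithmetical comprehension asserts that $\{n\in\mathbb N:\varphi(n)\}$ exists for each arithmetical formula $\varphi$ (with parameters). Reals. A real is a Cauchy sequence $x=(x_n)_{n\in\mathbb N}$ of rationals with no rate of convergence given: for each rational $\varepsilon>0$ there is an $N\in\mathbb N$ with $|x_m-x_n|<\varepsilon$ for all $m,n\geq N$. For reals $x,y$: $x\leq y$ means that for each rational $\varepsilon>0$ there is an $N$ with $x_n\leq y_n+\varepsilon$ for all $n\geq N$; $x=y$ means $x\leq y$ and $y\leq x$; $x<y$ means $x\leq y$ but not $x=y$. Addition, multiplication and absolute value are defined pointwise; rationals are identified with constant sequences. Put $B_\delta(y)=\{z\in\mathbb R:|y-z|<\delta\}$ and $[0,1]=\{x\in\mathbb R:0\leq x\leq 1\}$. Sequences of reals. A sequence of reals $(x_n)_{n\in\mathbb N}$, $x_n=(x_{ni})_{i\in\mathbb N}$, is a double sequence of rationals that is uniformly Cauchy: each $\varepsilon>0$ admits an $N\in\mathbb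 N$ such that $|x_{ni}-x_{nj}|<\varepsilon$ for all $n\in\mathbb N$ and all $i,j\geq N$. (The equalities in (ii) are equalities of reals.) Continuous functions. A partial continuous function on $\mathbb R$ is (represented by) an arbitrary function $f\colon\mathbb Q\to\mathbb Q^{\mathbb N}$, $f(q)=(f(q)_i)_{i\in\mathbb N}$. A real $x$ lies in $\operatorname{dom}(f)$ if each $\varepsilon>0$ admits a (positive) $N\in\mathbb N$ such that $|f(q)_i-f(r)_j|<\varepsilon$ for all rationals $q,r\in B_{1/N}(x)$ and all $i,j\geq N$. For $x=(x_i)\in\operatorname{dom}(f)$ the value is the real $f(x)=(f(x_i)_i)_{i\in\mathbb N}$. A continuous function $f\colon D\to\mathbb R$ is such an $f$ with $D\subseteq\operatorname{dom}(f)$; $f\colon D\to E$ means in addition that $f(x)\in E$ for all $x\in D$. *)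

(* Defs.v *)
From Stdlib Require Import List.
Import ListNotations.

(** * The language of second-order arithmetic

    De Bruijn indices, counted separately for number variables and for set
    variables.  Equality is primitive for numbers only. *)

Inductive term : Type :=
| Var (i : nat)
| Zero
| One
| Plus (s t : term)
| Times (s t : term).

Inductive form : Type :=
| EqN (s t : term)
| LtN (s t : term)
| Mem (t : term) (X : nat)
| Bot
| Imp (p q : form)
| AllNum (p : form)
| AllSet (p : form).

(** The logic is classical, so the other connectives are abbreviations. *)
Definition Not (p : form) : form := Imp p Bot.
Definition And (p q : form) : form := Not (Imp p (Not q)).
Definition Or (p q : form) : form := Imp (Not p) q.
Definition Iff (p q : form) : form := And (Imp p q) (Imp q p).
Definition ExNum (p : form) : form := Not (AllNum (Not p)).
Definition ExSet (p : form) : form := Not (AllSet (Not p)).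

Definition scons {A : Type} (a : A) (f : nat -> A) (i : nat) : A :=
  match i with 0 => a | S j => f j end.

Fixpoint tsubst (sigma : nat -> term) (t : term) : term :=
  match t with
  | Var i => sigma i
  | Zero => Zero
  | One => One
  | Plus s u => Plus (tsubst sigma s) (tsubst sigma u)
  | Times s u => Times (tsubst sigma s) (tsubst sigma u)
  end.

Definition tshift : term -> term := tsubst (fun i => Var (S i)).

Definition upN (sigma : nat -> term) : nat -> term :=
  scons (Var 0) (fun i => tshift (sigma i)).
Definition upS (rho : nat -> nat) : nat -> nat :=
  scons 0 (fun i => S (rho i)).

(** Simultaneous capture-avoiding substitution of terms for number variables
    and of set variables for set variables. *)
Fixpoint subst (sigma : nat -> term) (rho : nat -> nat) (p : form) : form :=
  match p with
  | EqN s t => EqN (tsubst sigma s) (tsubst sigma t)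
  | LtN s t => LtN (tsubst sigma s) (tsubst sigma t)
  | Mem t X => Mem (tsubst sigma t) (rho X)
  | Bot => Bot
  | Imp p q => Imp (subst sigma rho p) (subst sigma rho q)
  | AllNum p => AllNum (subst (upN sigma) rho p)
  | AllSet p => AllSet (subst sigma (upS rho) p)
  end.

Definition shiftN : form -> form := subst (fun i => Var (S i)) (fun X => X).
Definition shiftS : form -> form := subst Var S.
Definition instN (t : term) : form -> form :=
  subst (scons t Var) (fun X => X).
Definition instS (X : nat) : form -> form :=
  subst Var (scons X (fun Y => Y)).

(** * Classical natural deduction from the axioms in [T]

    The eigenvariable conditions of [prv_AllNI] and [prv_AllSI] concern the
    local assumptions in [G] only, so that the elements of [T] are used as if
    they were universally closed: their free variables are parameters. *)

Inductive prv (T : form -> Prop) : list form -> form -> Prop :=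
| prv_ax G p : T p -> prv T G p
| prv_hyp G p : In p G -> prv T G p
| prv_ImpI G p q : prv T (p :: G) q -> prv T G (Imp p q)
| prv_ImpE G p q : prv T G (Imp p q) -> prv T G p -> prv T G q
| prv_DN G p : prv T G (Not (Not p)) -> prv T G p
| prv_AllNI G p : prv T (map shiftN G) p -> prv T G (AllNum p)
| prv_AllNE G p t : prv T G (AllNum p) -> prv T G (instN t p)
| prv_AllSI G p : prv T (map shiftS G) p -> prv T G (AllSet p)
| prv_AllSE G p X : prv T G (AllSet p) -> prv T G (instS X p)
| prv_refl G t : prv T G (EqN t t)
| prv_leibniz G s t p :
    prv T G (EqN s t) -> prv T G (instN s p) -> prv T G (instN t p).

Definition provable (T : form -> Prop) (p : form) : Prop := prv T [] p.

Definition extend (T A : form -> Prop) (p : form) : Prop := T p \/ A p.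

(** Two principles, each given by a set of axioms (a schema or a single
    sentence), are equivalent over [T]. *)
Definition equivalent_over (T A B : form -> Prop) : Prop :=
  (forall p, B p -> provable (extend T A) p) /\
  (forall p, A p -> provable (extend T B) p).

(** * RCA_0 and arithmetical comprehension *)

(** In the two bounded quantifiers the bound is shifted, so that it does not
    contain the bound variable. *)
Inductive Delta00 : form -> Prop :=
| Delta00_Eq s t : Delta00 (EqN s t)
| Delta00_Lt s t : Delta00 (LtN s t)
| Delta00_Mem t X : Delta00 (Mem t X)
| Delta00_Bot : Delta00 Bot
| Delta00_Imp p q : Delta00 p -> Delta00 q -> Delta00 (Imp p q)
| Delta00_ball t p :
    Delta00 p -> Delta00 (AllNum (Imp (LtN (Var 0) (tshift t)) p))
| Delta00_bex t p :
    Delta00 p -> Delta00 (ExNum (And (LtN (Var 0) (tshift t)) p)).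

Inductive Sigma01 : form -> Prop :=
| Sigma01_intro p : Delta00 p -> Sigma01 (ExNum p).

Inductive Pi01 : form -> Prop :=
| Pi01_intro p : Delta00 p -> Pi01 (AllNum p).

Fixpoint arithmetical (p : form) : Prop :=
  match p with
  | Imp p q => arithmetical p /\ arithmetical q
  | AllNum p => arithmetical p
  | AllSet _ => False
  | _ => True
  end.

Definition basic_axioms : list form :=
  let m := Var 0 in
  let n := Var 1 in
  [ Not (EqN (Plus n One) Zero);
    Imp (EqN (Plus m One) (Plus n One)) (EqN m n);
    EqN (Plus m Zero) m;
    EqN (Plus m (Plus n One)) (Plus (Plus m n) One);
    EqN (Times m Zero) Zero;
    EqN (Times m (Plus n One)) (Plus (Times m n) m);
    Not (LtN m Zero);
    Iff (LtN m (Plus n One)) (Or (LtN m n) (EqN m n)) ].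

(** In both schemata number variable 0 of [p] is the distinguished variable;
    all other variables are parameters. *)
Definition induction_axiom (p : form) : form :=
  Imp (instN Zero p)
    (Imp (AllNum (Imp p (subst (scons (Plus (Var 0) One) (fun i => Var (S i)))
                         (fun X => X) p)))
       (AllNum p)).

Definition comprehension_axiom (p : form) : form :=
  ExSet (AllNum (Iff (Mem (Var 0) 0) (shiftS p))).

Inductive RCA0 : form -> Prop :=
| RCA0_basic p : In p basic_axioms -> RCA0 p
| RCA0_induction p : Sigma01 p -> RCA0 (induction_axiom p)
| RCA0_comprehension p q :
    Sigma01 p -> Pi01 q -> RCA0 (Imp (AllNum (Iff p q)) (comprehension_axiom p)).

Inductive ACA : form -> Prop :=
| ACA_intro p : arithmetical p -> ACA (comprehension_axiom p).

(** * Writing formulas with named variables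

    An [nterm], [svar] or [fml] is a term, set variable or formula as a function
    of the numbers of number and set quantifiers above it.  A bound variable
    remembers the depth [d] of its quantifier, and occurs as index
    [d' - S d] at depth [d'].  [sentence] produces the de Bruijn formula. *)

Definition nterm : Type := nat -> term.
Definition svar : Type := nat -> nat.
Definition fml : Type := nat -> nat -> form.

Definition sentence (p : fml) : form := p 0 0.

Declare Scope nt_scope.
Delimit Scope nt_scope with nt.
Bind Scope nt_scope with nterm.
Declare Scope fml_scope.
Delimit Scope fml_scope with fml.
Bind Scope fml_scope with fml.

Definition n0 : nterm := fun _ => Zero.
Definition n1 : nterm := fun _ => One.
Definition nadd (s t : nterm) : nterm := fun d => Plus (s d) (t d).
Definition nmul (s t : nterm) : nterm := fun d => Times (s d) (t d).
Notation "0" := n0 : nt_scope.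
Notation "1" := n1 : nt_scope.
Notation "s + t" := (nadd s t) : nt_scope.
Notation "s * t" := (nmul s t) : nt_scope.

Definition f_eq (s t : nterm) : fml := fun d _ => EqN (s d) (t d).
Definition f_lt (s t : nterm) : fml := fun d _ => LtN (s d) (t d).
Definition f_mem (t : nterm) (X : svar) : fml := fun d e => Mem (t d) (X e).
Definition f_not (p : fml) : fml := fun d e => Not (p d e).
Definition f_imp (p q : fml) : fml := fun d e => Imp (p d e) (q d e).
Definition f_and (p q : fml) : fml := fun d e => And (p d e) (q d e).
Definition f_or (p q : fml) : fml := fun d e => Or (p d e) (q d e).
Definition f_true : fml := fun _ _ => Not Bot.
Definition f_all (p : nterm -> fml) : fml :=
  fun d e => AllNum (p (fun d' => Var (d' - S d)) (S d) e).
Definition f_ex (p : nterm -> fml) : fml :=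
  fun d e => ExNum (p (fun d' => Var (d' - S d)) (S d) e).
Definition f_allS (p : svar -> fml) : fml :=
  fun d e => AllSet (p (fun e' => e' - S e) d (S e)).
Definition f_exS (p : svar -> fml) : fml :=
  fun d e => ExSet (p (fun e' => e' - S e) d (S e)).

Notation "s = t" := (f_eq s%nt t%nt) : fml_scope.
Notation "s < t" := (f_lt s%nt t%nt) : fml_scope.
Notation "s <= t" := (f_lt s%nt (t + 1)%nt) : fml_scope.
Notation "s ∈ X" := (f_mem s%nt X) (at level 70) : fml_scope.
Notation "~ p" := (f_not p) : fml_scope.
Notation "p /\ q" := (f_and p q) : fml_scope.
Notation "p \/ q" := (f_or p q) : fml_scope.
Notation "p -> q" := (f_imp p q) : fml_scope.
Notation "∀ x , p" := (f_all (fun x => p))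
  (at level 200, x name, right associativity) : fml_scope.
Notation "∃ x , p" := (f_ex (fun x => p))
  (at level 200, x name, right associativity) : fml_scope.
Notation "∀₂ X , p" := (f_allS (fun X => p))
  (at level 200, X name, right associativity) : fml_scope.
Notation "∃₂ X , p" := (f_exS (fun X => p))
  (at level 200, X name, right associativity) : fml_scope.

Local Open Scope fml_scope.

(** The injective pairing function [(i + j)^2 + i]. *)
Definition npair (i j : nterm) : nterm := ((i + j) * (i + j) + i)%nt.

(** * Rational numbers

    A triple stands for the fraction [(pos - neg) / (den + 1)]. *)

Record frac : Type := Frac { pos : nterm; neg : nterm; den : nterm }.

Definition code (x : frac) : nterm := npair (npair (pos x) (neg x)) (den x).

Definition dnm (x : frac) : nterm := (den x + 1)%nt.

Definition qadd (x y : frac) : frac :=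
  {| pos := pos x * dnm y + pos y * dnm x;
     neg := neg x * dnm y + neg y * dnm x;
     den := den x * den y + den x + den y |}%nt.
Definition qopp (x : frac) : frac :=
  {| pos := neg x; neg := pos x; den := den x |}.
Definition qsub (x y : frac) : frac := qadd x (qopp y).

Definition qeq (x y : frac) : fml :=
  pos x * dnm y + neg y * dnm x = pos y * dnm x + neg x * dnm y.
Definition qlt (x y : frac) : fml :=
  pos x * dnm y + neg y * dnm x < pos y * dnm x + neg x * dnm y.
Definition qle (x y : frac) : fml :=
  pos x * dnm y + neg y * dnm x <= pos y * dnm x + neg x * dnm y.

Definition q0 : frac := Frac 0 0 0.
Definition q1 : frac := Frac 1 0 0.
(** [1 / (M + 1)] *)
Definition qinv_succ (M : nterm) : frac := Frac 1 0 M.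

(** [k] holds of the absolute value of [x]. *)
Definition qabs (x : frac) (k : frac -> fml) : fml :=
  ∃ a, (pos x = neg x + a \/ neg x = pos x + a) /\ k (Frac a 0 (den x)).

(** |x - y| < z *)
Definition qdist_lt (x y z : frac) : fml :=
  qabs (qsub x y) (fun d => qlt d z).

Definition all_frac (p : frac -> fml) : fml :=
  ∀ a, ∀ b, ∀ c, p (Frac a b c).
Definition ex_frac (p : frac -> fml) : fml :=
  ∃ a, ∃ b, ∃ c, p (Frac a b c).

(** A rational number is the fraction with the least code among all fractions
    equal to it; hence rationals are equal if and only if their codes are. *)
Definition is_rat (x : frac) : fml :=
  all_frac (fun y => code y < code x -> ~ qeq y x).

Definition all_rat (p : frac -> fml) : fml :=
  all_frac (fun x => is_rat x -> p x).
Definition ex_rat (p : frac -> fml) : fml :=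
  ex_frac (fun x => is_rat x /\ p x).
Definition all_posrat (p : frac -> fml) : fml :=
  all_rat (fun x => qlt q0 x -> p x).

(** * Functions into the rationals *)

(** The set [X] is (the graph of) a function from [D] to the rationals. *)
Definition is_fun (D : nterm -> fml) (X : svar) : fml :=
  (∀ m, m ∈ X -> ∃ d, D d /\ ex_rat (fun q => m = npair d (code q)))
  /\ (∀ d, D d ->
        ex_rat (fun q => npair d (code q) ∈ X /\
          all_rat (fun r => npair d (code r) ∈ X -> code r = code q))).

(** [k] holds of the value at [d] of the function [X]. *)
Definition value (X : svar) (d : nterm) (k : frac -> fml) : fml :=
  ex_rat (fun q => npair d (code q) ∈ X /\ k q).

(** * Sequences of rationals and reals

    Sequences of rationals that are definable from given ones (pointwise
    operations, values [f(x)], rows of a double sequence) are represented by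
    [rseq]: if [x : rseq], then [x n k] says that [k] holds of [x_n].  Terms
    of such sequences need only be fractions, not fractions with least code,
    as they are just compared with respect to the order. *)

Definition rseq : Type := nterm -> (frac -> fml) -> fml.

Definition seq_of (X : svar) : rseq := fun n k => value X n k.
Definition const (q : frac) : rseq := fun _ k => k q.
(** [|x - y|], pointwise *)
Definition rdist (x y : rseq) : rseq := fun n k =>
  x n (fun p => y n (fun q => qabs (qsub p q) k)).

Definition cauchy (x : rseq) : fml :=
  all_posrat (fun e => ∃ N, ∀ m, ∀ n, N <= m -> N <= n ->
    x m (fun p => x n (fun q => qdist_lt p q e))).

Definition rle (x y : rseq) : fml :=
  all_posrat (fun e => ∃ N, ∀ n, N <= n ->
    x n (fun p => y n (fun q => qle p (qadd q e)))).
Definition req (x y : rseq) : fml := rle x y /\ rle y x.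
Definition rlt (x y : rseq) : fml := rle x y /\ ~ req x y.

Definition is_real (X : svar) : fml :=
  is_fun (fun _ => f_true) X /\ cauchy (seq_of X).

Definition in_unit_interval (x : rseq) : fml :=
  cauchy x /\ rle (const q0) x /\ rle x (const q1).

(** The rational [q] lies in the ball with radius [r] around [x]. *)
Definition in_ball (r : frac) (x : rseq) (q : frac) : fml :=
  rlt (rdist x (const q)) (const r).

(** A double sequence of rationals: the value [x_{ni}] is taken at
    [npair n i]. *)
Definition row (Y : svar) (n : nterm) : rseq := fun i k =>
  value Y (npair n i) k.

Definition is_real_seq (Y : svar) : fml :=
  is_fun (fun d => ∃ n, ∃ i, d = npair n i) Y
  /\ all_posrat (fun e => ∃ N, ∀ n, ∀ i, ∀ j,
       N <= i -> N <= j ->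
       row Y n i (fun p => row Y n j (fun q => qdist_lt p q e))).

(** * Partial continuous functions *)

(** A function [F] from the rationals to sequences of rationals: the value
    [F(q)_i] is taken at [npair (code q) i]. *)
Definition is_partial_continuous (F : svar) : fml :=
  is_fun (fun d => ex_rat (fun q => ∃ i, d = npair (code q) i)) F.

Definition fval (F : svar) (q : frac) : rseq := fun i k =>
  value F (npair (code q) i) k.

(** The positive natural number in the definition of the domain is
    [N = M + 1]. *)
Definition in_dom (F : svar) (x : rseq) : fml :=
  all_posrat (fun e => ∃ M, all_rat (fun q => all_rat (fun r =>
    in_ball (qinv_succ M) x q -> in_ball (qinv_succ M) x r ->
    ∀ i, ∀ j, M + 1 <= i -> M + 1 <= j ->
    fval F q i (fun u => fval F r j (fun v => qdist_lt u v e))))).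

(** The value [F(x) = (F(x_i)_i)_i]; here the terms of [x] must be rationals,
    i.e. have least codes, which is the case for [seq_of] and [row]. *)
Definition app (F : svar) (x : rseq) : rseq := fun i k =>
  x i (fun q => fval F q i k).

Definition continuous_unit_interval (F : svar) : fml :=
  is_partial_continuous F
  /\ ∀₂ X, is_real X -> in_unit_interval (seq_of X) ->
       in_dom F (seq_of X) /\ in_unit_interval (app F (seq_of X)).

(** The equation [x_{n+1} = F(x_n)] includes that its right side is defined,
    i.e. that [x_n] lies in the domain of [F]. *)
Definition is_orbit (F X Y : svar) : fml :=
  is_real_seq Y
  /\ req (row Y 0%nt) (seq_of X)
  /\ ∀ n, in_dom F (row Y n) /\
            req (row Y (n + 1)%nt) (app F (row Y n)).

Definition orbit_principle : form := sentence
  (∀₂ F, continuous_unit_interval F ->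
   ∀₂ X, is_real X -> in_unit_interval (seq_of X) ->
   ∃₂ Y, is_orbit F X Y).

(* Main.v *)
(** By the completeness theorem it suffices to argue in an arbitrary model [M] of RCA_0,
    whose numbers form a discretely ordered semiring with an ordered field of fractions.

    Given arithmetical comprehension, iterate pointwise: [h i 0 = x i] and
    [h i (n + 1) = F (h i n) i].  Every [h _ n] is a real in the unit interval by arithmetical
    induction, and composing with the least moduli of convergence makes the double sequence
    uniformly Cauchy.

    Conversely, let [P n] say that some [v] satisfies [T n v].  The ternary expansions with
    digit 2 at those positions [n] for which some [v < i] satisfies [T n v], truncated at
    position [i], increase with [i] and hence form a Cauchy sequence, although no rate of
    convergence is known.  The orbit of this real under the map that shifts the expansions is
    uniformly Cauchy, so that a single index approximates all its members well enough to read
    off their first digits, which decide [P].  Equality of reals is too complex for the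
    available induction; that the orbit follows the shifted expansions up to step [n] is
    shown by induction on bounds between rational approximations of precision [3 ^ - n]. *)

From Stdlib Require Import List Arith Lia Ring ssreflect.
From Stdlib Require Import Classical ClassicalEpsilon FunctionalExtensionality.
From Stdlib Require Import PropExtensionality ProofIrrelevance.
Require Import Defs.
Import ListNotations.

Set Implicit Arguments.
Unset Strict Implicit.
Unset Printing Implicit Defensive.

Arguments prv_ax {T G p}.
Arguments prv_hyp {T G p}.
Arguments prv_ImpI {T G p q}.
Arguments prv_ImpE {T G p q}.
Arguments prv_DN {T G p}.
Arguments prv_AllNI {T G p}.
Arguments prv_AllNE {T G p}.
Arguments prv_AllSI {T G p}.
Arguments prv_AllSE {T G p}.
Arguments prv_refl {T G}.
Arguments prv_leibniz {T G s t p}.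

(** * Quotients *)

(** Both principles are compared with comprehension for [S1] predicates. In the forward direction a
    real can be iterated termwise because the value [f(x)] is itself taken termwise, as [f(x_i)_i];
    what this leaves open is the rate of convergence of each iterate. In the converse direction the
    obstacle is that no finite part of a sequence of reals without rates says anything about its
    members. Only uniformity helps: one index serves all rows. It can serve because a first digit 0
    or 2 leaves a gap from 1/3 to 2/3, so an approximation with error below 1/6 reveals the digit by
    comparison with 1/2. Dropping a digit extends to a map with Lipschitz constant 3 on all
    rationals, which makes it continuous in the required sense. As each step triples an error, the
    error at step 0 must be of order [3 ^ - n] for tracking up to step [n], which forces an index
    depending on [n]. The tracking therefore takes place at such a large index, and only its outcome
    for row [n] is carried back to the fixed index, where the cost is independent of [n]. *)

Section Quotient.
Variables (A : Type) (R : A -> A -> Prop).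

(** A class is the predicate [R a] itself, so equality of classes is Leibniz equality. Used for the
    terms of the Henkin model and for the integers. *)
Definition quot : Type := {P : A -> Prop | exists a, P = R a}.
Definition cls (a : A) : quot := exist _ (R a) (ex_intro _ a eq_refl).
Definition rep (x : quot) : A :=
  proj1_sig (constructive_indefinite_description _ (proj2_sig x)).

Lemma repK x : cls (rep x) = x.
Proof.
rewrite /rep; case: constructive_indefinite_description => a /= E.
by case: x E => P HP /= E; apply: subset_eq_compat; rewrite E.
Qed.

Lemma cls_eq a b :
  (forall x, R x x) -> (forall x y, R x y -> R y x) ->
  (forall x y z, R x y -> R y z -> R x z) -> cls a = cls b <-> R a b.
Proof.
move=> Rrefl Rsym Rtrans; split=> [[E]|H]; first by have := Rrefl b; rewrite -{1}E.
apply: subset_eq_compat.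
apply: functional_extensionality => c; apply: propositional_extensionality.
by split; apply: Rtrans => //; apply: Rsym.
Qed.

End Quotient.

(** * Substitution *)

Lemma tsubst_comp (tau sigma : nat -> term) (t : term) :
  tsubst tau (tsubst sigma t) = tsubst (fun i => tsubst tau (sigma i)) t.
Proof. by elim: t => //= s -> u ->. Qed.

Lemma tsubst_id (t : term) : tsubst Var t = t.
Proof. by elim: t => //= s -> u ->. Qed.

Lemma tsubst_tshift (sigma : nat -> term) (t : term) :
  tsubst (upN sigma) (tshift t) = tshift (tsubst sigma t).
Proof. by rewrite /tshift !tsubst_comp. Qed.

Lemma tsubst_scons_tshift (u t : term) (sigma : nat -> term) :
  tsubst (scons u sigma) (tshift t) = tsubst sigma t.
Proof. by rewrite /tshift tsubst_comp. Qed.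

Lemma upN_comp (tau sigma : nat -> term) :
  (fun i => tsubst (upN tau) (upN sigma i)) = upN (fun i => tsubst tau (sigma i)).
Proof.
by apply: functional_extensionality => -[|i] //=; rewrite tsubst_tshift.
Qed.

Lemma upN_Var : upN Var = Var.
Proof. by apply: functional_extensionality => -[]. Qed.

Lemma upS_comp (rho' rho : nat -> nat) :
  (fun X => upS rho' (upS rho X)) = upS (fun X => rho' (rho X)).
Proof. by apply: functional_extensionality => -[]. Qed.

Lemma upS_id : upS (fun X => X) = fun X => X.
Proof. by apply: functional_extensionality => -[]. Qed.

Lemma subst_comp (p : form) tau rho' sigma rho :
  subst tau rho' (subst sigma rho p) =
  subst (fun i => tsubst tau (sigma i)) (fun X => rho' (rho X)) p.
Proof.
elim: p tau rho' sigma rho =>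
  [s t|s t|t X||p IHp q IHq|p IHp|p IHp] tau rho' sigma rho //=;
  rewrite ?tsubst_comp ?IHp ?IHq ?upN_comp ?upS_comp //.
Qed.

Lemma subst_id (p : form) : subst Var (fun X => X) p = p.
Proof.
elim: p => [s t|s t|t X||p IHp q IHq|p IHp|p IHp] /=;
  by rewrite ?tsubst_id ?upN_Var ?upS_id ?IHp ?IHq.
Qed.

Lemma subst_instN (sigma : nat -> term) (rho : nat -> nat) (t : term) p :
  subst sigma rho (instN t p) = instN (tsubst sigma t) (subst (upN sigma) rho p).
Proof.
rewrite /instN !subst_comp; f_equal; apply: functional_extensionality => -[|i] //=.
by rewrite /tshift tsubst_comp /= tsubst_id.
Qed.

Lemma instN_upN (sigma : nat -> term) rho (t : term) p :
  instN t (subst (upN sigma) rho p) = subst (scons t sigma) rho p.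
Proof.
rewrite /instN subst_comp; f_equal; apply: functional_extensionality => -[|i] //=.
by rewrite /tshift tsubst_comp /= tsubst_id.
Qed.

Lemma subst_instS (sigma : nat -> term) (rho : nat -> nat) X p :
  subst sigma rho (instS X p) = instS (rho X) (subst sigma (upS rho) p).
Proof.
rewrite /instS !subst_comp; f_equal; apply: functional_extensionality => -[|i] //=;
  by rewrite tsubst_id.
Qed.

Lemma instS_upS (sigma : nat -> term) rho X p :
  instS X (subst sigma (upS rho) p) = subst sigma (scons X rho) p.
Proof.
rewrite /instS subst_comp; f_equal; apply: functional_extensionality => -[|i] //=;
  by rewrite tsubst_id.
Qed.

Lemma subst_shiftN (sigma : nat -> term) rho p :
  subst (upN sigma) rho (shiftN p) = shiftN (subst sigma rho p).
Proof. by rewrite /shiftN !subst_comp. Qed.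

Lemma subst_shiftS (sigma : nat -> term) rho p :
  subst sigma (upS rho) (shiftS p) = shiftS (subst sigma rho p).
Proof.
rewrite /shiftS !subst_comp; f_equal; apply: functional_extensionality => i /=.
by rewrite tsubst_id.
Qed.

(** Bounds on free variables are expressed through invariance under changes of the substitution,
    since substitution is all that they are needed for. *)
Lemma tsubst_agree (t : term) : exists k, forall sigma sigma',
  (forall i, i < k -> sigma i = sigma' i) -> tsubst sigma t = tsubst sigma' t.
Proof.
elim: t => [i|||s [k Hk] u [l Hl]|s [k Hk] u [l Hl]];
  try (by exists 0); try (exists (k + l) => ? ? H /=;
  by rewrite (Hk _ _ (fun i Hi => H i ltac:(lia)))
             (Hl _ _ (fun i Hi => H i ltac:(lia)))).
by exists (S i) => ? ? H /=; apply: H; lia.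
Qed.

(** [bounds k p]: the free variables of both sorts in [p] are below [k]. *)
Definition bounds (k : nat) (p : form) : Prop :=
  forall sigma sigma' rho rho',
  (forall i, i < k -> sigma i = sigma' i) -> (forall i, i < k -> rho i = rho' i) ->
  subst sigma rho p = subst sigma' rho' p.

Lemma bounds_le k l p : k <= l -> bounds k p -> bounds l p.
Proof. by move=> kl H ? ? ? ? H1 H2; apply: H => i Hi; [apply: H1|apply: H2]; lia. Qed.

Lemma bounds_exists (p : form) : exists k, bounds k p.
Proof.
elim: p => [s t|s t|t X||p [k Hk] q [l Hl]|p [k Hk]|p [k Hk]].
- have [k Hk] := tsubst_agree s; have [l Hl] := tsubst_agree t.
  exists (k + l) => ? ? ? ? H _ /=.
  by rewrite (Hk _ _ (fun i Hi => H i ltac:(lia))) (Hl _ _ (fun i Hi => H i ltac:(lia))).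
- have [k Hk] := tsubst_agree s; have [l Hl] := tsubst_agree t.
  exists (k + l) => ? ? ? ? H _ /=.
  by rewrite (Hk _ _ (fun i Hi => H i ltac:(lia))) (Hl _ _ (fun i Hi => H i ltac:(lia))).
- have [k Hk] := tsubst_agree t.
  exists (k + S X) => ? ? ? ? H H' /=.
  by rewrite (Hk _ _ (fun i Hi => H i ltac:(lia))) H'; [lia|].
- by exists 0.
- exists (k + l) => ? ? ? ? H H' /=.
  by rewrite (Hk _ _ _ _ (fun i Hi => H i ltac:(lia)) (fun i Hi => H' i ltac:(lia)))
             (Hl _ _ _ _ (fun i Hi => H i ltac:(lia)) (fun i Hi => H' i ltac:(lia))).
- exists k => ? ? ? ? H H' /=; f_equal; apply: Hk => // -[|i] //= Hi.
  by rewrite H; [lia|].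
- exists k => ? ? ? ? H H' /=; f_equal; apply: Hk => // -[|i] //= Hi.
  by rewrite H'; [lia|].
Qed.

(** * Derivations *)

Section Derivations.
Variable T : form -> Prop.

Lemma prv_weaken G G' p : prv T G p -> incl G G' -> prv T G' p.
Proof.
move=> H; elim: H G' => {G p}.
- by move=> G p Tp G' _; apply: prv_ax.
- by move=> G p Hp G' sub; apply: prv_hyp; apply: sub.
- move=> G p q _ IH G' sub; apply: prv_ImpI; apply: IH => r [->|Hr]; first by left.
  by right; apply: sub.
- by move=> G p q _ IH1 _ IH2 G' sub; apply: (prv_ImpE (IH1 _ sub) (IH2 _ sub)).
- by move=> G p _ IH G' sub; apply: prv_DN; apply: IH.
- by move=> G p _ IH G' sub; apply: prv_AllNI; apply: IH; apply: incl_map.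
- by move=> G p t _ IH G' sub; apply: prv_AllNE; apply: IH.
- by move=> G p _ IH G' sub; apply: prv_AllSI; apply: IH; apply: incl_map.
- by move=> G p X _ IH G' sub; apply: prv_AllSE; apply: IH.
- by move=> G t G' _; apply: prv_refl.
- by move=> G s t p _ IH1 _ IH2 G' sub; apply: prv_leibniz (IH1 _ sub) (IH2 _ sub).
Qed.

Lemma provable_weaken G p : provable T p -> prv T G p.
Proof. by move=> H; apply: prv_weaken H _ => ?. Qed.

(** [T] need not be closed under substitution. A formula provable without assumptions can however be
    generalized and instantiated [n] times, which lowers the remaining variables by [n]. *)
Lemma provable_substN (n : nat) (sigma : nat -> term) p :
  provable T p ->
  provable T (subst (fun i => if i <? n then sigma i else Var (i - n)) (fun X => X) p).
Proof.
elim: n sigma p => [|n IH] sigma p Hp.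
  rewrite [subst _ _ _](_ : _ = p) //.
  rewrite -[RHS]subst_id; f_equal; apply: functional_extensionality => i /=.
  by rewrite Nat.sub_0_r.
have /(IH (fun i => sigma (S i))) /= : provable T (AllNum p) by apply: prv_AllNI.
move/prv_AllNE => /(_ (sigma 0)); rewrite instN_upN.
rewrite [subst _ _ _](_ : _ = subst
  (fun i => if i <? S n then sigma i else Var (i - S n)) (fun X => X) p) //.
by f_equal; apply: functional_extensionality => -[].
Qed.

Lemma provable_substS (n : nat) (rho : nat -> nat) p :
  provable T p ->
  provable T (subst Var (fun i => if i <? n then rho i else i - n) p).
Proof.
elim: n rho p => [|n IH] rho p Hp.
  rewrite [subst _ _ _](_ : _ = p) //.
  rewrite -[RHS]subst_id; f_equal; apply: functional_extensionality => i /=.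
  by rewrite Nat.sub_0_r.
have /(IH (fun i => rho (S i))) /= : provable T (AllSet p) by apply: prv_AllSI.
move/prv_AllSE => /(_ (rho 0)); rewrite instS_upS.
rewrite [subst _ _ _](_ : _ = subst Var
  (fun i => if i <? S n then rho i else i - S n) p) //.
by f_equal; apply: functional_extensionality => -[].
Qed.

(** Beyond a bound for the free variables of [p] the substitution does not matter, so the finite
    ones suffice. *)
Lemma provable_subst sigma rho p : provable T p -> provable T (subst sigma rho p).
Proof.
have [k Hk] := bounds_exists p.
move=> /(provable_substN k sigma) /(provable_substS k rho).
have [l Hl] := bounds_exists p.
rewrite subst_comp.
set tau := (X in subst X); move=> H.
have <- : subst tau (fun X => if X <? k then rho X else X - k) p = subst sigma rho p.
  apply: Hk => i Hi; rewrite /tau /=; move/Nat.ltb_lt: Hi => ->; by rewrite ?tsubst_id.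
by [].
Qed.

Lemma prv_subst G p sigma rho :
  prv T G p -> prv T (map (subst sigma rho) G) (subst sigma rho p).
Proof.
move=> H; elim: H sigma rho => {G p}.
- by move=> G p Tp sigma rho; apply/provable_weaken/provable_subst/prv_ax.
- by move=> G p Hp sigma rho; apply: prv_hyp; apply: in_map.
- by move=> G p q _ IH sigma rho; apply: prv_ImpI; apply: (IH sigma rho).
- by move=> G p q _ IH1 _ IH2 sigma rho; apply: prv_ImpE (IH1 sigma rho) (IH2 _ _).
- by move=> G p _ IH sigma rho; apply: prv_DN; apply: (IH sigma rho).
- move=> G p _ IH sigma rho; apply: prv_AllNI; have := IH (upN sigma) rho.
  by rewrite !map_map (map_ext _ _ (subst_shiftN _ _)).
- by move=> G p t _ IH sigma rho; rewrite subst_instN; apply: prv_AllNE; apply: (IH sigma rho).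
- move=> G p _ IH sigma rho; apply: prv_AllSI; have := IH sigma (upS rho).
  by rewrite !map_map (map_ext _ _ (subst_shiftS _ _)).
- by move=> G p X _ IH sigma rho; rewrite subst_instS; apply: prv_AllSE; apply: (IH sigma rho).
- by move=> G t sigma rho; apply: prv_refl.
- move=> G s t p _ IH1 _ IH2 sigma rho; have H1 := IH1 sigma rho; have := IH2 sigma rho.
  by rewrite !subst_instN; apply: prv_leibniz.
Qed.

Lemma bounds_list (G : list form) : exists k, forall p, In p G -> bounds k p.
Proof.
elim: G => [|p G [k Hk]]; first by exists 0.
have [l Hl] := bounds_exists p.
exists (k + l) => q [<-|Hq]; [apply: bounds_le Hl|apply: bounds_le (Hk _ Hq)]; lia.
Qed.

(** The renaming that sends [k] to 0 and every other variable one up turns [G] into its shift, as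
    [k] does not occur there, and turns the fresh instance of [q] back into [q]. *)
Lemma prv_fresh_AllNum (G : list form) (q : form) (k : nat) :
  (forall p, In p G -> bounds k p) -> bounds k q ->
  prv T G (instN (Var k) q) -> prv T G (AllNum q).
Proof.
move=> HG Hq /(prv_subst (fun i => if i =? k then Var 0 else Var (S i)) (fun X => X)).
set sigma := fun i => _; move=> H.
apply: prv_AllNI.
have -> : map shiftN G = map (subst sigma (fun X => X)) G.
  apply: map_ext_in => p Hp; apply: (HG p Hp) => // i Hi.
  by rewrite /sigma (proj2 (Nat.eqb_neq i k)) //; lia.
suff -> : q = subst sigma (fun X => X) (instN (Var k) q) by [].
rewrite /instN subst_comp -[LHS]subst_id; apply: Hq => // -[|i] Hi /=.
  by rewrite /sigma Nat.eqb_refl.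
by rewrite /sigma (proj2 (Nat.eqb_neq i k)) //; lia.
Qed.

Lemma prv_fresh_AllSet (G : list form) (q : form) (k : nat) :
  (forall p, In p G -> bounds k p) -> bounds k q ->
  prv T G (instS k q) -> prv T G (AllSet q).
Proof.
move=> HG Hq /(prv_subst Var (fun i => if i =? k then 0 else S i)).
set rho := fun i => _; move=> H.
apply: prv_AllSI.
have -> : map shiftS G = map (subst Var rho) G.
  apply: map_ext_in => p Hp; apply: (HG p Hp) => // i Hi.
  by rewrite /rho (proj2 (Nat.eqb_neq i k)) //; lia.
suff -> : q = subst Var rho (instS k q) by [].
rewrite /instS subst_comp -[LHS]subst_id; apply: Hq => // -[|i] Hi /=.
  by rewrite /rho Nat.eqb_refl.
by rewrite /rho (proj2 (Nat.eqb_neq i k)) //; lia.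
Qed.

Lemma prv_hd G p : prv T (p :: G) p.
Proof. by apply: prv_hyp; left. Qed.

Lemma prv_tl G p q : prv T G q -> prv T (p :: G) q.
Proof. by move=> H; apply: prv_weaken H _ => r; right. Qed.

Lemma prv_exfalso G p : prv T G Bot -> prv T G p.
Proof. by move=> H; apply/prv_DN/prv_ImpI/prv_tl. Qed.

Lemma prv_by_contra G p : prv T (Not p :: G) Bot -> prv T G p.
Proof. by move=> H; apply/prv_DN/prv_ImpI. Qed.

Lemma prv_eq_sym G s t : prv T G (EqN s t) -> prv T G (EqN t s).
Proof.
move=> H; have := prv_leibniz (p := EqN (Var 0) (tshift s)) H.
rewrite /instN /= !tsubst_scons_tshift !tsubst_id; apply; exact: prv_refl.
Qed.

Lemma prv_eq_trans G s t u :
  prv T G (EqN s t) -> prv T G (EqN t u) -> prv T G (EqN s u).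
Proof.
move=> H1 H2; have := prv_leibniz (p := EqN (tshift s) (Var 0)) H2.
by rewrite /instN /= !tsubst_scons_tshift !tsubst_id; apply.
Qed.

Lemma prv_eq_congr G (c : term) s t :
  prv T G (EqN s t) ->
  prv T G (EqN (tsubst (scons s Var) c) (tsubst (scons t Var) c)).
Proof.
move=> H.
have := prv_leibniz (p := EqN (tshift (tsubst (scons s Var) c)) c) H.
rewrite /instN /= !tsubst_scons_tshift !tsubst_id; apply; exact: prv_refl.
Qed.

End Derivations.

(** * Structures and completeness *)

Record structure : Type := Structure {
  num : Type;
  sets : Type;
  zeroM : num;
  oneM : num;
  addM : num -> num -> num;
  mulM : num -> num -> num;
  ltM : num -> num -> Prop;
  elemM : num -> sets -> Prop }.

Fixpoint eval (M : structure) (s : nat -> num M) (t : term) : num M :=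
  match t with
  | Var i => s i
  | Zero => zeroM M
  | One => oneM M
  | Plus t u => addM (eval s t) (eval s u)
  | Times t u => mulM (eval s t) (eval s u)
  end.

Fixpoint sat (M : structure) (s : nat -> num M) (r : nat -> sets M) (p : form) : Prop :=
  match p with
  | EqN t u => eval s t = eval s u
  | LtN t u => ltM (eval s t) (eval s u)
  | Mem t X => elemM (eval s t) (r X)
  | Bot => False
  | Imp p q => sat s r p -> sat s r q
  | AllNum p => forall x, sat (scons x s) r p
  | AllSet p => forall X, sat s (scons X r) p
  end.

Definition is_model (T : form -> Prop) (M : structure) : Prop :=
  forall p, T p -> forall (s : nat -> num M) (r : nat -> sets M), sat s r p.

(** Structures without sets satisfy every formula vacuously. *)
Record rca : Type := Rca {
  str :> structure;
  str_model : is_model RCA0 str;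
  some_set : sets str }.

Lemma eval_tsubst (M : structure) (s : nat -> num M) sigma t :
  eval s (tsubst sigma t) = eval (fun i => eval s (sigma i)) t.
Proof. by elim: t => //= t -> u ->. Qed.

Lemma scons_eval_upN (M : structure) (s : nat -> num M) sigma x :
  (fun i => eval (scons x s) (upN sigma i)) = scons x (fun i => eval s (sigma i)).
Proof.
by apply: functional_extensionality => -[|i] //=; rewrite /tshift eval_tsubst.
Qed.

Lemma sat_subst (M : structure) p (s : nat -> num M) r sigma rho :
  sat s r (subst sigma rho p) <->
  sat (fun i => eval s (sigma i)) (fun i => r (rho i)) p.
Proof.
elim: p s r sigma rho => [t u|t u|t X||p IHp q IHq|p IHp|p IHp] s r sigma rho /=;
  rewrite ?eval_tsubst //.
- by rewrite IHp IHq.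
- by split=> H x; move: (H x); rewrite IHp scons_eval_upN.
- have E X : (fun i => scons X r (upS rho i)) = scons X (fun i => r (rho i)).
    by apply: functional_extensionality => -[].
  by split=> H X; move: (H X); rewrite IHp E.
Qed.

(** Cumulative finite lists replace an enumeration of the formulas: a stage of the construction
    treats a whole list. *)
Fixpoint terms_upto (n : nat) : list term :=
  match n with
  | 0 => []
  | S n => Zero :: One :: Var n :: terms_upto n
      ++ flat_map (fun s => map (Plus s) (terms_upto n)) (terms_upto n)
      ++ flat_map (fun s => map (Times s) (terms_upto n)) (terms_upto n)
  end.

Fixpoint forms_upto (n : nat) : list form :=
  match n with
  | 0 => []
  | S n => Bot :: forms_upto n
      ++ flat_map (fun s => map (EqN s) (terms_upto n)) (terms_upto n)
      ++ flat_map (fun s => map (LtN s) (terms_upto n)) (terms_upto n)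
      ++ flat_map (fun s => map (Mem s) (seq 0 n)) (terms_upto n)
      ++ flat_map (fun p => map (Imp p) (forms_upto n)) (forms_upto n)
      ++ map AllNum (forms_upto n) ++ map AllSet (forms_upto n)
  end.

Lemma in_flat_map2 {A B C : Type} (f : A -> B -> C) a b (l : list A) (l' : list B) :
  In a l -> In b l' -> In (f a b) (flat_map (fun x => map (f x) l') l).
Proof. by move=> Ha Hb; apply/in_flat_map; exists a; split=> //; apply: in_map. Qed.

Lemma terms_upto_le n m : n <= m -> incl (terms_upto n) (terms_upto m).
Proof.
elim: m => [|m IH] le t Ht; first by move: Ht; rewrite (_ : n = 0) //; lia.
case: (Nat.eq_dec n (S m)) => [<-//|ne].
do 3 right; apply/in_app_iff; left; apply: (IH _ t Ht); lia.
Qed.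

Lemma forms_upto_le n m : n <= m -> incl (forms_upto n) (forms_upto m).
Proof.
elim: m => [|m IH] le t Ht; first by move: Ht; rewrite (_ : n = 0) //; lia.
case: (Nat.eq_dec n (S m)) => [<-//|ne].
right; apply/in_app_iff; left; apply: (IH _ t Ht); lia.
Qed.

Lemma terms_upto_complete t : exists n, In t (terms_upto n).
Proof.
have step n m s u : In s (terms_upto n) -> In u (terms_upto m) ->
    In s (terms_upto (n + m)) /\ In u (terms_upto (n + m)).
  by move=> Hs Hu; split; [apply: terms_upto_le Hs|apply: terms_upto_le Hu]; lia.
elim: t => [i|||s [n Hn] u [m Hm]|s [n Hn] u [m Hm]].
- by exists (S i); do 2 right; left.
- by exists 1; left.
- by exists 1; right; left.
- have [Hs Hu] := step _ _ _ _ Hn Hm.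
  exists (S (n + m)); do 3 right; apply/in_app_iff; right; apply/in_app_iff; left.
  exact: in_flat_map2.
- have [Hs Hu] := step _ _ _ _ Hn Hm.
  exists (S (n + m)); do 3 right; apply/in_app_iff; right; apply/in_app_iff; right.
  exact: in_flat_map2.
Qed.

Lemma forms_upto_complete p : exists n, In p (forms_upto n).
Proof.
have step n m s u : In s (terms_upto n) -> In u (terms_upto m) ->
    In s (terms_upto (n + m)) /\ In u (terms_upto (n + m)).
  by move=> Hs Hu; split; [apply: terms_upto_le Hs|apply: terms_upto_le Hu]; lia.
elim: p => [s t|s t|t X||p [n Hn] q [m Hm]|p [n Hn]|p [n Hn]].
- have [n Hn] := terms_upto_complete s; have [m Hm] := terms_upto_complete t.
  have [Hs Ht] := step _ _ _ _ Hn Hm; exists (S (n + m)).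
  by right; rewrite !in_app_iff; right; left; apply: in_flat_map2.
- have [n Hn] := terms_upto_complete s; have [m Hm] := terms_upto_complete t.
  have [Hs Ht] := step _ _ _ _ Hn Hm; exists (S (n + m)).
  by right; rewrite !in_app_iff; do 2 right; left; apply: in_flat_map2.
- have [n Hn] := terms_upto_complete t; exists (S (n + S X)).
  right; rewrite !in_app_iff; do 3 right; left; apply: in_flat_map2.
    by apply: terms_upto_le Hn; lia.
  by apply/in_seq; lia.
- by exists 1; left.
- exists (S (n + m)); right; rewrite !in_app_iff; do 4 right; left.
  by apply: in_flat_map2; [apply: forms_upto_le Hn|apply: forms_upto_le Hm]; lia.
- by exists (S n); right; rewrite !in_app_iff; do 5 right; left; apply: in_map.
- by exists (S n); right; rewrite !in_app_iff; do 6 right; apply: in_map.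
Qed.

(** * The Henkin construction *)

Section Henkin.
Variable T : form -> Prop.

Definition consistent (G : list form) : Prop := ~ prv T G Bot.

(** [G'] decides [f] and, when it refutes a universal formula [f], contains a
    counterexample. *)
Definition treats (G' : list form) (f : form) : Prop :=
  (In f G' \/ prv T G' (Not f))
  /\ (In f G' -> forall q, f = Not (AllNum q) -> exists t, In (Not (instN t q)) G')
  /\ (In f G' -> forall q, f = Not (AllSet q) -> exists X, In (Not (instS X q)) G').

(** If [f] is consistent with [G] it is added, together with a fresh counterexample in case it
    refutes a universal formula; otherwise [G] already proves its negation. *)
Lemma treat_one G f : consistent G ->
  exists G', consistent G' /\ incl G G' /\ treats G' f.
Proof.
move=> cG; case: (classic (prv T (f :: G) Bot)) => [H|cf].
  have nf : prv T G (Not f) by apply: prv_ImpI.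
  have notin : ~ In f G.
    by move=> inG; apply: cG; apply: prv_ImpE nf _; apply: prv_hyp.
  by exists G; split=> //; split=> // ; split; [right|split].
case: (classic (exists q, f = Not (AllNum q))) => [[q Eq]|nN].
  have [k Hk] := bounds_list (q :: f :: G).
  exists (Not (instN (Var k) q) :: f :: G); split; [|split].
    (* If the counterexample were inconsistent, the fresh instance and hence [AllNum q] would follow
       from [f :: G], against [f]. *)
    move=> /prv_by_contra H; apply: cf.
    have/prv_fresh_AllNum : prv T (f :: G) (instN (Var k) q) by [].
    move=> /(_ (fun p Hp => Hk p (or_intror Hp)) (Hk q (or_introl eq_refl))) H'.
    by apply: prv_ImpE H'; have:= prv_hd T G f; rewrite {2}Eq.
    by move=> p Hp; do 2 right.
  split; first by left; right; left.
  split; by move=> _ q'; rewrite Eq // => -[<-]; exists (Var k); left.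
case: (classic (exists q, f = Not (AllSet q))) => [[q Eq]|nS].
  have [k Hk] := bounds_list (q :: f :: G).
  exists (Not (instS k q) :: f :: G); split; [|split].
    move=> /prv_by_contra H; apply: cf.
    have/prv_fresh_AllSet : prv T (f :: G) (instS k q) by [].
    move=> /(_ (fun p Hp => Hk p (or_intror Hp)) (Hk q (or_introl eq_refl))) H'.
    by apply: prv_ImpE H'; have:= prv_hd T G f; rewrite {2}Eq.
    by move=> p Hp; do 2 right.
  split; first by left; right; left.
  split; by move=> _ q'; rewrite Eq // => -[<-]; exists k; left.
exists (f :: G); split=> //; split; first by move=> p; right.
split; first by left; left.
by split=> _ q Eq; [case: nN|case: nS]; exists q.
Qed.

(** A formula refuted by [G] cannot enter a consistent extension, so no new counterexample becomes
    due. *)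
Lemma treats_incl G G' f : consistent G' -> incl G G' -> treats G f -> treats G' f.
Proof.
move=> cG sub [[inG|nf] [HN HS]].
  split; first by left; apply: sub.
  split=> _ q Eq; first by have [t /sub] := HN inG q Eq; exists t.
  by have [X /sub] := HS inG q Eq; exists X.
have nf' := prv_weaken nf sub.
have notin : ~ In f G'.
  by move=> inG; apply: cG; apply: prv_ImpE nf' _; apply: prv_hyp.
by split; [right|split].
Qed.

Lemma treat_all (fs : list form) G : consistent G ->
  exists G', consistent G' /\ incl G G' /\ forall f, In f fs -> treats G' f.
Proof.
elim: fs G => [|f fs IH] G cG; first by exists G; split=> //; split.
have [G1 [c1 [sub1 t1]]] := IH _ cG.
have [G2 [c2 [sub2 t2]]] := treat_one f c1.
exists G2; split=> //; split; first by move=> p /sub1 /sub2.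
by move=> g [<-//|/t1]; apply: treats_incl.
Qed.

Variables (p0 : form) (p0_unprovable : ~ provable T p0).

Lemma start_consistent : consistent [Not p0].
Proof. by move=> /prv_by_contra. Qed.

Fixpoint stage (n : nat) : {G : list form | consistent G} :=
  match n with
  | 0 => exist _ _ start_consistent
  | S n =>
    let (G', H) := constructive_indefinite_description _
      (treat_all (forms_upto n) (proj2_sig (stage n))) in
    exist _ G' (proj1 H)
  end.

Definition Gst (n : nat) : list form := proj1_sig (stage n).

Lemma Gst_consistent n : consistent (Gst n).
Proof. exact: (proj2_sig (stage n)). Qed.

Lemma Gst_succ n :
  incl (Gst n) (Gst (S n)) /\ forall f, In f (forms_upto n) -> treats (Gst (S n)) f.
Proof.
by rewrite /Gst /=; case: constructive_indefinite_description => G' /= -[? []].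
Qed.

Lemma Gst_le n m : n <= m -> incl (Gst n) (Gst m).
Proof.
elim=> [|k _ IH] p Hp //; apply: (proj1 (Gst_succ k)); exact: IH.
Qed.

(** A complete consistent theory with witnesses that contains [T] and [Not p0]. *)
Definition Om (p : form) : Prop := exists n, In p (Gst n).

Lemma Gst_treats f : exists n, forall m, n <= m -> treats (Gst m) f.
Proof.
have [n Hn] := forms_upto_complete f.
exists (S n) => m nm; apply: (treats_incl (@Gst_consistent m) (Gst_le nm)).
exact: (proj2 (Gst_succ n)).
Qed.

Lemma Om_prv n p : prv T (Gst n) p -> Om p.
Proof.
move=> H; have [m /(_ (n + m)) [|[Hp|Hp] _]] := Gst_treats p; first lia.
  by exists (n + m).
case: (@Gst_consistent (n + m)); apply: prv_ImpE Hp _.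
by apply: prv_weaken H _; apply: Gst_le; lia.
Qed.

Lemma Om_closed G p : (forall q, In q G -> Om q) -> prv T G p -> Om p.
Proof.
move=> HG Hp.
have [n Hn] : exists n, incl G (Gst n).
  elim: G HG {Hp} => [|q G IH] HG; first by exists 0.
  have [n Hn] := IH (fun r Hr => HG r (or_intror Hr)).
  have [m Hm] := HG q (or_introl eq_refl).
  exists (n + m) => r [<-|/Hn]; by [apply: Gst_le Hm; lia|apply: Gst_le; lia].
by apply: (@Om_prv n); apply: prv_weaken Hp Hn.
Qed.

Lemma Om_provable p : provable T p -> Om p.
Proof. by apply: Om_closed. Qed.

Lemma Om_Bot : ~ Om Bot.
Proof. by move=> [n Hn]; apply: (@Gst_consistent n); apply: prv_hyp. Qed.

Lemma Om_or_Not p : Om p \/ Om (Not p).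
Proof.
have [n /(_ n (le_n n)) [[Hp|Hp] _]] := Gst_treats p; first by left; exists n.
by right; apply: Om_prv Hp.
Qed.

Lemma Om_Imp p q : Om (Imp p q) <-> (Om p -> Om q).
Proof.
split=> [Hpq Hp|H].
  apply: (@Om_closed [Imp p q; p]) => [r [<-|[<-|[]]]//|].
  by apply: prv_ImpE; apply: prv_hyp; [left|right; left].
case: (Om_or_Not p) => Hp.
  by apply: (@Om_closed [q]) (prv_ImpI (prv_tl p (prv_hd _ _ _))) => r [<-|[]]; apply: H.
apply: (@Om_closed [Not p]) => [r [<-|[]]//|].
apply/prv_ImpI/prv_exfalso/(@prv_ImpE _ _ p _); apply: prv_hyp; by [right; left|left].
Qed.

Lemma Om_AllNum q : Om (AllNum q) <-> forall t, Om (instN t q).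
Proof.
split=> [H t|H].
  apply: (@Om_closed [AllNum q]) => [r [<-|[]]//|].
  exact/prv_AllNE/prv_hd.
case: (Om_or_Not (AllNum q)) => // -[n Hn].
have [m /(_ (n + m)) [|_ [HN _]]] := Gst_treats (Not (AllNum q)); first lia.
have [|t Ht] := HN _ q eq_refl; first by apply: Gst_le Hn; lia.
case: Om_Bot; apply/Om_Imp: (H t); by exists (n + m).
Qed.

Lemma Om_AllSet q : Om (AllSet q) <-> forall X, Om (instS X q).
Proof.
split=> [H X|H].
  apply: (@Om_closed [AllSet q]) => [r [<-|[]]//|].
  exact/prv_AllSE/prv_hd.
case: (Om_or_Not (AllSet q)) => // -[n Hn].
have [m /(_ (n + m)) [|_ [_ HS]]] := Gst_treats (Not (AllSet q)); first lia.
have [|X HX] := HS _ q eq_refl; first by apply: Gst_le Hn; lia.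
case: Om_Bot; apply/Om_Imp: (H X); by exists (n + m).
Qed.

Lemma Om_refl t : Om (EqN t t).
Proof. by apply/Om_provable/prv_refl. Qed.

Lemma Om_sym s t : Om (EqN s t) -> Om (EqN t s).
Proof.
by move=> H; apply: (@Om_closed [EqN s t]) => [r [<-|[]]//|]; apply/prv_eq_sym/prv_hd.
Qed.

Lemma Om_leibniz s t p : Om (EqN s t) -> Om (instN s p) -> Om (instN t p).
Proof.
move=> H1 H2; apply: (@Om_closed [EqN s t; instN s p]) => [r [<-|[<-|[]]]//|].
by apply: (@prv_leibniz _ _ s t); apply: prv_hyp; [left|right; left].
Qed.

Lemma Om_trans s t u : Om (EqN s t) -> Om (EqN t u) -> Om (EqN s u).
Proof.
move=> H1 H2; apply: (@Om_closed [EqN s t; EqN t u]) => [r [<-|[<-|[]]]//|].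
by apply: (@prv_eq_trans _ _ s t u); apply: prv_hyp; [left|right; left].
Qed.

(** * The term model *)

Definition tclass : Type := quot (fun s t => Om (EqN s t)).
Local Notation cls := (@cls _ (fun s t => Om (EqN s t))).

Lemma tcls_eq s t : cls s = cls t <-> Om (EqN s t).
Proof.
apply: cls_eq => [u|u v|u v w]; [exact: Om_refl|exact: Om_sym|exact: Om_trans].
Qed.

Lemma rep_cls t : Om (EqN (rep (cls t)) t).
Proof. by apply/tcls_eq; rewrite repK. Qed.

(** [c] stands for [Plus] or [Times]; the two arguments are replaced one after the other. *)
Lemma Om_eq_congr2 (c : term -> term -> term) s t s' t' :
  (forall (u v : term) sigma, tsubst sigma (c u v) = c (tsubst sigma u) (tsubst sigma v)) ->
  Om (EqN s s') -> Om (EqN t t') -> Om (EqN (c s t) (c s' t')).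
Proof.
move=> Hc H1 H2; apply: (@Om_closed [EqN s s'; EqN t t']) => [r [<-|[<-|[]]]//|].
apply: (@prv_eq_trans _ _ _ (c s' t)).
  have := @prv_eq_congr T [EqN s s'; EqN t t'] (c (Var 0) (tshift t)) s s'.
  rewrite !Hc /= !tsubst_scons_tshift !tsubst_id; apply; exact: prv_hd.
have := @prv_eq_congr T [EqN s s'; EqN t t'] (c (tshift s') (Var 0)) t t'.
rewrite !Hc /= !tsubst_scons_tshift !tsubst_id; apply; exact/prv_tl/prv_hd.
Qed.

Lemma Om_lt_congr s t s' t' :
  Om (EqN s s') -> Om (EqN t t') -> Om (LtN s t) -> Om (LtN s' t').
Proof.
move=> H1 H2 H.
have := Om_leibniz (p := LtN (Var 0) (tshift t)) H1.
rewrite /instN /= !tsubst_scons_tshift !tsubst_id => /(_ H) H'.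
have := Om_leibniz (p := LtN (tshift s') (Var 0)) H2.
by rewrite /instN /= !tsubst_scons_tshift !tsubst_id; apply.
Qed.

Lemma Om_mem_congr s s' X : Om (EqN s s') -> Om (Mem s X) -> Om (Mem s' X).
Proof. by move=> H1 H; exact: (Om_leibniz (p := Mem (Var 0) X) H1). Qed.

(** Since equality is primitive for numbers only, terms are divided by provable equality while the
    sets are simply the set variables. *)
Definition term_model : structure := {|
  num := tclass;
  sets := nat;
  zeroM := cls Zero;
  oneM := cls One;
  addM x y := cls (Plus (rep x) (rep y));
  mulM x y := cls (Times (rep x) (rep y));
  ltM x y := Om (LtN (rep x) (rep y));
  elemM x X := Om (Mem (rep x) X) |}.

Lemma eval_term_model (sigma : nat -> term) t :
  eval (M := term_model) (fun i => cls (sigma i)) t = cls (tsubst sigma t).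
Proof.
elim: t => //= s -> u ->; apply/tcls_eq; apply: Om_eq_congr2 => //; exact: rep_cls.
Qed.

Lemma truth_lemma p sigma rho :
  sat (M := term_model) (fun i => cls (sigma i)) rho p <-> Om (subst sigma rho p).
Proof.
elim: p sigma rho => [s t|s t|t X||p IHp q IHq|p IHp|p IHp] sigma rho /=;
  rewrite ?eval_term_model.
- exact: tcls_eq.
- by split; apply: Om_lt_congr; try exact: rep_cls; apply: Om_sym; exact: rep_cls.
- by split; apply: Om_mem_congr; try exact: rep_cls; apply: Om_sym; exact: rep_cls.
- by split=> // /Om_Bot.
- by rewrite Om_Imp IHp IHq.
- rewrite Om_AllNum; have E t : scons (cls t) (fun i => cls (sigma i)) =
      fun i => cls (scons t sigma i) by apply: functional_extensionality => -[].
  split=> H x; first by rewrite instN_upN -IHp -E; apply: H.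
  by rewrite -(repK x) (E (rep x)) IHp -instN_upN; apply: H.
- by rewrite Om_AllSet; split=> H X; move: (H X); rewrite instS_upS IHp.
Qed.

Lemma term_model_is_model : is_model T term_model.
Proof.
move=> p Tp s r.
have -> : s = fun i => cls (rep (s i)).
  by apply: functional_extensionality => i; rewrite repK.
by apply/truth_lemma/Om_provable/provable_subst/prv_ax.
Qed.

Lemma term_model_refutes : ~ sat (M := term_model) (fun i => cls (Var i)) (fun X => X) p0.
Proof.
rewrite truth_lemma subst_id => H; apply: Om_Bot.
have/Om_Imp: Om (Not p0) by exists 0; left.
by apply.
Qed.

End Henkin.

Theorem completeness (T : form -> Prop) (p : form) :
  (forall M, is_model T M -> forall (s : nat -> num M) (r : nat -> sets M), sat s r p) ->
  provable T p.
Proof.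
move=> H; apply: NNPP => np; apply: (term_model_refutes (p0_unprovable := np)).
exact/H/term_model_is_model.
Qed.

(** * Definability in a structure *)

(** Interleaves two environments, [f] at even and [g] at odd positions, so that two formulas with
    parameters of their own can share one environment. *)
Fixpoint mrg {A : Type} (f g : nat -> A) (i : nat) : A :=
  match i with 0 => f 0 | S j => mrg g (fun k => f (S k)) j end.

Lemma mrg_l {A : Type} (f g : nat -> A) i : mrg f g (i + i) = f i.
Proof.
elim: i f g => [|i IH] f g //=.
by rewrite -plus_n_Sm /= IH.
Qed.

Lemma mrg_r {A : Type} (f g : nat -> A) i : mrg f g (S (i + i)) = g i.
Proof. exact: mrg_l. Qed.

Lemma mrg_ind {A : Type} (P : A -> Prop) (f g : nat -> A) :
  (forall i, P (f i)) -> (forall i, P (g i)) -> forall i, P (mrg f g i).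
Proof.
move=> Hf Hg i; elim: i f g Hf Hg => [|i IH] f g Hf Hg /=; first exact: Hf.
by apply: IH => // k; apply: Hf.
Qed.

Lemma mrg_app {A B : Type} (f g : nat -> A -> B) i (c : A) :
  mrg f g i c = mrg (fun j => f j c) (fun j => g j c) i.
Proof. by elim: i f g => [|i IH] f g //=; rewrite IH. Qed.

Section Definability.
Variable M : rca.
Implicit Types (K : form -> Prop).

Fixpoint ctx (n : nat) : Type :=
  match n with 0 => unit | S n => (ctx n * num M)%type end.

(** The constants and the coordinate functions. *)
Fixpoint proj (n : nat) : (ctx n -> num M) -> Prop :=
  match n with
  | 0 => fun _ => True
  | S n => fun f => (forall c, f c = snd c)
                    \/ exists h, @proj n h /\ forall c, f c = h (fst c)
  end.

(** Number parameters enter through the constants among the [g i]. *)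
Definition definable K n (P : ctx n -> Prop) : Prop :=
  exists (p : form) (r : nat -> sets M) (g : nat -> ctx n -> num M),
    K p /\ (forall i, proj (g i)) /\ forall c, sat (M := M) (fun i => g i c) r p <-> P c.

Definition DT n (f : ctx n -> num M) : Prop :=
  exists (t : term) (g : nat -> ctx n -> num M),
    (forall i, proj (g i)) /\ forall c, eval (M := M) (fun i => g i c) t = f c.

Definition D0 n (P : ctx n -> Prop) : Prop := definable Delta00 P.

(** Defined through a semantic quantifier, so that closure properties can be proved without building
    formulas; [S1_definable] returns to the syntax. *)
Definition S1 n (P : ctx n -> Prop) : Prop :=
  exists Q : ctx (S n) -> Prop, D0 Q /\ forall c, P c <-> exists x, Q (c, x).

Definition D1 n (P : ctx n -> Prop) : Prop := S1 P /\ S1 (fun c => ~ P c).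

(** As the function is total, the complement of such a graph is [S1] too: a number differs from the
    value if the value is some other number. *)
Definition R1 n (f : ctx n -> num M) : Prop :=
  S1 (n := S n) (fun c => snd c = f (fst c)).

Lemma proj_const n a : proj (n := n) (fun _ => a).
Proof. by elim: n => [|n IH] //=; right; exists (fun _ => a). Qed.

Lemma proj_snd n : proj (n := S n) (fun c => snd c).
Proof. by left. Qed.

Lemma proj_fst n f : proj (n := n) f -> proj (n := S n) (fun c => f (fst c)).
Proof. by move=> H; right; exists f. Qed.

Lemma proj_fst_eq n f (h : ctx n -> num M) :
  (forall c, f c = h (fst c)) -> proj h -> proj (n := S n) f.
Proof. by move=> E Hh; right; exists h. Qed.

(** Separates the variables that read the last coordinate from those that read the others, which
    makes the last coordinate available for binding: it becomes variable 0. *)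
Lemma proj_split n (g : nat -> ctx (S n) -> num M) : (forall i, proj (g i)) ->
  exists (tau : nat -> nat) (h : nat -> ctx n -> num M), (forall i, proj (h i)) /\
  forall i c, g i c = scons (snd c) (fun j => h j (fst c)) (tau i).
Proof.
move=> Hg.
have H i : exists kh : nat * (ctx n -> num M), proj (snd kh) /\ (fst kh = 0 \/ fst kh = S i) /\
    forall c, g i c = match fst kh with 0 => snd c | _ => snd kh (fst c) end.
  case: (Hg i) => [E|[h [Hh E]]].
    exists (0, fun _ => zeroM M); split; first exact: proj_const.
    by split; [left|].
  by exists (S i, h); split=> //; split; [right|].
pose kh i := proj1_sig (constructive_indefinite_description _ (H i)).
have Hkh i : proj (snd (kh i)) /\ (fst (kh i) = 0 \/ fst (kh i) = S i) /\
    forall c, g i c = match fst (kh i) with 0 => snd c | _ => snd (kh i) (fst c) end.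
  exact: (proj2_sig (constructive_indefinite_description _ (H i))).
exists (fun i => fst (kh i)), (fun i => snd (kh i)); split=> [i|i c].
  by case: (Hkh i).
by have [_ [[E|E] ->]] := Hkh i; rewrite E.
Qed.

Definition closed_subst K : Prop := forall p sigma rho, K p -> K (subst sigma rho p).

Lemma Delta00_subst : closed_subst Delta00.
Proof.
move=> p sigma rho H; elim: H sigma rho => {p} /=; try by constructor.
- by move=> t p _ IH sigma rho; rewrite tsubst_tshift; constructor.
- move=> t p _ IH sigma rho; rewrite tsubst_tshift; exact: (Delta00_bex _ _ (IH _ _)).
Qed.

Lemma Sigma01_subst : closed_subst Sigma01.
Proof. move=> p sigma rho [q H]; exact/Sigma01_intro/Delta00_subst. Qed.

Lemma Pi01_subst : closed_subst Pi01.
Proof. move=> p sigma rho [q H]; exact/Pi01_intro/Delta00_subst. Qed.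

Lemma sat_rename (p : form) (s s' : nat -> num M) r r' tau rho :
  (forall i, s i = s' (tau i)) -> (forall i, r i = r' (rho i)) ->
  sat s r p <-> sat s' r' (subst (fun i => Var (tau i)) rho p).
Proof.
move=> Hs Hr; rewrite sat_subst /=.
by rewrite (functional_extensionality _ _ Hs) (functional_extensionality _ _ Hr).
Qed.

Lemma definable_pair K K' n (P Q : ctx n -> Prop) :
  closed_subst K -> closed_subst K' -> definable K P -> definable K' Q ->
  exists p q r (g : nat -> ctx n -> num M), K p /\ K' q /\ (forall i, proj (g i)) /\
    (forall c, sat (M := M) (fun i => g i c) r p <-> P c) /\
    (forall c, sat (M := M) (fun i => g i c) r q <-> Q c).
Proof.
move=> cK cK' [p [r [g [Kp [Hg Hp]]]]] [q [r' [g' [Kq [Hg' Hq]]]]].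
exists (subst (fun i => Var (i + i)) (fun i => i + i) p).
exists (subst (fun i => Var (S (i + i))) (fun i => S (i + i)) q).
exists (mrg r r'), (mrg g g').
split; [exact: cK|split; [exact: cK'|split; [exact: mrg_ind|split=> c]]].
- by rewrite -Hp -(sat_rename p (s := fun i => g i c) (r := r)) // => i;
    rewrite ?mrg_app ?mrg_l.
- by rewrite -Hq -(sat_rename q (s := fun i => g' i c) (r := r')) // => i;
    rewrite ?mrg_app ?mrg_r.
Qed.

Lemma definable_ext K n (P Q : ctx n -> Prop) :
  (forall c, P c <-> Q c) -> definable K P -> definable K Q.
Proof.
by move=> E [p [r [g [Kp [Hg Hp]]]]]; exists p, r, g; split=> //; split=> // c; rewrite -E.
Qed.

Lemma D0_ext n (P Q : ctx n -> Prop) : (forall c, P c <-> Q c) -> D0 P -> D0 Q.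
Proof. exact: definable_ext. Qed.

Lemma S1_ext n (P Q : ctx n -> Prop) : (forall c, P c <-> Q c) -> S1 P -> S1 Q.
Proof. by move=> E [R [DR HR]]; exists R; split=> // c; rewrite -E. Qed.

Lemma DT_pair n (f g : ctx n -> num M) : DT f -> DT g ->
  exists t u (h : nat -> ctx n -> num M), (forall i, proj (h i)) /\
    (forall c, eval (M := M) (fun i => h i c) t = f c) /\
    (forall c, eval (M := M) (fun i => h i c) u = g c).
Proof.
move=> [t [k [Hk Ht]]] [u [l [Hl Hu]]].
exists (tsubst (fun i => Var (i + i)) t), (tsubst (fun i => Var (S (i + i))) u), (mrg k l).
split; [exact: mrg_ind|split=> c; rewrite eval_tsubst -?Ht -?Hu].
- by f_equal; apply: functional_extensionality => i; rewrite [eval _ _]/= mrg_l.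
- by f_equal; apply: functional_extensionality => i; exact: (f_equal (fun F => F c) (mrg_r k l i)).
Qed.

Lemma DT_proj n (f : ctx n -> num M) : proj f -> DT f.
Proof. by move=> Hf; exists (Var 0), (fun _ => f). Qed.

Lemma DT_zero n : DT (n := n) (fun _ => zeroM M).
Proof. exact/DT_proj/proj_const. Qed.

Lemma DT_one n : DT (n := n) (fun _ => oneM M).
Proof. exact/DT_proj/proj_const. Qed.

Lemma DT_add n (f g : ctx n -> num M) : DT f -> DT g -> DT (fun c => addM (f c) (g c)).
Proof.
move=> Hf Hg; have [t [u [h [Hh [Ht Hu]]]]] := DT_pair Hf Hg.
by exists (Plus t u), h; split=> // c /=; rewrite Ht Hu.
Qed.

Lemma DT_mul n (f g : ctx n -> num M) : DT f -> DT g -> DT (fun c => mulM (f c) (g c)).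
Proof.
move=> Hf Hg; have [t [u [h [Hh [Ht Hu]]]]] := DT_pair Hf Hg.
by exists (Times t u), h; split=> // c /=; rewrite Ht Hu.
Qed.

Lemma DT_fst n (f : ctx n -> num M) : DT f -> DT (n := S n) (fun c => f (fst c)).
Proof.
move=> [t [g [Hg Ht]]]; exists t, (fun i c => g i (fst c)).
by split=> [i|c]; [apply: proj_fst|apply: Ht].
Qed.

Lemma D0_eq n (f g : ctx n -> num M) : DT f -> DT g -> D0 (fun c => f c = g c).
Proof.
move=> Hf Hg; have [t [u [h [Hh [Ht Hu]]]]] := DT_pair Hf Hg.
exists (EqN t u), (fun _ => some_set M), h; split; first by constructor.
by split=> // c /=; rewrite Ht Hu.
Qed.

Lemma D0_lt n (f g : ctx n -> num M) : DT f -> DT g -> D0 (fun c => ltM (f c) (g c)).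
Proof.
move=> Hf Hg; have [t [u [h [Hh [Ht Hu]]]]] := DT_pair Hf Hg.
exists (LtN t u), (fun _ => some_set M), h; split; first by constructor.
by split=> // c /=; rewrite Ht Hu.
Qed.

Lemma D0_mem n (f : ctx n -> num M) X : DT f -> D0 (fun c => elemM (f c) X).
Proof.
move=> [t [h [Hh Ht]]].
exists (Mem t 0), (fun _ => X), h; split; first by constructor.
by split=> // c /=; rewrite Ht.
Qed.

Lemma D0_False n : D0 (n := n) (fun _ => False).
Proof.
exists Bot, (fun _ => some_set M), (fun _ _ => zeroM M); split; first by constructor.
by split=> // i; apply: proj_const.
Qed.

Lemma D0_imp n (P Q : ctx n -> Prop) : D0 P -> D0 Q -> D0 (fun c => P c -> Q c).
Proof.
move=> HP HQ.
have [p [q [r [g [Dp [Dq [Hg [Hp Hq]]]]]]]] :=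
  definable_pair Delta00_subst Delta00_subst HP HQ.
exists (Imp p q), r, g; split; first by constructor.
by split=> // c /=; rewrite Hp Hq.
Qed.

Lemma D0_not n (P : ctx n -> Prop) : D0 P -> D0 (fun c => ~ P c).
Proof. move=> HP; exact/D0_imp/D0_False. Qed.

Lemma D0_and n (P Q : ctx n -> Prop) : D0 P -> D0 Q -> D0 (fun c => P c /\ Q c).
Proof.
move=> HP HQ; apply: (@D0_ext _ (fun c => ~ (P c -> ~ Q c))) => [c|].
  split=> [H|[HP1 HQ1] H]; [apply: NNPP => N; apply: H => ? ?; exact: N|exact: H].
exact/D0_not/D0_imp/D0_not.
Qed.

Lemma D0_or n (P Q : ctx n -> Prop) : D0 P -> D0 Q -> D0 (fun c => P c \/ Q c).
Proof.
move=> HP HQ; apply: (@D0_ext _ (fun c => ~ P c -> Q c)) => [c|]; first by tauto.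
by apply: D0_imp => //; apply: D0_not.
Qed.

Lemma D0_iff n (P Q : ctx n -> Prop) : D0 P -> D0 Q -> D0 (fun c => P c <-> Q c).
Proof. by move=> HP HQ; apply: D0_and; apply: D0_imp. Qed.

Lemma D0_ball n (f : ctx n -> num M) (P : ctx n -> num M -> Prop) :
  DT f -> D0 (n := S n) (fun c => P (fst c) (snd c)) ->
  D0 (fun c => forall x, ltM x (f c) -> P c x).
Proof.
move=> [t [k [Hk Ht]]] [p [r [g [Dp [Hg Hp]]]]].
have [tau [h [Hh Eg]]] := proj_split Hg.
(* The merged environment holds the parameters of the bound at even and those of [p] at odd
   positions. [nu] keeps the bound variable 0 and sends parameter [j] to position [S (j + j)], one
   further because of the binder. *)
pose nu i := match i with 0 => 0 | S j => S (S (j + j)) end.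
exists (AllNum (Imp (LtN (Var 0) (tshift (tsubst (fun i => Var (i + i)) t)))
          (subst (fun i => Var (nu (tau i))) (fun X => X) p))), r, (mrg k h).
split; first by constructor; apply: Delta00_subst.
split=> [|c]; first exact: mrg_ind.
have E x : sat (scons x (fun i => mrg k h i c)) r
    (subst (fun i => Var (nu (tau i))) (fun X => X) p) <-> P c x.
  rewrite -(Hp (c, x)) -(sat_rename p (s := fun i => g i (c, x))) // => i.
  rewrite Eg /=; case: (tau i) => [|j] //=.
  exact: (f_equal (fun F => F c) (eq_sym (mrg_r k h j))).
have Et x : eval (scons x (fun i => mrg k h i c)) (tshift (tsubst (fun i => Var (i + i)) t)) =
    f c.
  rewrite /tshift !eval_tsubst -Ht /=; f_equal; apply: functional_extensionality => i /=.
  by rewrite mrg_app mrg_l.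
split=> H x; first by rewrite -(Et x) -(E x); apply: H.
move: (H x); rewrite -(Et x) -(E x); exact.
Qed.

Lemma D0_bex n (f : ctx n -> num M) (P : ctx n -> num M -> Prop) :
  DT f -> D0 (n := S n) (fun c => P (fst c) (snd c)) ->
  D0 (fun c => exists x, ltM x (f c) /\ P c x).
Proof.
move=> Hf HP; apply: (@D0_ext _ (fun c => ~ forall x, ltM x (f c) -> ~ P c x)) => [c|].
  split=> [H|[x [xf Px]] H]; last exact: H Px.
  by apply: NNPP => N; apply: H => x xf Px; apply: N; exists x.
by apply/D0_not/D0_ball => //; apply: D0_not.
Qed.

(** [th] may permute, drop, repeat or fix coordinates: it is a substitution of variables and
    constants, not of compound terms. *)
Lemma D0_reindex m n (th : ctx m -> ctx n) (P : ctx n -> Prop) :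
  (forall f, proj f -> proj (fun c => f (th c))) ->
  D0 P -> D0 (fun c => P (th c)).
Proof.
move=> Hth [p [r [g [Dp [Hg Hp]]]]]; exists p, r, (fun i c => g i (th c)).
by split=> //; split=> // i; apply: Hth.
Qed.

Lemma reindex_fst n f : proj (n := n) f -> proj (n := S n) (fun c => f (fst c)).
Proof. exact: proj_fst. Qed.

Lemma reindex_up m n (th : ctx m -> ctx n) :
  (forall f, proj f -> proj (fun c => f (th c))) ->
  forall f : ctx (S n) -> num M, proj f -> proj (n := S m) (fun c => f (th (fst c), snd c)).
Proof.
move=> Hth f [E|[h [Hh E]]]; first by left.
by right; exists (fun c => h (th c)); split=> //; apply: Hth.
Qed.

Lemma reindex_pair m n (th : ctx m -> ctx n) (a : ctx m -> num M) :
  (forall f, proj f -> proj (fun c => f (th c))) -> proj a ->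
  forall f : ctx (S n) -> num M, proj f -> proj (fun c => f (th c, a c)).
Proof.
move=> Hth Ha f [E|[h [Hh E]]].
  have -> : (fun c => f (th c, a c)) = a by apply: functional_extensionality => c; rewrite E.
  by [].
have -> : (fun c => f (th c, a c)) = fun c => h (th c).
  by apply: functional_extensionality => c; rewrite E.
exact: Hth.
Qed.

Lemma S1_reindex m n (th : ctx m -> ctx n) (P : ctx n -> Prop) :
  (forall f, proj f -> proj (fun c => f (th c))) ->
  S1 P -> S1 (fun c => P (th c)).
Proof.
move=> Hth [Q [DQ HQ]]; exists (fun c => Q (th (fst c), snd c)).
split=> [|c]; last exact: HQ.
apply: (D0_reindex (m := S m) (n := S n) (th := fun c => (th (fst c), snd c)) _ DQ).
exact: reindex_up.
Qed.

Lemma D0_S1 n (P : ctx n -> Prop) : D0 P -> S1 P.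
Proof.
move=> H; exists (fun c => P (fst c)); split=> [|c].
  exact: D0_reindex (@reindex_fst _) H.
by split=> [Pc|[_ //]]; exists (zeroM M).
Qed.

Lemma S1_definable n (P : ctx n -> Prop) : S1 P -> definable Sigma01 P.
Proof.
move=> [Q [[q [r [g [Dq [Hg Hq]]]]] HQ]].
have [tau [h [Hh Eg]]] := proj_split Hg.
exists (ExNum (subst (fun i => Var (tau i)) (fun X => X) q)), r, h.
split; first by constructor; apply: Delta00_subst.
split=> // c; rewrite HQ.
have E x : sat (scons x (fun i => h i c)) r (subst (fun i => Var (tau i)) (fun X => X) q)
    <-> Q (c, x).
  by rewrite -Hq -(sat_rename q (s := fun i => g i (c, x))) // => i; rewrite Eg.
split=> [/= H|[x /E Hx] /= H]; last exact: H Hx.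
by apply: NNPP => N; apply: H => x /E Hx; apply: N; exists x.
Qed.

Lemma notS1_definable n (P : ctx n -> Prop) : S1 (fun c => ~ P c) -> definable Pi01 P.
Proof.
move=> [Q [[q [r [g [Dq [Hg Hq]]]]] HQ]].
have [tau [h [Hh Eg]]] := proj_split Hg.
exists (AllNum (Not (subst (fun i => Var (tau i)) (fun X => X) q))), r, h.
split; first by constructor; apply: (@Delta00_subst (Not q)); constructor=> //; constructor.
split=> // c.
have E x : sat (scons x (fun i => h i c)) r (subst (fun i => Var (tau i)) (fun X => X) q)
    <-> Q (c, x).
  by rewrite -Hq -(sat_rename q (s := fun i => g i (c, x))) // => i; rewrite Eg.
split=> [/= H|Pc x /E Hx]; last by apply: (proj2 (HQ c)) Pc; exists x.
by apply: NNPP => /HQ [x /E]; apply: H.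
Qed.

(** Brings an environment into the form of the axiom schemata, with variable 0 distinguished and
    constant parameters elsewhere. *)
Lemma unary_env (g : nat -> ctx 1 -> num M) : (forall i, proj (g i)) ->
  exists tau s, forall i x, g i (tt, x) = scons x s (tau i).
Proof.
move=> Hg; have [tau [h [_ Eg]]] := proj_split Hg.
by exists tau, (fun j => h j tt) => i x; rewrite Eg.
Qed.

End Definability.

(** * Induction and comprehension *)

Section Schemata.
Variable M : rca.

Lemma sat_Iff (s : nat -> num M) r p q : sat s r (Iff p q) <-> (sat s r p <-> sat s r q).
Proof. by rewrite /Iff /And /Not /=; tauto. Qed.

Lemma sat_ExSet (s : nat -> num M) r p :
  sat s r (ExSet p) <-> exists X, sat s (scons X r) p.
Proof.
split=> [/= H|[X HX] /= H]; last exact: H HX.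
by apply: NNPP => N; apply: H => X HX; apply: N; exists X.
Qed.

Lemma sat_comprehension (s : nat -> num M) r p :
  sat s r (comprehension_axiom p) <->
  exists X, forall x, elemM x X <-> sat (scons x s) r p.
Proof.
rewrite /comprehension_axiom sat_ExSet.
have E X x : sat (scons x s) (scons X r) (Iff (Mem (Var 0) 0) (shiftS p)) <->
    (elemM x X <-> sat (scons x s) r p).
  by rewrite sat_Iff /shiftS sat_subst.
by split=> -[X HX]; exists X => x; apply/E; exact: HX.
Qed.

Lemma sat_induction (s : nat -> num M) r p : sat s r (induction_axiom p) <->
  (sat (scons (zeroM M) s) r p ->
   (forall x, sat (scons x s) r p -> sat (scons (addM x (oneM M)) s) r p) ->
   forall x, sat (scons x s) r p).
Proof.
rewrite /induction_axiom /instN /= sat_subst.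
have -> : (fun i => eval s (scons Zero Var i)) = scons (zeroM M) s.
  by apply: functional_extensionality => -[].
have E x : sat (scons x s) r (subst (scons (Plus (Var 0) One) (fun i => Var (S i)))
    (fun X => X) p) <-> sat (scons (addM x (oneM M)) s) r p.
  rewrite sat_subst (_ : (fun i => eval _ _) = scons (addM x (oneM M)) s) //.
  by apply: functional_extensionality => -[].
split=> H H0 HS; apply: H => // x; first by rewrite E; apply: HS.
by move=> /HS /E.
Qed.

Let HM := @str_model M.

Lemma S1_ind (P : num M -> Prop) : S1 (n := 1) (fun c => P (snd c)) ->
  P (zeroM M) -> (forall x, P x -> P (addM x (oneM M))) -> forall x, P x.
Proof.
move=> /S1_definable [p [r [g [Sp [Hg Hp]]]]].
have [tau [s Eg]] := unary_env Hg.
have E x : sat (scons x s) r (subst (fun i => Var (tau i)) (fun X => X) p) <-> P x.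
  by rewrite -(Hp (tt, x)) -(sat_rename p (s := fun i => g i (tt, x))).
have := HM (RCA0_induction _ (Sigma01_subst (fun i => Var (tau i)) (fun X => X) Sp)) s r.
rewrite sat_induction E => H H0 HS x; apply/E/H=> // y /E /HS Hy.
exact/E.
Qed.

Lemma D1_comprehension (P : num M -> Prop) : D1 (n := 1) (fun c => P (snd c)) ->
  exists X, forall x, elemM x X <-> P x.
Proof.
move=> [/S1_definable HP /notS1_definable HQ].
have [p [q [r [g [Sp [Pq [Hg [Hp Hq]]]]]]]] :=
  definable_pair Sigma01_subst Pi01_subst HP HQ.
have [tau [s Eg]] := unary_env Hg.
have E p' x : sat (scons x s) r (subst (fun i => Var (tau i)) (fun X => X) p') <->
    sat (M := M) (fun i => g i (tt, x)) r p'.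
  by rewrite -(sat_rename p' (s := fun i => g i (tt, x))).
have H := HM (RCA0_comprehension _ _
  (Sigma01_subst (fun i => Var (tau i)) (fun X => X) Sp)
  (Pi01_subst (fun i => Var (tau i)) (fun X => X) Pq)) s r.
have/sat_comprehension [X HX] : sat s r (comprehension_axiom
    (subst (fun i => Var (tau i)) (fun X => X) p)).
  apply: (H : (forall x, sat (scons x s) r (Iff _ _)) -> _) => x.
  by rewrite sat_Iff !E Hp Hq.
by exists X => x; rewrite HX E Hp.
Qed.

End Schemata.

(** * Arithmetic *)

Declare Scope dom_scope.
Delimit Scope dom_scope with M.
Bind Scope dom_scope with num.

Definition leM (M : structure) (x y : num M) : Prop := ltM x (addM y (oneM M)).

Notation "0" := (zeroM _) : dom_scope.
Notation "1" := (oneM _) : dom_scope.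
Notation "x + y" := (addM x y) : dom_scope.
Notation "x * y" := (mulM x y) : dom_scope.
Notation "x < y" := (ltM x y) : dom_scope.
Notation "x <= y" := (leM x y) : dom_scope.
(** [dfn_proj], [dfn_term] and [dfn] prove [proj], [DT] and [D0] by following the shape of the
    function or predicate. *)
Ltac dfn_factor := intros [? ?]; cbn [fst snd]; reflexivity.
Ltac dfn_proj :=
  cbv beta; first
  [ apply proj_const | apply proj_snd
  | eapply proj_fst_eq; [dfn_factor|dfn_proj] ].
Ltac dfn_term := cbv beta; first
  [ apply DT_zero | apply DT_one
  | apply DT_add; dfn_term | apply DT_mul; dfn_term
  | apply DT_proj; dfn_proj ].
Ltac dfn := cbv beta; first
  [ apply D0_ball; [dfn_term|dfn] | apply D0_bex; [dfn_term|dfn]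
  | apply D0_and; dfn | apply D0_or; dfn | apply D0_iff; dfn
  | apply D0_eq; dfn_term | apply D0_lt; dfn_term | apply D0_mem; dfn_term
  | apply D0_False | apply D0_not; dfn | apply D0_imp; dfn ].

Section Arithmetic.
Local Open Scope dom_scope.
Variable M : rca.
Implicit Types x y z u v w : num M.

Let env2 x y : nat -> num M := scons x (fun _ => y).

Lemma basic k m n : (k < 8)%nat ->
  sat (env2 m n) (fun _ => some_set M) (nth k basic_axioms Bot).
Proof. by move=> H; apply/(@str_model M)/RCA0_basic/nth_In. Qed.

Lemma num_succ_neq0 x : x + 1 <> 0.
Proof. by apply: (@basic 0 x x); lia. Qed.

Lemma num_succ_inj x y : x + 1 = y + 1 -> x = y.
Proof. by apply: (@basic 1 x y); lia. Qed.

Lemma num_addx0 x : x + 0 = x.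
Proof. by apply: (@basic 2 x x); lia. Qed.

Lemma num_addxS x y : x + (y + 1) = x + y + 1.
Proof. by apply: (@basic 3 x y); lia. Qed.

Lemma num_mulx0 x : x * 0 = 0.
Proof. by apply: (@basic 4 x x); lia. Qed.

Lemma num_mulxS x y : x * (y + 1) = x * y + x.
Proof. by apply: (@basic 5 x y); lia. Qed.

Lemma num_ltx0 x : ~ x < 0.
Proof. by apply: (@basic 6 x x); lia. Qed.

Lemma num_ltxS x y : x < y + 1 <-> x < y \/ x = y.
Proof.
have /sat_Iff /= := @basic 7 x y ltac:(lia).
by tauto.
Qed.

Lemma D0_ind (P : num M -> Prop) : D0 (n := 1) (fun c => P (snd c)) ->
  P 0 -> (forall x, P x -> P (x + 1)) -> forall x, P x.
Proof. by move=> /D0_S1; apply: S1_ind. Qed.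

Lemma num_add0x x : 0 + x = x.
Proof. by move: x; apply: D0_ind => [||x IH]; [dfn|rewrite num_addx0|rewrite num_addxS IH]. Qed.

Lemma num_addSx x y : x + 1 + y = x + y + 1.
Proof. by move: y; apply: D0_ind => [||y IH]; [dfn|rewrite !num_addx0|rewrite !num_addxS IH]. Qed.

Lemma num_addC x y : x + y = y + x.
Proof.
by move: y; apply: D0_ind => [||y IH];
  [dfn|rewrite num_add0x num_addx0|rewrite num_addxS num_addSx IH].
Qed.

Lemma num_addA x y z : x + (y + z) = x + y + z.
Proof. by move: z; apply: D0_ind => [||z IH]; [dfn|rewrite !num_addx0|rewrite !num_addxS IH]. Qed.

Lemma num_mul0x x : 0 * x = 0.
Proof.
by move: x; apply: D0_ind => [||x IH]; [dfn|rewrite num_mulx0|rewrite num_mulxS IH num_addx0].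
Qed.

Lemma num_mulSx x y : (x + 1) * y = x * y + y.
Proof.
move: y; apply: D0_ind => [||y IH]; [dfn|by rewrite !num_mulx0 num_addx0|].
by rewrite !num_mulxS IH !num_addxS -(num_addA _ x y) (num_addC x y) num_addA.
Qed.

Lemma num_mulC x y : x * y = y * x.
Proof.
by move: y; apply: D0_ind => [||y IH];
  [dfn|rewrite num_mul0x num_mulx0|rewrite num_mulxS num_mulSx IH].
Qed.

Lemma num_mulDr x y z : x * (y + z) = x * y + x * z.
Proof.
by move: z; apply: D0_ind => [||z IH];
  [dfn|rewrite num_mulx0 !num_addx0|rewrite num_addxS !num_mulxS IH num_addA].
Qed.

Lemma num_mulDl x y z : (y + z) * x = y * x + z * x.
Proof. by rewrite !(num_mulC _ x) num_mulDr. Qed.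

Lemma num_mulA x y z : x * (y * z) = x * y * z.
Proof.
by move: z; apply: D0_ind => [||z IH]; [dfn|rewrite !num_mulx0|rewrite !num_mulxS num_mulDr IH].
Qed.

Lemma num_mulx1 x : x * 1 = x.
Proof. by rewrite -[1%M]num_add0x num_mulxS num_mulx0 num_add0x. Qed.

Lemma num_mul1x x : 1 * x = x.
Proof. by rewrite num_mulC num_mulx1. Qed.

Lemma num_addIx z x y : x + z = y + z -> x = y.
Proof.
move: z; apply: D0_ind => [||z IH]; [dfn|by rewrite !num_addx0|].
by rewrite !num_addxS => /num_succ_inj.
Qed.

Lemma num_cases x : x = 0 \/ exists y, x = y + 1.
Proof.
move: x; apply: S1_ind => [||x _]; [|by left|by right; exists x].
(* The quantifier is moved to the front, as the definition of [S1] demands; the first disjunct holds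
   with any witness. *)
apply: (@S1_ext M 1 (fun c : ctx M 1 => exists y, snd c = 0 \/ snd c = y + 1)) => [c|].
  by split=> [[y [H|H]]|[H|[y H]]]; [left|right; exists y|exists 0; left|exists y; right].
by exists (fun c : ctx M 2 => snd (fst c) = 0 \/ snd (fst c) = snd c + 1); split=> //; dfn.
Qed.

Lemma num_ltxSx x : x < x + 1.
Proof. by apply/num_ltxS; right. Qed.

Lemma num_lt_addSr x z : x < x + (z + 1).
Proof.
move: z; apply: D0_ind => [||z IH]; [dfn|by rewrite num_add0x; apply: num_ltxSx|].
by rewrite num_addA; apply/num_ltxS; left.
Qed.

Lemma num_lt_exists x y : x < y <-> exists z, y = x + (z + 1).
Proof.
split=> [|[z ->]]; last exact: num_lt_addSr.
move: y; apply: S1_ind => [||y IH].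
- apply: (@S1_ext M 1 (fun c => exists z, x < snd c -> snd c = x + (z + 1))) => [c|].
    split=> [[z H] /H ->|H]; first by exists z.
    case: (classic (x < snd c)) => [/H [z E]|N]; [by exists z|by exists 0].
  by exists (fun c : ctx M 2 => x < snd (fst c) -> snd (fst c) = x + (snd c + 1)); split=> //; dfn.
- by move/num_ltx0.
- move/num_ltxS => [/IH [z ->]|->]; last by exists 0; rewrite num_add0x.
  by exists (z + 1); rewrite -num_addA.
Qed.

Lemma num_ltxx x : ~ x < x.
Proof.
move=> /num_lt_exists [z]; rewrite -{1}(num_addx0 x) (num_addC x 0) (num_addC x) => /num_addIx.
by move=> H; apply: (@num_succ_neq0 z).
Qed.

Lemma num_lt_trans y x z : x < y -> y < z -> x < z.
Proof.
move=> /num_lt_exists [u ->] /num_lt_exists [v ->]; apply/num_lt_exists.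
by exists (u + 1 + v); rewrite !num_addA.
Qed.

Lemma num_lt_total x y : x < y \/ x = y \/ y < x.
Proof.
move: y; apply: D0_ind => [||y [H|[->|H]]]; [dfn| | | |].
- case: (num_cases x) => [->|[z ->]]; [by right; left|right; right].
  by apply/num_lt_exists; exists z; rewrite num_add0x.
- by left; apply/num_ltxS; left.
- by left; apply: num_ltxSx.
- move/num_lt_exists: H => [z ->]; case: (num_cases z) => [->|[w ->]].
    by right; left; rewrite num_add0x.
  by right; right; apply/num_lt_exists; exists w; rewrite -(num_addA y) (num_addC 1) !num_addA.
Qed.

Lemma num_le_exists x y : x <= y <-> exists z, y = x + z.
Proof.
rewrite /leM num_lt_exists; split=> -[z H]; exists z; last by rewrite H num_addA.
by move: H; rewrite num_addA => /num_succ_inj.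
Qed.

Lemma num_le_eqVlt x y : x <= y <-> x = y \/ x < y.
Proof. by rewrite /leM num_ltxS; tauto. Qed.

Lemma num_lt_le x y : x < y -> x <= y.
Proof. by move=> H; apply/num_le_eqVlt; right. Qed.

Lemma num_le_refl x : x <= x.
Proof. by apply/num_le_eqVlt; left. Qed.

Lemma num_not_lt x y : ~ x < y <-> y <= x.
Proof.
rewrite num_le_eqVlt; split=> [H|[->|H] H'].
- by case: (num_lt_total x y) => [//|[->|H']]; [left|right].
- exact: num_ltxx H'.
- exact/(@num_ltxx x)/(num_lt_trans H').
Qed.

Lemma num_not_le x y : ~ x <= y <-> y < x.
Proof. by rewrite -num_not_lt; split=> [H|H H']; [apply: NNPP|apply: H']. Qed.

Lemma num_le_trans y x z : x <= y -> y <= z -> x <= z.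
Proof.
move=> /num_le_exists [u ->] /num_le_exists [v ->]; apply/num_le_exists.
by exists (u + v); rewrite num_addA.
Qed.

Lemma num_le_lt_trans y x z : x <= y -> y < z -> x < z.
Proof. by move=> /num_le_eqVlt [->//|]; apply: num_lt_trans. Qed.

Lemma num_lt_le_trans y x z : x < y -> y <= z -> x < z.
Proof. by move=> H /num_le_eqVlt [<-//|]; apply: num_lt_trans. Qed.

Lemma num_le0x x : 0 <= x.
Proof. by apply/num_le_exists; exists x; rewrite num_add0x. Qed.

Lemma num_le_antisym x y : x <= y -> y <= x -> x = y.
Proof. by move=> /num_le_eqVlt [//|/num_not_le]. Qed.

Lemma D0_unary (P : num M -> Prop) n (f : ctx M n -> num M) :
  D0 (n := 1) (fun c => P (snd c)) -> proj f -> D0 (fun c => P (f c)).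
Proof.
move=> DP Hf; apply: (D0_reindex (n := 1) (th := fun c => (tt, f c)) _ DP).
by apply: reindex_pair => // g _; apply: proj_const.
Qed.

(** The induction runs on the absence of elements below [y], which is again a bounded statement. *)
Lemma D0_least (P : num M -> Prop) x : D0 (n := 1) (fun c => P (snd c)) -> P x ->
  exists y, P y /\ forall z, z < y -> ~ P z.
Proof.
move=> DP Px; apply: NNPP => N.
suff H : forall y z, z < y -> ~ P z by apply: (H (x + 1) x) Px; apply: num_ltxSx.
apply: D0_ind => [|z /num_ltx0//|y IH z /num_ltxS [/IH//|-> Py]]; last by apply: N; exists y.
apply: D0_ball; first dfn_term.
apply: D0_not; apply: (D0_unary DP); exact: proj_snd.
Qed.
End Arithmetic.

(** * The ordered field of fractions *)

Section Integers.
Local Open Scope dom_scope.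
Variable M : rca.
Implicit Types (a b c d : num M) (p q : num M * num M).

Lemma num_semi_ring : semi_ring_theory (zeroM M) (oneM M) (@addM M) (@mulM M) eq.
Proof.
split=> *; rewrite ?num_add0x ?num_mul1x ?num_mul0x ?num_addA ?num_mulA ?num_mulDl //.
- exact: num_addC.
- exact: num_mulC.
Qed.
Add Ring num_ring : num_semi_ring.

Definition zrel p q : Prop := fst p + snd q = fst q + snd p.

Definition ZM : Type := quot zrel.
Definition zc p : ZM := cls zrel p.

Lemma zc_eq p q : zc p = zc q <-> zrel p q.
Proof.
apply: cls_eq => [[x x']|[x x'] [y y']|[x x'] [y y'] [z z']] //; rewrite /zrel /=.
move=> H1 H2; apply: (@num_addIx M y').
transitivity ((x + y') + z'); first ring.
rewrite H1; transitivity ((y + z') + x'); first ring.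
by rewrite H2; ring.
Qed.

Lemma zcK (x : ZM) : zc (rep x) = x.
Proof. exact: repK. Qed.

Definition zadd (x y : ZM) : ZM :=
  zc (fst (rep x) + fst (rep y), snd (rep x) + snd (rep y)).
Definition zopp (x : ZM) : ZM := zc (snd (rep x), fst (rep x)).
Definition zmul (x y : ZM) : ZM :=
  zc (fst (rep x) * fst (rep y) + snd (rep x) * snd (rep y),
      fst (rep x) * snd (rep y) + snd (rep x) * fst (rep y)).

Lemma zaddE a b c d : zadd (zc (a, b)) (zc (c, d)) = zc (a + c, b + d).
Proof.
have /zc_eq := zcK (zc (a, b)); have /zc_eq := zcK (zc (c, d)).
rewrite /zadd; case: (rep (zc (a, b))) => x x'; case: (rep (zc (c, d))) => y y'.
rewrite /zrel /= => H1 H2; apply/zc_eq; rewrite /zrel /=.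
transitivity ((x + b) + (y + d)); first ring.
by rewrite H1 H2; ring.
Qed.

Lemma zoppE a b : zopp (zc (a, b)) = zc (b, a).
Proof.
have /zc_eq := zcK (zc (a, b)); rewrite /zopp; case: (rep (zc (a, b))) => x x'.
rewrite /zrel /= => H; apply/zc_eq; rewrite /zrel /=.
by rewrite num_addC -H num_addC.
Qed.

Lemma zmulE a b c d : zmul (zc (a, b)) (zc (c, d)) = zc (a * c + b * d, a * d + b * c).
Proof.
have /zc_eq := zcK (zc (a, b)); have /zc_eq := zcK (zc (c, d)).
rewrite /zmul; case: (rep (zc (a, b))) => x x'; case: (rep (zc (c, d))) => y y'.
rewrite /zrel /= => H1 H2.
transitivity (zc (a * y + b * y', a * y' + b * y)); apply/zc_eq; rewrite /zrel /=.
- transitivity ((x + b) * y + (a + x') * y'); first ring.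
  by rewrite -H2 {1}H2; ring.
- transitivity (a * (y + d) + b * (c + y')); first ring.
  by rewrite -H1 {1}H1; ring.
Qed.

Lemma zcP (x : ZM) : exists a b, x = zc (a, b).
Proof. by rewrite -(zcK x); case: (rep x) => a b; exists a, b. Qed.

Definition ziota a : ZM := zc (a, 0).

Lemma zaddA (x y z : ZM) : zadd x (zadd y z) = zadd (zadd x y) z.
Proof.
have [a [a' ->]] := zcP x; have [b [b' ->]] := zcP y; have [c [c' ->]] := zcP z.
by rewrite !zaddE !num_addA.
Qed.

Lemma zaddC (x y : ZM) : zadd x y = zadd y x.
Proof.
have [a [a' ->]] := zcP x; have [b [b' ->]] := zcP y.
by rewrite !zaddE (num_addC a) (num_addC a').
Qed.

Lemma zadd0 (x : ZM) : zadd (ziota 0) x = x.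
Proof. by have [a [a' ->]] := zcP x; rewrite /ziota zaddE !num_add0x. Qed.

Lemma zaddN (x : ZM) : zadd (zopp x) x = ziota 0.
Proof.
have [a [a' ->]] := zcP x; rewrite /ziota zoppE zaddE; apply/zc_eq; rewrite /zrel /=; ring.
Qed.

Lemma zmulA (x y z : ZM) : zmul x (zmul y z) = zmul (zmul x y) z.
Proof.
have [a [a' ->]] := zcP x; have [b [b' ->]] := zcP y; have [c [c' ->]] := zcP z.
by rewrite !zmulE; apply/zc_eq; rewrite /zrel /=; ring.
Qed.

Lemma zmulC (x y : ZM) : zmul x y = zmul y x.
Proof.
have [a [a' ->]] := zcP x; have [b [b' ->]] := zcP y.
by rewrite !zmulE; apply/zc_eq; rewrite /zrel /=; ring.
Qed.

Lemma zmul1 (x : ZM) : zmul (ziota 1) x = x.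
Proof.
have [a [a' ->]] := zcP x; rewrite /ziota zmulE; apply/zc_eq; rewrite /zrel /=; ring.
Qed.

Lemma zmulDl (x y z : ZM) : zmul (zadd x y) z = zadd (zmul x z) (zmul y z).
Proof.
have [a [a' ->]] := zcP x; have [b [b' ->]] := zcP y; have [c [c' ->]] := zcP z.
by rewrite zaddE !zmulE zaddE; apply/zc_eq; rewrite /zrel /=; ring.
Qed.

Lemma ziota_inj a b : ziota a = ziota b -> a = b.
Proof. by move=> /zc_eq; rewrite /zrel /= !num_addx0. Qed.

Lemma ziotaD a b : ziota (a + b) = zadd (ziota a) (ziota b).
Proof. by rewrite /ziota zaddE num_addx0. Qed.

Lemma ziotaM a b : ziota (a * b) = zmul (ziota a) (ziota b).
Proof. by rewrite /ziota zmulE; apply/zc_eq; rewrite /zrel /=; ring. Qed.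

Lemma zone_neq0 : ziota 1 <> ziota 0.
Proof. by move=> /ziota_inj; rewrite -(num_add0x 1); apply: num_succ_neq0. Qed.

Lemma z_total (x : ZM) : exists a, x = ziota a \/ x = zopp (ziota a).
Proof.
have [a [b ->]] := zcP x.
case: (classic (a < b)) => [/num_lt_le|/num_not_lt] /num_le_exists [c ->].
  by exists c; right; rewrite /ziota zoppE; apply/zc_eq; rewrite /zrel /=; ring.
by exists c; left; apply/zc_eq; rewrite /zrel /=; ring.
Qed.

Lemma num_mul_eq0 a b : a * b = 0 -> a = 0 \/ b = 0.
Proof.
case: (num_cases a) => [|[c ->]]; first by left.
case: (num_cases b) => [|[d ->]]; first by right.
by rewrite num_mulxS num_addA => /num_succ_neq0.
Qed.

Lemma zmul_eq0 (x y : ZM) : zmul x y = ziota 0 -> x = ziota 0 \/ y = ziota 0.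
Proof.
have E0 : zopp (ziota 0) = ziota 0 by rewrite /ziota zoppE.
have [a Ha] := z_total x; have [b Hb] := z_total y; move=> H.
have Hab : a * b = 0.
  have : ziota (a * b) = ziota 0 \/ zopp (ziota (a * b)) = ziota 0.
    rewrite -H /ziota zoppE; case: Ha Hb => -> [] ->; rewrite /ziota ?zoppE zmulE;
      [left|right|right|left]; apply/zc_eq; rewrite /zrel /=; ring.
  case=> [/ziota_inj //|]; rewrite /ziota zoppE => /zc_eq; rewrite /zrel /=.
  by rewrite !num_add0x.
by case: (num_mul_eq0 Hab) => E; [left|right];
  [case: Ha => ->|case: Hb => ->]; rewrite E ?E0.
Qed.

End Integers.

From HB Require Import structures.
From mathcomp Require Import all_boot all_order all_algebra boolp ring lra.
Import Order.TTheory GRing.Theory Num.Theory.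

(** * The integers as an integral domain *)

Section IntegersRing.
Variable M : rca.
Local Open Scope ring_scope.

HB.instance Definition _ := gen_eqMixin (ZM M).
HB.instance Definition _ := gen_choiceMixin (ZM M).
HB.instance Definition _ := GRing.isZmodule.Build (ZM M)
  (@zaddA M) (@zaddC M) (@zadd0 M) (@zaddN M).

Fact ZM_one_neq0 : ziota (oneM M) != 0 :> ZM M.
Proof. exact/eqP/zone_neq0. Qed.

HB.instance Definition _ := GRing.Zmodule_isComNzRing.Build (ZM M)
  (@zmulA M) (@zmulC M) (@zmul1 M) (@zmulDl M) ZM_one_neq0.

(** Units and inverses are chosen classically; they are part of the integral domain structure over
    which the field of fractions is formed. *)
Definition zunit : pred (ZM M) := fun x => `[< exists y : ZM M, y * x = 1 >].
Definition zinv (x : ZM M) : ZM M :=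
  if pselect (exists y : ZM M, y * x = 1) is left H then projT1 (cid H) else x.

Fact zmulVx : {in zunit, left_inverse 1 zinv *%R}.
Proof.
move=> x /asboolP H; rewrite /zinv; case: pselect => // H'; exact: projT2 (cid H').
Qed.

Fact zunitPl (x y : ZM M) : y * x = 1 -> zunit x.
Proof. by move=> H; apply/asboolP; exists y. Qed.

Fact zinv_out : {in [predC zunit], zinv =1 id}.
Proof. by move=> x; rewrite inE => /asboolPn H; rewrite /zinv; case: pselect. Qed.

HB.instance Definition _ :=
  GRing.ComNzRing_hasMulInverse.Build (ZM M) zmulVx zunitPl zinv_out.

Fact ZM_integral : GRing.integral_domain_axiom (ZM M).
Proof.
move=> x y /zmul_eq0 H; apply/orP; case: H => H; [left|right]; exact/eqP.
Qed.

HB.instance Definition _ := GRing.ComUnitRing_isIntegral.Build (ZM M) ZM_integral.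
End IntegersRing.

Local Notation "x %:F" := (@FracField.tofrac _ x) (at level 1, format "x %:F").

(** * The field of fractions and its order *)

Section Field.
Variable M : rca.
Local Open Scope ring_scope.

Definition QM : Type := {fraction (ZM M)}.
HB.instance Definition _ := GRing.Field.on QM.

Definition iota (a : num M) : QM := (ziota a)%:F.

Lemma iotaD a b : iota (addM a b) = iota a + iota b.
Proof. by rewrite /iota ziotaD tofracD. Qed.

Lemma iotaM a b : iota (mulM a b) = iota a * iota b.
Proof. by rewrite /iota ziotaM tofracM. Qed.

Lemma iota0 : iota (zeroM M) = 0.
Proof. exact: tofrac0. Qed.

Lemma iota1 : iota (oneM M) = 1.
Proof. exact: tofrac1. Qed.

Lemma iota_inj : injective iota.
Proof. by move=> a b /eqP; rewrite tofrac_eq => /eqP/ziota_inj. Qed.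

Lemma iota_succ_neq0 a : iota a + 1 != 0.
Proof.
apply/eqP; rewrite -iota1 -iotaD -iota0 => /iota_inj; exact: num_succ_neq0.
Qed.

(** The nonnegative cone from which the order is built; successors serve as denominators because
    they are visibly nonzero. *)
Definition qnonneg (x : QM) : Prop := exists a b, x = iota a / (iota b + 1).

#[local] Opaque iota.

Lemma frac_repr (R : idomainType) (x : {fraction R}) :
  exists n d : R, d != 0 /\ x = n%:F / d%:F.
Proof.
elim/quotW: x => r; exists (\n_r), (\d_r); have d0 := denom_ratioP r; split=> //.
apply: (canRL (mulfK _)); first by rewrite tofrac_eq0.
unlock FracField.tofrac; rewrite -[LHS]FracField.pi_mul; apply/eqmodP => /=.
rewrite FracField.equivfE /FracField.mulf !numden_Ratio ?mulf_neq0 ?oner_eq0 //.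
by rewrite !mulr1 mulrC.
Qed.

Lemma qnonneg_total x : qnonneg x \/ qnonneg (- x).
Proof.
have [n [d [d0 ->]]] := frac_repr x.
have [a Ha] := z_total n; have [b Hb] := z_total d.
have [c Ec] : exists c, b = addM c (oneM M).
  case: (num_cases b) => // b0; case/eqP: d0; rewrite b0 in Hb.
  by case: Hb => ->; [|exact: oppr0].
have Hn : n%:F = iota a \/ n%:F = - iota a.
  by case: Ha => ->; [left|right; rewrite tofracN].
have Hd : d%:F = iota c + 1 \/ d%:F = - (iota c + 1).
  by rewrite -iota1 -iotaD -Ec; case: Hb => ->; [left|right; rewrite tofracN].
case: Hn Hd => -> [] ->; [left|right|right|left]; exists a, c;
  rewrite ?invrN ?mulrNN ?mulrN ?mulNr ?opprK //.
Qed.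

Fact iota_succ_mul b d :
  (iota b + 1) * (iota d + 1) = iota (addM (mulM b (addM d (oneM M))) d) + 1.
Proof. by rewrite !(iotaD, iotaM, iota1) mulrDl mul1r addrA. Qed.

Lemma qnonneg_add x y : qnonneg x -> qnonneg y -> qnonneg (x + y).
Proof.
move=> [a [b ->]] [c [d ->]].
exists (addM (mulM a (addM d (oneM M))) (mulM c (addM b (oneM M)))).
exists (addM (mulM b (addM d (oneM M))) d).
by rewrite addf_div ?iota_succ_neq0 // (iota_succ_mul b d) !(iotaD, iotaM, iota1).
Qed.

Lemma qnonneg_mul x y : qnonneg x -> qnonneg y -> qnonneg (x * y).
Proof.
move=> [a [b ->]] [c [d ->]].
exists (mulM a c), (addM (mulM b (addM d (oneM M))) d).
by rewrite mulf_div -iotaM (iota_succ_mul b d).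
Qed.

Fact oppf_div_eq (F : fieldType) (a b c d : F) :
  b != 0 -> d != 0 -> - (a / b) = c / d -> a * d + c * b = 0.
Proof.
move=> b0 d0 E; have -> : c = - (a / b) * d by rewrite E mulfVK.
by field.
Qed.

Lemma qnonneg_anti x : qnonneg x -> qnonneg (- x) -> x = 0.
Proof.
move=> [a [b ->]] [c [d]] /(oppf_div_eq (iota_succ_neq0 b) (iota_succ_neq0 d)).
rewrite -iota1 -!iotaD -!iotaM -iotaD -iota0 => /iota_inj.
(* Clearing denominators left a vanishing sum of products of numbers; with [a = e + 1] the sum would
   be a successor. *)
case: (num_cases a) => [->|[e ->]]; first by rewrite iota0 mul0r.
by rewrite num_mulxS num_addA num_addSx => /num_succ_neq0.
Qed.

Definition zqle (x y : QM) : bool := `[< qnonneg (y - x) >].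
Definition zqnorm (x : QM) : QM := if zqle 0 x then x else - x.

Fact qle0_add x y : zqle 0 x -> zqle 0 y -> zqle 0 (x + y).
Proof.
by move=> /asboolP Hx /asboolP Hy; apply/asboolP; move: Hx Hy; rewrite !subr0; apply: qnonneg_add.
Qed.

Fact qle0_mul x y : zqle 0 x -> zqle 0 y -> zqle 0 (x * y).
Proof.
by move=> /asboolP Hx /asboolP Hy; apply/asboolP; move: Hx Hy; rewrite !subr0; apply: qnonneg_mul.
Qed.

Fact qle0_anti x : zqle 0 x -> zqle x 0 -> x = 0.
Proof.
by move=> /asboolP; rewrite subr0 => Hx /asboolP; rewrite sub0r; apply: qnonneg_anti.
Qed.

Fact qsub_ge0 x y : zqle 0 (y - x) = zqle x y.
Proof. by rewrite /zqle subr0. Qed.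

Fact qle0_total x : zqle 0 x || zqle x 0.
Proof.
by apply/orP; case: (qnonneg_total x) => H; [left|right]; apply/asboolP; rewrite ?subr0 ?sub0r.
Qed.

Fact qnormN x : zqnorm (- x) = zqnorm x.
Proof.
rewrite /zqnorm; have E y : zqle 0 (- y) = zqle y 0 by rewrite -(qsub_ge0 y 0) sub0r.
rewrite E; case: ifP => H1; case: ifP => H2; rewrite ?opprK //.
  by rewrite (qle0_anti H2 H1) oppr0.
by have := qle0_total x; rewrite H1 H2.
Qed.

Fact qge0_norm x : zqle 0 x -> zqnorm x = x.
Proof. by rewrite /zqnorm => ->. Qed.

HB.instance Definition _ := Num.IntegralDomain_isLeReal.Build QM
  qle0_add qle0_mul qle0_anti qsub_ge0 qle0_total qnormN qge0_norm (fun _ _ => erefl).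

Lemma qle_iota a b : (iota a <= iota b) = `[< leM a b >].
Proof.
have H c d : leM c d -> iota c <= iota d.
  move=> /num_le_exists [e ->]; rewrite iotaD; apply/asboolP.
  by exists e, (zeroM M); rewrite iota0 add0r divr1 addrC addKr.
apply/idP/asboolP => [ab|]; last exact: H.
case: (num_lt_total a b) => [/num_lt_le //|[->|/num_lt_le ba]]; first exact: num_le_refl.
rewrite (@iota_inj a b); first exact: num_le_refl.
by apply: le_anti; rewrite ab H.
Qed.

Lemma q_repr x : exists a b c, x = (iota a - iota b) / (iota c + 1).
Proof.
case: (qnonneg_total x) => -[a [c E]]; first by exists a, (zeroM M), c; rewrite iota0 subr0.
by exists (zeroM M), a, c; rewrite iota0 sub0r mulNr -E opprK.
Qed.

End Field.

Record fractions (M : rca) : Type := Fractions {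
  fractions_field : realFieldType;
  to_fraction : num M -> fractions_field;
  to_fractionD : forall a b, to_fraction (addM a b) = (to_fraction a + to_fraction b)%R;
  to_fractionM : forall a b, to_fraction (mulM a b) = (to_fraction a * to_fraction b)%R;
  to_fraction0 : to_fraction (zeroM M) = 0%R;
  to_fraction1 : to_fraction (oneM M) = 1%R;
  to_fraction_le : forall a b, (to_fraction a <= to_fraction b)%R = `[< leM a b >];
  fraction_repr : forall x, exists a b c,
    x = ((to_fraction a - to_fraction b) / (to_fraction c + 1))%R }.

(* Opaque, to keep [ring] and [lra] from unfolding the construction. *)
Lemma fractions_exist (M : rca) : fractions M.
Proof.
exact: (@Fractions M (QM M) (@iota M) (@iotaD M) (@iotaM M) (@iota0 M) (@iota1 M)
  (@qle_iota M) (@q_repr M)).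
Qed.

(** * Functions with a [S1]-definable graph *)

Section RecursiveFunctions.
Variable M : rca.

Definition frac_field : realFieldType := fractions_field (fractions_exist M).
Definition io : num M -> frac_field := to_fraction (fractions_exist M).

Lemma ioD a b : io (addM a b) = (io a + io b)%R. Proof. exact: to_fractionD. Qed.
Lemma ioM a b : io (mulM a b) = (io a * io b)%R. Proof. exact: to_fractionM. Qed.
Lemma io0 : io (zeroM M) = 0%R. Proof. exact: to_fraction0. Qed.
Lemma io1 : io (oneM M) = 1%R. Proof. exact: to_fraction1. Qed.

Lemma io_le a b : leM a b <-> (io a <= io b)%R.
Proof. by rewrite to_fraction_le asboolE. Qed.

(** Discreteness of the numbers: a strict inequality is a gap of one in the field, in a form that
    linear arithmetic can use. *)
Lemma io_lt a b : ltM a b <-> (io a + 1 <= io b)%R.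
Proof.
rewrite -io1 -ioD -io_le; split=> [/num_lt_exists [z ->]|].
  by apply/num_le_exists; exists z; rewrite (num_addC z) num_addA.
by apply: num_lt_le_trans; apply: num_ltxSx.
Qed.

Lemma io_inj : injective io.
Proof.
by move=> a b E; apply: num_le_antisym; apply/io_le; rewrite E.
Qed.

Lemma io_eq a b : a = b <-> io a = io b.
Proof. by split=> [->//|/io_inj]. Qed.

Lemma io_ge0 a : (0 <= io a)%R.
Proof. by rewrite -io0 -io_le; apply: num_le0x. Qed.

Lemma io_gt a b : ltM a b <-> (io a < io b)%R.
Proof.
rewrite -num_not_le io_le; split=> [/negP|H]; rewrite -?ltNge // => H'.
by apply/negP: H'; rewrite -ltNge.
Qed.

(** One unbounded quantifier supplies a common bound for both witnesses, which leaves a bounded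
    matrix; [x + y + 1] is such a bound. The same device contracts two quantifiers in [S1_ex]. *)
Lemma S1_and n (P Q : ctx M n -> Prop) : S1 P -> S1 Q -> S1 (fun c => P c /\ Q c).
Proof.
move=> [P' [DP HP]] [Q' [DQ HQ]].
exists (fun c : ctx M (S n) => (exists x, ltM x (snd c) /\ P' (fst c, x)) /\
  (exists x, ltM x (snd c) /\ Q' (fst c, x))).
split.
  apply: D0_and; (apply: D0_bex; first by dfn_term);
    [apply: (D0_reindex (m := S (S n)) (n := S n)
      (th := fun c => (fst (fst c), snd c)) _ DP)
    |apply: (D0_reindex (m := S (S n)) (n := S n)
      (th := fun c => (fst (fst c), snd c)) _ DQ)];
    apply: reindex_pair (@proj_snd _ _) => f Hf;
    exact: (proj_fst (proj_fst Hf)).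
move=> c; rewrite HP HQ /=; split=> [[[x Hx] [y Hy]]|[z [[x [_ Hx]] [y [_ Hy]]]]].
  exists (addM (addM x y) (oneM M)); split; [exists x|exists y]; split=> //.
    by apply/num_le_exists; exists y.
  by apply/num_le_exists; exists x; rewrite num_addC.
by split; [exists x|exists y].
Qed.

Lemma S1_or n (P Q : ctx M n -> Prop) : S1 P -> S1 Q -> S1 (fun c => P c \/ Q c).
Proof.
move=> [P' [DP HP]] [Q' [DQ HQ]].
exists (fun c => P' c \/ Q' c); split; first exact: D0_or.
move=> c; rewrite HP HQ; split=> [[[x H]|[x H]]|[x [H|H]]];
  [exists x; left|exists x; right|left; exists x|right; exists x] => //.
Qed.

Lemma S1_ex n (P : ctx M n -> num M -> Prop) :
  S1 (n := S n) (fun c => P (fst c) (snd c)) -> S1 (fun c => exists x, P c x).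
Proof.
move=> [P' [DP HP]].
exists (fun c : ctx M (S n) => exists y, ltM y (snd c) /\
  exists x, ltM x (snd c) /\ P' ((fst c, y), x)).
split.
  do 2 (apply: D0_bex; first by dfn_term).
  apply: (D0_reindex (m := S (S (S n))) (n := S (S n))
    (th := fun c => (fst (fst (fst c)), snd (fst c), snd c)) _ DP).
  apply: reindex_pair (@proj_snd _ _); apply: reindex_pair (proj_fst (@proj_snd _ _)).
  by move=> f Hf; apply: (proj_fst (proj_fst (proj_fst Hf))).
move=> c; split=> [[x /(HP (c, x)) [y Hy]]|[z [x [_ [y [_ Hy]]]]]]; last first.
  by exists x; apply/(HP (c, x)); exists y.
exists (addM (addM x y) (oneM M)) => /=; exists x; split.
  by apply/num_le_exists; exists y.
by exists y; split=> //; apply/num_le_exists; exists x; rewrite num_addC.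
Qed.

Definition R1u (F : num M -> num M) : Prop := R1 (n := 1) (fun c => F (snd c)).
Definition R1b (F : num M -> num M -> num M) : Prop :=
  R1 (n := 2) (fun c => F (snd (fst c)) (snd c)).
Definition R1t (F : num M -> num M -> num M -> num M) : Prop :=
  R1 (n := 3) (fun c => F (snd (fst (fst c))) (snd (fst c)) (snd c)).

Lemma R1_reindex m n (th : ctx M m -> ctx M n) (f : ctx M n -> num M) :
  (forall h, proj h -> proj (fun c => h (th c))) -> R1 f -> R1 (fun c => f (th c)).
Proof.
move=> Hth Hf.
apply: (S1_reindex (m := S m) (n := S n) (th := fun c => (th (fst c), snd c)) _ Hf).
exact: reindex_up.
Qed.

Lemma R1_fst n (f : ctx M n -> num M) : R1 f -> R1 (n := S n) (fun c => f (fst c)).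
Proof. by apply: R1_reindex => h; apply: proj_fst. Qed.

Lemma S1_fst n (P : ctx M n -> Prop) : S1 P -> S1 (n := S n) (fun c => P (fst c)).
Proof. by apply: S1_reindex => h; apply: proj_fst. Qed.

Lemma R1_DT n (f : ctx M n -> num M) : DT f -> R1 f.
Proof. by move=> Hf; apply/D0_S1/D0_eq; [dfn_term|apply: DT_fst]. Qed.

Lemma S1_app n (P : ctx M n -> num M -> Prop) (f : ctx M n -> num M) :
  R1 f -> S1 (n := S n) (fun c => P (fst c) (snd c)) -> S1 (fun c => P c (f c)).
Proof.
move=> Hf HP.
apply: (S1_ext (P := fun c => exists y, y = f c /\ P c y)) => [c|].
  by split=> [[y [->]]//|H]; exists (f c).
by apply: S1_ex; apply: S1_and.
Qed.

Lemma R1_ext n (f g : ctx M n -> num M) : (forall c, f c = g c) -> R1 f -> R1 g.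
Proof. by move=> E; rewrite (functional_extensionality _ _ E). Qed.

Lemma R1_app n (g : ctx M n -> num M -> num M) (f : ctx M n -> num M) :
  R1 f -> R1 (n := S n) (fun c => g (fst c) (snd c)) -> R1 (fun c => g c (f c)).
Proof.
move=> Hf Hg.
apply: (S1_app (n := S n) (P := fun c y => snd c = g (fst c) y) (f := fun c => f (fst c))).
  exact: R1_fst.
apply: (S1_reindex (m := S (S n)) (n := S (S n))
  (th := fun c => (fst (fst c), snd c, snd (fst c))) _ Hg).
apply: reindex_pair (proj_fst (@proj_snd _ _)); apply: reindex_pair (@proj_snd _ _).
by move=> h Hh; apply: (proj_fst (proj_fst Hh)).
Qed.

Lemma R1_app1 (F : num M -> num M) n (f : ctx M n -> num M) :
  R1u F -> R1 f -> R1 (fun c => F (f c)).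
Proof.
move=> HF Hf; apply: (R1_app (g := fun _ => F) Hf).
apply: (R1_reindex (m := S n) (n := 1) (th := fun c => (tt, snd c)) _ HF).
apply: reindex_pair (@proj_snd _ _) => h _; exact: proj_const.
Qed.

Lemma R1_app2 (F : num M -> num M -> num M) n (f g : ctx M n -> num M) :
  R1b F -> R1 f -> R1 g ->
  R1 (fun c => F (f c) (g c)).
Proof.
move=> HF Hf Hg; apply: (R1_app (g := fun c => F (f c)) Hg).
apply: (R1_app (n := S n) (g := fun c y => F y (snd c)) (f := fun c => f (fst c))).
  exact: R1_fst.
apply: (R1_reindex (m := S (S n)) (n := 2) (th := fun c => (tt, snd c, snd (fst c))) _ HF).
apply: reindex_pair (proj_fst (@proj_snd _ _)); apply: reindex_pair (@proj_snd _ _).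
move=> h _; exact: proj_const.
Qed.

Lemma R1_app3 (F : num M -> num M -> num M -> num M) n (f g h : ctx M n -> num M) :
  R1t F ->
  R1 f -> R1 g -> R1 h -> R1 (fun c => F (f c) (g c) (h c)).
Proof.
move=> HF Hf Hg Hh; apply: (R1_app (g := fun c => F (f c) (g c)) Hh).
apply: (R1_app (n := S n) (g := fun c y => F (f (fst c)) y (snd c)) (f := fun c => g (fst c))).
  exact: R1_fst.
apply: (R1_app (n := S (S n)) (g := fun c y => F y (snd c) (snd (fst c)))
  (f := fun c => f (fst (fst c)))).
  exact: (R1_fst (R1_fst Hf)).
apply: (R1_reindex (m := S (S (S n))) (n := 3)
  (th := fun c => (tt, snd c, snd (fst c), snd (fst (fst c)))) _ HF).
apply: reindex_pair (proj_fst (proj_fst (@proj_snd _ _))).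
apply: reindex_pair (proj_fst (@proj_snd _ _)); apply: reindex_pair (@proj_snd _ _).
move=> k _; exact: proj_const.
Qed.

Lemma D0_S1_app2 n (P : num M -> num M -> Prop) (f g : ctx M n -> num M) :
  S1 (n := 2) (fun c => P (snd (fst c)) (snd c)) -> R1 f -> R1 g ->
  S1 (fun c => P (f c) (g c)).
Proof.
move=> HP Hf Hg; apply: (S1_app (P := fun c => P (f c)) Hg).
apply: (S1_app (n := S n) (P := fun c y => P y (snd c)) (f := fun c => f (fst c))).
  exact: R1_fst.
apply: (S1_reindex (m := S (S n)) (n := 2) (th := fun c => (tt, snd c, snd (fst c))) _ HP).
apply: reindex_pair (proj_fst (@proj_snd _ _)); apply: reindex_pair (@proj_snd _ _).
move=> h _; exact: proj_const.
Qed.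

Lemma S1_app1 n (P : num M -> Prop) (f : ctx M n -> num M) :
  S1 (n := 1) (fun c => P (snd c)) -> R1 f -> S1 (fun c => P (f c)).
Proof.
move=> HP Hf; apply: (S1_app (P := fun _ => P) Hf).
apply: (S1_reindex (m := S n) (n := 1) (th := fun c => (tt, snd c)) _ HP).
apply: reindex_pair (@proj_snd _ _) => h _; exact: proj_const.
Qed.

Lemma S1_eq n (f g : ctx M n -> num M) : R1 f -> R1 g -> S1 (fun c => f c = g c).
Proof. apply: (D0_S1_app2 (P := fun x y => x = y)); apply: D0_S1; dfn. Qed.

Lemma S1_neq n (f g : ctx M n -> num M) : R1 f -> R1 g -> S1 (fun c => f c <> g c).
Proof. apply: (D0_S1_app2 (P := fun x y => x <> y)); apply: D0_S1; dfn. Qed.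

Lemma S1_lt n (f g : ctx M n -> num M) : R1 f -> R1 g -> S1 (fun c => ltM (f c) (g c)).
Proof. apply: (D0_S1_app2 (P := @ltM M)); apply: D0_S1; dfn. Qed.

Lemma S1_elem n (f : ctx M n -> num M) X : R1 f -> S1 (fun c => elemM (f c) X).
Proof. apply: (S1_app1 (P := fun x => elemM x X)); apply: D0_S1; dfn. Qed.

Lemma S1_nelem n (f : ctx M n -> num M) X : R1 f -> S1 (fun c => ~ elemM (f c) X).
Proof. apply: (S1_app1 (P := fun x => ~ elemM x X)); apply: D0_S1; dfn. Qed.

Lemma R1_add n (f g : ctx M n -> num M) : R1 f -> R1 g -> R1 (fun c => addM (f c) (g c)).
Proof. by apply: (R1_app2 (F := @addM M)); apply: R1_DT; dfn_term. Qed.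

Lemma R1_mul n (f g : ctx M n -> num M) : R1 f -> R1 g -> R1 (fun c => mulM (f c) (g c)).
Proof. by apply: (R1_app2 (F := @mulM M)); apply: R1_DT; dfn_term. Qed.

Lemma R1_if n (P : ctx M n -> Prop) (f g : ctx M n -> num M) :
  S1 P -> S1 (fun c => ~ P c) -> R1 f -> R1 g ->
  R1 (fun c => if pselect (P c) then f c else g c).
Proof.
move=> HP HnP Hf Hg.
apply: (S1_ext (P := fun c : ctx M (S n) =>
  (P (fst c) /\ snd c = f (fst c)) \/ (~ P (fst c) /\ snd c = g (fst c)))) => [c|].
  by case: pselect => H; (split=> [[[? ?]|[? ?]]|?] //); [left|right].
apply: S1_or; [exact: (S1_and (S1_fst HP) Hf)|exact: (S1_and (S1_fst HnP) Hg)].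
Qed.

End RecursiveFunctions.

(** * Pairs and codes of fractions *)

Lemma R1_fst_eq (M : rca) n (f : ctx M (S n) -> num M) (h : ctx M n -> num M) :
  (forall c, f c = h (fst c)) -> R1 h -> R1 f.
Proof. by move=> E Hh; apply: (R1_ext (fun c => esym (E c))); apply: R1_fst. Qed.

(** [dfr] proves [R1] for composite functions and finds the graphs of named functions among the
    hypotheses; [dfs] proves [S1]. *)
Ltac dfr_app dfr := match goal with
  | H : @R1u _ ?F |- R1 (fun c => ?F _) => apply (R1_app1 H); dfr
  | H : @R1b _ ?F |- R1 (fun c => ?F _ _) => apply (R1_app2 H); dfr
  | H : @R1t _ ?F |- R1 (fun c => ?F _ _ _) => apply (R1_app3 H); dfr
  end.
Ltac dfr := cbv beta; first
  [ apply: R1_DT; dfn_term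
  | apply: R1_add; dfr | apply: R1_mul; dfr | assumption | dfr_app dfr
  | eapply R1_fst_eq; [dfn_factor|dfr] ].
Ltac dfs := cbv beta; first
  [ apply: S1_ex; dfs | apply: S1_and; dfs | apply: S1_or; dfs
  | apply: S1_eq; dfr | apply: S1_neq; dfr | apply: S1_lt; dfr
  | apply: S1_elem; dfr | apply: S1_nelem; dfr | apply: D0_S1; dfn | assumption ].

Section Codes.
Variable M : rca.
Implicit Types (a b i j x y z : num M).
Local Open Scope dom_scope.
Local Notation io := (@io M).
Local Notation Q := (frac_field M).

Definition pr i j : num M := (i + j) * (i + j) + i.

Lemma num_le_sq x : x <= x * x.
Proof.
case: (num_cases x) => [->|[y ->]]; first by rewrite num_mulx0; apply: num_le_refl.
have := io_ge0 y; rewrite io_le !(ioM, ioD, io1); nra.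
Qed.

Lemma pr_l i j : i <= pr i j.
Proof. by apply/num_le_exists; exists ((i + j) * (i + j)); rewrite num_addC. Qed.

Lemma pr_r i j : j <= pr i j.
Proof.
have := num_le_sq (i + j); rewrite !io_le /pr !(ioD, ioM).
have := io_ge0 i; have := io_ge0 j; lra.
Qed.

(** With [s = i + j], the code lies between [s ^ 2] and [(s + 1) ^ 2], the latter excluded; so [s]
    is determined first, and then [i]. *)
Lemma pr_inj i j i' j' : pr i j = pr i' j' -> i = i' /\ j = j'.
Proof.
have lem k l k' l' : k + l < k' + l' -> pr k l <> pr k' l'.
  rewrite io_lt io_eq /pr !(ioD, ioM).
  have := io_ge0 k; have := io_ge0 l; have := io_ge0 k'; have := io_ge0 l'; nra.
move=> E; case: (num_lt_total (i + j) (i' + j')) => [/lem //|[Es|/lem /(_ (esym E)) //]].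
have Ei : i = i'.
  by move: E; rewrite /pr Es !(num_addC (_ * _)) => /num_addIx.
by split=> //; move: Es; rewrite Ei !(num_addC i') => /num_addIx.
Qed.

Definition cd a b c : num M := pr (pr a b) c.

Lemma cd_bounds a b c z : cd a b c <= z -> [/\ a <= z, b <= z & c <= z].
Proof.
move=> H; have H1 := num_le_trans (pr_l (pr a b) c) H.
split; [exact: num_le_trans (pr_l a b) H1|exact: num_le_trans (pr_r a b) H1|].
exact: num_le_trans (pr_r _ _) H.
Qed.

Lemma cd_inj a b c a' b' c' : cd a b c = cd a' b' c' -> [/\ a = a', b = b' & c = c'].
Proof. by move=> /pr_inj [/pr_inj [-> ->] ->]. Qed.

Definition frv a b c : Q := ((io a - io b) / (io c + 1))%R.

Definition qeqM a b c a' b' c' : Prop :=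
  a * (c' + 1) + b' * (c + 1) = a' * (c + 1) + b * (c' + 1).

Lemma io_succ_gt0 c : (0 < io c + 1 :> Q)%R.
Proof. have := io_ge0 c; lra. Qed.

Lemma io_succ_neq0 c : (io c + 1 != 0 :> Q)%R.
Proof. by have := io_succ_gt0 c; rewrite lt0r => /andP []. Qed.

Lemma qeqM_frv a b c a' b' c' : qeqM a b c a' b' c' <-> frv a b c = frv a' b' c'.
Proof.
rewrite /qeqM io_eq !(ioD, ioM, io1) /frv; split=> [H|/eqP].
  apply/eqP; rewrite eqr_div ?io_succ_neq0 //; apply/eqP; lra.
rewrite eqr_div ?io_succ_neq0 // => /eqP; lra.
Qed.

(** A fraction with least code. The separate bounds on [x], [y] and [z] follow from the one on their
    code by [cd_bounds]; they make the predicate bounded. *)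
Definition iscan a b c : Prop :=
  forall x, x < cd a b c -> forall y, y < cd a b c -> forall z, z < cd a b c ->
  cd x y z < cd a b c -> ~ qeqM x y z a b c.

Lemma iscanP a b c : iscan a b c <->
  forall x y z, cd x y z < cd a b c -> frv x y z <> frv a b c.
Proof.
split=> H x y z; last by move=> ? ? ? ? /qeqM_frv; apply: H.
move=> lt /qeqM_frv.
have [Hx Hy Hz] := cd_bounds (num_le_refl (cd x y z)).
by apply: H => //; apply: num_le_lt_trans lt.
Qed.

Lemma iscan_exists (q : Q) : exists a b c, frv a b c = q /\ iscan a b c.
Proof.
have [a0 [b0 [c0 E0]]] := fraction_repr q.
(* To apply [D0_least], the components are bounded by the code itself. *)
pose P z := exists a, a < z + 1 /\ exists b, b < z + 1 /\ exists c, c < z + 1 /\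
  z = cd a b c /\ qeqM a b c a0 b0 c0.
have HP : P (cd a0 b0 c0).
  have [Ha Hb Hc] := cd_bounds (num_le_refl (cd a0 b0 c0)).
  by exists a0; split=> //; exists b0; split=> //; exists c0.
have [|z [[a [_ [b [_ [c [_ [-> /qeqM_frv E]]]]]]] Hmin]] := D0_least _ HP.
  by rewrite /P /cd /pr /qeqM; dfn.
exists a, b, c; split; first by rewrite E.
apply/iscanP => x y z' lt Exy; apply: (Hmin _ lt).
have [Hx Hy Hz] := cd_bounds (num_le_refl (cd x y z')).
exists x; split=> //; exists y; split=> //; exists z'; do ! split=> //.
by apply/qeqM_frv; rewrite Exy E.
Qed.

Definition crep (q : Q) : num M * num M * num M :=
  let a := cid (iscan_exists q) in let b := cid (projT2 a) in let c := cid (projT2 b) in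
  (projT1 a, projT1 b, projT1 c).
Definition cpos q : num M := (crep q).1.1.
Definition cneg q : num M := (crep q).1.2.
Definition cden q : num M := (crep q).2.
Definition rcode q : num M := cd (cpos q) (cneg q) (cden q).

Lemma crepP q : frv (cpos q) (cneg q) (cden q) = q /\ iscan (cpos q) (cneg q) (cden q).
Proof. exact: (projT2 (cid (projT2 (cid (projT2 (cid (iscan_exists q))))))). Qed.

Lemma crepK q : frv (cpos q) (cneg q) (cden q) = q.
Proof. by case: (crepP q). Qed.

Lemma rcode_inj : injective rcode.
Proof. by move=> q q' /cd_inj [E1 E2 E3]; rewrite -(crepK q) -(crepK q') E1 E2 E3. Qed.

Lemma rcodeE a b c : iscan a b c -> cd a b c = rcode (frv a b c).
Proof.
move=> /iscanP H; have [E /iscanP H'] := crepP (frv a b c).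
case: (num_lt_total (cd a b c) (rcode (frv a b c))) => [lt|[//|lt]].
  by case: (H' _ _ _ lt).
by case: (H _ _ _ lt).
Qed.

(** [rcode] comes from a choice; this is its graph as a bounded predicate of the code and a
    fraction. *)
Definition isrcode z p q d : Prop :=
  exists a, a < z + 1 /\ exists b, b < z + 1 /\ exists c, c < z + 1 /\
  z = cd a b c /\ iscan a b c /\ qeqM a b c p q d.

Lemma isrcodeP z p q d : isrcode z p q d <-> z = rcode (frv p q d).
Proof.
split=> [[a [_ [b [_ [c [_ [-> [can /qeqM_frv <-]]]]]]]]|->]; first exact: rcodeE.
have [E can] := crepP (frv p q d).
have [Ha Hb Hc] := cd_bounds (num_le_refl (rcode (frv p q d))).
exists (cpos (frv p q d)); split=> //; exists (cneg (frv p q d)); split=> //.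
exists (cden (frv p q d)); do ! split=> //; exact/qeqM_frv.
Qed.

(** * Definable functions with values in the field of fractions *)

(** Field operations are easy on triples that need not have least codes, whereas sets and recursion
    deal with codes; [RQ_rcode] and [rcode_RQ] translate. *)
Definition RQ n (f : ctx M n -> Q) : Prop :=
  exists p q d : ctx M n -> num M, [/\ R1 p, R1 q & R1 d] /\
  forall c, f c = frv (p c) (q c) (d c).

Lemma RQ_rcode n (f : ctx M n -> Q) : RQ f -> R1 (fun c => rcode (f c)).
Proof.
move=> [p [q [d [[Hp Hq Hd] E]]]].
apply: (S1_ext (P := fun c : ctx M (S n) => exists x, x = p (fst c) /\
  exists y, y = q (fst c) /\ exists z, z = d (fst c) /\ isrcode (snd c) x y z)) => [c|].
  split=> [[x [-> [y [-> [z [-> /isrcodeP ->]]]]]]|->]; first by rewrite -E.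
  exists (p (fst c)); split=> //; exists (q (fst c)); split=> //; exists (d (fst c)).
  by split=> //; apply/isrcodeP; rewrite -E.
by rewrite /isrcode /iscan /cd /pr /qeqM; dfs.
Qed.

Lemma rcode_RQ n (f : ctx M n -> Q) : R1 (fun c => rcode (f c)) -> RQ f.
Proof.
move=> H; exists (fun c => cpos (f c)), (fun c => cneg (f c)), (fun c => cden (f c)).
split; last by move=> c; rewrite crepK.
have E c x y z : rcode (f c) = cd x y z <->
    [/\ x = cpos (f c), y = cneg (f c) & z = cden (f c)].
  by split=> [/cd_inj [<- <- <-]|[-> -> ->]].
split.
- apply: (S1_ext (P := fun c : ctx M (S n) => exists y z, rcode (f (fst c)) = cd (snd c) y z)).
    by move=> c; split=> [[y [z /E []//]]|H']; do 2 eexists; apply/E.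
  by rewrite /cd /pr; dfs.
- apply: (S1_ext (P := fun c : ctx M (S n) => exists y z, rcode (f (fst c)) = cd y (snd c) z)).
    by move=> c; split=> [[y [z /E []//]]|H']; do 2 eexists; apply/E.
  by rewrite /cd /pr; dfs.
- apply: (S1_ext (P := fun c : ctx M (S n) => exists y z, rcode (f (fst c)) = cd y z (snd c))).
    by move=> c; split=> [[y [z /E []//]]|H']; do 2 eexists; apply/E.
  by rewrite /cd /pr; dfs.
Qed.

Lemma RQ_ext n (f g : ctx M n -> Q) : (forall c, f c = g c) -> RQ f -> RQ g.
Proof. by move=> E; rewrite (functional_extensionality _ _ E). Qed.

Lemma RQ_io n (f : ctx M n -> num M) : R1 f -> RQ (fun c => io (f c)).
Proof.
move=> Hf; exists f, (fun _ => 0), (fun _ => 0); split; first by split; dfr.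
by move=> c; rewrite /frv io0 subr0 add0r divr1.
Qed.

Lemma RQ_const n (q : Q) : RQ (fun _ : ctx M n => q).
Proof.
exists (fun _ => cpos q), (fun _ => cneg q), (fun _ => cden q); split; first by split; dfr.
by move=> c; rewrite crepK.
Qed.

Lemma RQ_opp n (f : ctx M n -> Q) : RQ f -> RQ (fun c => - f c)%R.
Proof.
move=> [p [q [d [[Hp Hq Hd] E]]]]; exists q, p, d; split=> // c.
by rewrite E /frv -mulNr opprB.
Qed.

Lemma RQ_add n (f g : ctx M n -> Q) : RQ f -> RQ g -> RQ (fun c => f c + g c)%R.
Proof.
move=> [p [q [d [[Hp Hq Hd] E]]]] [p' [q' [d' [[Hp' Hq' Hd'] E']]]].
exists (fun c => p c * (d' c + 1) + p' c * (d c + 1)).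
exists (fun c => q c * (d' c + 1) + q' c * (d c + 1)).
(* The denominator is the successor of this component, so this is the product of [d + 1] and
   [d' + 1], less one. *)
exists (fun c => d c * d' c + d c + d' c); split; first by split; dfr.
move=> c; rewrite E E' /frv !(ioD, ioM, io1).
have := io_succ_neq0 (d c); have := io_succ_neq0 (d' c).
move: (io (d c)) (io (d' c)) => x y y0 x0; have xy0 := mulf_neq0 x0 y0.
have E1 : (x * y + x + y + 1 = (x + 1) * (y + 1))%R by ring.
by rewrite E1; field; rewrite x0 y0.
Qed.

Lemma RQ_sub n (f g : ctx M n -> Q) : RQ f -> RQ g -> RQ (fun c => f c - g c)%R.
Proof. by move=> Hf Hg; apply/RQ_add/RQ_opp. Qed.

Lemma RQ_mul n (f g : ctx M n -> Q) : RQ f -> RQ g -> RQ (fun c => f c * g c)%R.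
Proof.
move=> [p [q [d [[Hp Hq Hd] E]]]] [p' [q' [d' [[Hp' Hq' Hd'] E']]]].
exists (fun c => p c * p' c + q c * q' c).
exists (fun c => p c * q' c + q c * p' c).
exists (fun c => d c * d' c + d c + d' c); split; first by split; dfr.
move=> c; rewrite E E' /frv !(ioD, ioM, io1).
have := io_succ_neq0 (d c); have := io_succ_neq0 (d' c).
move: (io (d c)) (io (d' c)) => x y y0 x0; have xy0 := mulf_neq0 x0 y0.
have E1 : (x * y + x + y + 1 = (x + 1) * (y + 1))%R by ring.
by rewrite E1; field; rewrite x0 y0.
Qed.

Lemma RQ_inv_succ n (f : ctx M n -> num M) : R1 f -> RQ (fun c => (io (f c) + 1)^-1)%R.
Proof.
move=> Hf; exists (fun _ => 1), (fun _ => 0), f; split; first by split; dfr.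
by move=> c; rewrite /frv io0 io1 subr0 mul1r.
Qed.

Lemma frv_lt a b c a' b' c' : (frv a b c < frv a' b' c')%R <->
  a * (c' + 1) + b' * (c + 1) < a' * (c + 1) + b * (c' + 1).
Proof.
rewrite io_gt !(ioD, ioM, io1) /frv ltr_pdivrMr ?io_succ_gt0 // mulrAC.
rewrite ltr_pdivlMr ?io_succ_gt0 //; split=> H; lra.
Qed.

Lemma S1_Qlt n (f g : ctx M n -> Q) : RQ f -> RQ g -> S1 (fun c => (f c < g c)%R).
Proof.
move=> [p [q [d [[Hp Hq Hd] E]]]] [p' [q' [d' [[Hp' Hq' Hd'] E']]]].
apply: (S1_ext (P := fun c =>
  p c * (d' c + 1) + q' c * (d c + 1) < p' c * (d c + 1) + q c * (d' c + 1))) => [c|].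
  by rewrite E E' frv_lt.
by dfs.
Qed.

Lemma S1_Qle n (f g : ctx M n -> Q) : RQ f -> RQ g -> S1 (fun c => (f c <= g c)%R).
Proof.
move=> [p [q [d [[Hp Hq Hd] E]]]] [p' [q' [d' [[Hp' Hq' Hd'] E']]]].
apply: (S1_ext (P := fun c =>
  p c * (d' c + 1) + q' c * (d c + 1) <= p' c * (d c + 1) + q c * (d' c + 1))) => [c|].
  rewrite -num_not_lt E E' leNgt -(rwP negP).
  have -> : (frv (p' c) (q' c) (d' c) < frv (p c) (q c) (d c))%R <->
    p' c * (d c + 1) + q c * (d' c + 1) < p c * (d' c + 1) + q' c * (d c + 1).
    exact: frv_lt.
  by [].
by rewrite /leM; dfs.
Qed.

Lemma RQ_if n (P : ctx M n -> Prop) (f g : ctx M n -> Q) :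
  S1 P -> S1 (fun c => ~ P c) -> RQ f -> RQ g ->
  RQ (fun c => if pselect (P c) then f c else g c).
Proof.
move=> HP HnP /RQ_rcode Hf /RQ_rcode Hg; apply: rcode_RQ.
by apply: R1_ext (R1_if HP HnP Hf Hg) => c; case: pselect.
Qed.

End Codes.

(** * Finite sets coded by numbers, and primitive recursion *)

Section Recursion.
Variable M : rca.
Implicit Types (a b i j m u x y z w : num M).
Local Open Scope dom_scope.
Local Notation io := (@io M).
Local Notation pr := (@pr M).

(** The bound on the quotient makes divisibility bounded; for nonzero [m] it is no restriction. *)
Definition dvd m u : Prop := exists y, y < u + 1 /\ u = m * y.

Lemma dvdI m y : m <> 0 -> dvd m (m * y).
Proof.
move=> m0; exists y; split=> //; rewrite -/(leM _ _).
case: (num_cases m) => // -[x ->]; apply/num_le_exists; exists (x * y).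
by rewrite num_mulSx num_addC.
Qed.

Lemma dvd_sub m a p r : m <> 0 -> m * r = a + m * p -> dvd m a.
Proof.
move=> m0 E; have [w Ew] : exists w, r = p + w.
  apply/num_le_exists/num_not_lt => /num_lt_exists [z Ep].
  move: E; rewrite Ep io_eq !(ioM, ioD, io1); case: (num_cases m) m0 => // -[x ->] _.
  rewrite ioD io1; have := io_ge0 a; have := io_ge0 x; have := io_ge0 z; have := io_ge0 r; nra.
suff -> : a = m * w by apply: dvdI.
by apply: (@num_addIx _ (m * p)); rewrite -E Ew num_mulDr num_addC.
Qed.

(** The number [b] takes the place of the factorial of [n]. *)
Lemma common_multiple n : exists b, b <> 0 /\ forall d, d < n -> dvd (d + 1) b.
Proof.
move: n; apply: S1_ind => [||n [b [b0 Hb]]].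
- by apply: S1_ex; apply: D0_S1; rewrite /dvd; dfn.
- by exists 1; split=> [|d /num_ltx0//]; rewrite -[1]num_add0x; apply: num_succ_neq0.
exists (b * (n + 1)); split.
  by case/num_mul_eq0 => // /num_succ_neq0.
move=> d /num_ltxS [/Hb [y [_ ->]]|->].
  by rewrite -num_mulA; apply: dvdI; apply: num_succ_neq0.
by rewrite num_mulC; apply: dvdI; apply: num_succ_neq0.
Qed.

Definition modulus b z : num M := 1 + (z + 1) * b.

Lemma modulus_neq0 b z : modulus b z <> 0.
Proof. by rewrite /modulus num_addC; apply: num_succ_neq0. Qed.

(* The moduli are pairwise coprime: with [i' = i + 1] and [j' = j + 1], the difference
   [i' * modulus b j - j' * modulus b i = i' - j'] divides [b], and
   [i' * b = modulus b i - 1]. *)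
Lemma modulus_coprime b n i j a :
  (forall d, d < n -> dvd (d + 1) b) -> i < n -> j < n -> i <> j ->
  dvd (modulus b i) (a * modulus b j) -> dvd (modulus b i) a.
Proof.
move=> Hb iln jln ij [x [_ E]].
have m0 := @modulus_neq0 b i.
have diff k l e : k < n -> k = l + (e + 1) -> exists c, b = (e + 1) * c.
  move=> kn Ek; have [|c [_ Ec]] := Hb e; last by exists c.
  apply: num_lt_trans kn; rewrite Ek io_gt !(ioD, io1); have := io_ge0 l; lra.
move/io_eq: E; rewrite !(ioM, ioD, io1) => E.
case: (num_lt_total i j) => [/num_lt_exists [e Ej]|[//|/num_lt_exists [e Ei]]].
(* Here [modulus b i = 1 + i' * c * (j' * modulus b i - i' * modulus b j)]. Multiply by [a], replace
   [a * modulus b j] by [modulus b i * x] and move the negative terms across: this is the equation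
   that [dvd_sub] requires. *)
- have [c Ec] := diff _ _ _ jln Ej.
  apply: (@dvd_sub _ _ ((i + 1) * c * (j + 1) * a) (a + (i + 1) * (i + 1) * c * x)) => //.
  move: E; rewrite /modulus io_eq !(ioM, ioD, io1) Ec Ej !(ioM, ioD, io1) => E.
  apply/eqP; rewrite -subr_eq0; apply/eqP.
  transitivity ((io i + 1) * (io i + 1) * io c * (((1 + (io i + 1) * ((io e + 1) * io c)) * io x) -
    io a * (1 + (io i + (io e + 1) + 1) * ((io e + 1) * io c))))%R; first by ring.
  by rewrite E subrr mulr0.
- have [c Ec] := diff _ _ _ iln Ei.
  apply: (@dvd_sub _ _ ((i + 1) * c * (i + 1) * x) (a + (i + 1) * c * a * (j + 1))) => //.
  move: E; rewrite /modulus io_eq !(ioM, ioD, io1) Ec Ei !(ioM, ioD, io1) => E.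
  apply/eqP; rewrite -subr_eq0; apply/eqP.
  transitivity ((io j + (io e + 1) + 1) * (io j + (io e + 1) + 1) * io c *
    (io a * (1 + (io j + 1) * ((io e + 1) * io c)) -
     (1 + (io j + (io e + 1) + 1) * ((io e + 1) * io c)) * io x))%R; first by ring.
  by rewrite E subrr mulr0.
Qed.

Lemma dvd_mulr m a x : dvd m a -> dvd m (a * x).
Proof.
case: (EM (m = 0)) => [->|m0] [y [_ ->]].
  by exists 0; rewrite !num_mul0x; split=> //; apply: num_ltxSx.
by rewrite -num_mulA; apply: dvdI.
Qed.

(** Coding as for the beta function: [u] is the product of the moduli of the elements. The induction
    on [k] multiplies by one modulus at a time, and coprimality keeps the other divisibilities
    unchanged. *)
Lemma finite_coding (P : num M -> Prop) n : D0 (n := 1) (fun c => P (snd c)) ->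
  exists u b, forall z, z < n -> (dvd (modulus b z) u <-> P z).
Proof.
move=> DP; have [b [b0 Hb]] := common_multiple n.
suff H k : exists u, forall z, z < n -> (dvd (modulus b z) u <-> z < k /\ P z).
  have [u Hu] := H n; exists u, b => z zn; rewrite (Hu z zn); tauto.
move: k; apply: S1_ind => [||k [u Hu]].
- apply: S1_ex; apply: D0_S1; rewrite /dvd /modulus.
  apply: D0_ball; first dfn_term.
  apply: D0_iff; first dfn.
  by apply: D0_and; [dfn|apply: (D0_unary DP); dfn_proj].
(* The empty product: as [b] is nonzero, every modulus exceeds 1 and does not divide it. *)
- exists 1 => z zn; split=> [[y [_ E]]|[/num_ltx0//]]; exfalso.
  have [c Eb] : exists c, b = c + 1 by case: (num_cases b).
  move: E; rewrite /modulus Eb; case: (num_cases y) => [->|[y' ->]].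
    by rewrite num_mulx0 -[1%M]num_add0x => /num_succ_neq0.
  move/io_eq; rewrite !(ioM, ioD, io1).
  have := io_ge0 z; have := io_ge0 c; have := io_ge0 y' => y0 c0 z0.
  have := mulr_ge0 z0 c0; have := mulr_ge0 z0 y0; have := mulr_ge0 c0 y0.
  have := mulr_ge0 (mulr_ge0 z0 c0) y0; nra.
case: (EM (P k /\ k < n)) => [[Pk kn]|nPk].
  exists (u * modulus b k) => z zn; split=> [H|[/num_ltxS [zk|->] Pz]].
  - case: (EM (z = k)) => [->|zk]; first by split=> //; apply: num_ltxSx.
    have /(Hu z zn) [lt Pz] := modulus_coprime Hb zn kn zk H.
    by split=> //; apply/num_ltxS; left.
  - by apply/dvd_mulr/(Hu z zn).
  - by rewrite num_mulC; apply/dvdI/modulus_neq0.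
exists u => z zn; rewrite (Hu z zn) num_ltxS; split=> [[]|[[//|E] Pz]]; first by split; [left|].
by case: nPk; rewrite -E.
Qed.

(** * Projections of pairs, and graphs of functions as sets *)

Definition unl x : num M :=
  if pselect (exists i j, x = pr i j) is left H then projT1 (cid H) else 0.
Definition unr x : num M :=
  if pselect (exists i j, x = pr i j) is left H then projT1 (cid (projT2 (cid H))) else 0.

Lemma unlK i j : unl (pr i j) = i.
Proof.
rewrite /unl; case: pselect => [H|[]]; last by exists i, j.
by have [j' /pr_inj [/esym E _]] := projT2 (cid H).
Qed.

Lemma unrK i j : unr (pr i j) = j.
Proof.
rewrite /unr; case: pselect => [H|[]]; last by exists i, j.
by have /pr_inj [_ /esym E] := projT2 (cid (projT2 (cid H))).
Qed.

Definition is_pair x : Prop := exists i, i < x + 1 /\ exists j, j < x + 1 /\ x = pr i j.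

Lemma is_pairP x : is_pair x <-> exists i j, x = pr i j.
Proof.
split=> [[i [_ [j [_ E]]]]|[i [j ->]]]; first by exists i, j.
by exists i; split; [exact: pr_l|exists j; split; [exact: pr_r|]].
Qed.

Lemma D0_is_pair n (f : ctx M n -> num M) : DT f -> D0 (fun c => is_pair (f c)).
Proof.
move=> Hf; have H1 := DT_fst Hf; have H2 := DT_fst H1.
apply: D0_bex; first by apply: DT_add => //; dfn_term.
apply: D0_bex; first by apply: DT_add => //; dfn_term.
by apply: D0_eq => //; rewrite /pr; dfn_term.
Qed.

Lemma R1_unl : R1u unl.
Proof.
apply: (S1_ext (P := fun c : ctx M 2 => (exists j, snd (fst c) = pr (snd c) j) \/
  (snd c = 0 /\ ~ is_pair (snd (fst c))))) => [[[t x] z]|]; last first.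
  apply: S1_or; first by rewrite /pr; dfs.
  by apply: D0_S1; apply: D0_and; [dfn|apply/D0_not/D0_is_pair; dfn_term].
rewrite /= is_pairP; split=> [[[j ->]|[-> H]]|->]; first by rewrite unlK.
  by rewrite /unl; case: pselect.
case: (EM (exists i j, x = pr i j)) => [[i [j ->]]|H]; [left|right].
  by exists j; rewrite unlK.
by rewrite /unl; case: pselect.
Qed.

Lemma R1_unr : R1u unr.
Proof.
apply: (S1_ext (P := fun c : ctx M 2 => (exists j, snd (fst c) = pr j (snd c)) \/
  (snd c = 0 /\ ~ is_pair (snd (fst c))))) => [[[t x] z]|]; last first.
  apply: S1_or; first by rewrite /pr; dfs.
  by apply: D0_S1; apply: D0_and; [dfn|apply/D0_not/D0_is_pair; dfn_term].
rewrite /= is_pairP; split=> [[[j ->]|[-> H]]|->]; first by rewrite unrK.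
  by rewrite /unr; case: pselect.
case: (EM (exists i j, x = pr i j)) => [[i [j ->]]|H]; [left|right].
  by exists i; rewrite unrK.
by rewrite /unr; case: pselect.
Qed.

(** The complement is [S1]: [z] is no pair, or its first component lies outside [D], or its second
    component differs from the value of the total function [F]. *)
Lemma graph_set (D : num M -> Prop) (F : num M -> num M) :
  D0 (n := 1) (fun c => D (snd c)) -> R1u F ->
  exists X, forall z, elemM z X <-> exists d, D d /\ z = pr d (F d).
Proof.
move=> DD HF; apply: D1_comprehension; split.
  apply: S1_ex; apply: S1_and; last by rewrite /pr; dfs.
  by apply: D0_S1; apply: (D0_unary DD); dfn_proj.
have H1 := R1_unl; have H2 := R1_unr.
apply: (S1_ext (P := fun c : ctx M 1 => ~ is_pair (snd c) \/ (~ D (unl (snd c)) \/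
  exists d, d = unl (snd c) /\ unr (snd c) <> F d))) => [[t z]|]; last first.
  apply: S1_or; first by apply/D0_S1/D0_not/D0_is_pair; dfn_term.
  apply: S1_or; last dfs.
  by apply: (S1_app1 (P := fun d => ~ D d)); [apply: D0_S1; exact: D0_not|dfr].
rewrite /= is_pairP; split=> [[H|[H|[d [-> H]]]] [d' [Dd E]]|H].
- by apply: H; exists d', (F d').
- by move: H; rewrite E unlK.
- by move: H; rewrite E unlK unrK.
- case: (EM (exists i j, z = pr i j)) => [[i [j E]]|]; [right|by left].
  case: (EM (D (unl z))) => Dz; [right|by left].
  exists (unl z); split=> // Ej; apply: H; exists (unl z); split=> //.
  by rewrite -Ej E unlK unrK.
Qed.

(** * Primitive recursion by coded computations *)

Section PrimitiveRecursion.
Variables (base : num M -> num M) (step : num M -> num M -> num M -> num M).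
Hypotheses (R1_base : R1u base) (R1_step : R1t step).

(** Once the graphs of [base] and [step] are sets, membership in them is atomic, and being a
    computation becomes a bounded property. *)
Let base_set : exists X, forall p w, elemM (pr p w) X <-> w = base p.
Proof.
have [|X HX] := graph_set (D := fun _ => True) _ R1_base.
  by apply: (D0_ext (P := fun _ : ctx M 1 => ~ False)) => [c|]; [tauto|dfn].
exists X => p w; rewrite HX; split=> [[d [_ /pr_inj [-> ->]]]//|->].
by exists p.
Qed.

Let step_set : exists X, forall p k v w, elemM (pr (pr (pr p k) v) w) X <-> w = step p k v.
Proof.
have H1 := R1_unl; have H2 := R1_unr.
have HF : R1u (fun x => step (unl (unl x)) (unr (unl x)) (unr x)) by rewrite /R1u; dfr.
have [|X HX] := graph_set (D := fun _ => True) _ HF.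
  by apply: (D0_ext (P := fun _ : ctx M 1 => ~ False)) => [c|]; [tauto|dfn].
exists X => p k v w; rewrite HX; split=> [[d [_ /pr_inj [<- ->]]]|->].
  by rewrite !(unlK, unrK).
by exists (pr (pr p k) v); rewrite !(unlK, unrK).
Qed.

Let B : sets M := projT1 (cid base_set).
Let C : sets M := projT1 (cid step_set).

Let HB p w : elemM (pr p w) B <-> w = base p.
Proof. exact: (projT2 (cid base_set)). Qed.

Let HC p k v w : elemM (pr (pr (pr p k) v) w) C <-> w = step p k v.
Proof. exact: (projT2 (cid step_set)). Qed.

Let coded u b n z : Prop := z < n /\ dvd (modulus b z) u.

(* Every coded pair [pr k v] is justified by coded pairs. *)
Let computation p u b n : Prop := forall z, z < n -> coded u b n z ->
  (exists w, w < z + 1 /\ (z = pr 0 w /\ elemM (pr p w) B)) \/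
  (exists k, k < z + 1 /\ exists v, v < n /\ exists w, w < z + 1 /\
     (coded u b n (pr k v) /\ (z = pr (k + 1) w /\ elemM (pr (pr (pr p k) v) w) C))).

Let computes p k v : Prop := exists u b n, computation p u b n /\ coded u b n (pr k v).

Let S1_computes : S1 (n := 3) (fun c => computes c.1.1.2 c.1.2 c.2).
Proof. by rewrite /computes /computation /coded /dvd /modulus /pr; dfs. Qed.

Let computes_exists p k : exists v, computes p k v.
Proof.
move: k; apply: S1_ind => [||k [v [u [b [n [Hc Hkv]]]]]].
- apply: S1_ex; apply: (S1_reindex (m := 2) (n := 3)
    (th := fun c => (tt, p, snd (fst c), snd c)) _ S1_computes).
  apply: reindex_pair (@proj_snd _ _); apply: reindex_pair (proj_fst (@proj_snd _ _)).
  apply: reindex_pair (@proj_const _ _ _) => h _; exact: proj_const.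
- pose z0 := pr 0 (base p).
  have [|u [b Hu]] := finite_coding (P := fun z => z = z0) (z0 + 1) _; first dfn.
  exists (base p), u, b, (z0 + 1); split=> [z zn [_ /(Hu z zn) ->]|].
    left; exists (base p); split; first exact: pr_r.
    by split=> //; apply/HB.
  by split; [exact: num_ltxSx|apply/Hu; first exact: num_ltxSx].
pose z1 := pr (k + 1) (step p k v).
(* The computation is extended by the next pair; the new bound exceeds both the old bound and that
   pair. *)
have [|u' [b' Hu]] := finite_coding (P := fun z => coded u b n z \/ z = z1) (n + (z1 + 1)) _.
  by rewrite /coded /dvd /modulus; dfn.
have n_le z : z < n -> z < n + (z1 + 1) by move=> zn; apply: num_lt_trans zn (num_lt_addSr _ _).
have z1_lt : z1 < n + (z1 + 1).
  by apply/num_lt_exists; exists n; rewrite (num_addC n (z1 + 1)) -(num_addA z1) (num_addC 1).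
exists (step p k v), u', b', (n + (z1 + 1)); split; last by split=> //; apply/Hu => //; right.
have sub z : coded u b n z -> coded u' b' (n + (z1 + 1)) z.
  by move=> Hz; have zn := n_le _ Hz.1; split=> //; apply/Hu => //; left.
move=> z zn [_ /(Hu z zn) [Hz|->]].
  case: (Hc z Hz.1 Hz) => [H|[k' [H1 [v' [H2 [w [H3 [H4 H5]]]]]]]]; first by left.
  right; exists k'; split=> //; exists v'; split; first exact: n_le.
  by exists w; split=> //; split=> //; apply: sub.
right; exists k; split.
  apply: num_le_trans (pr_l _ _); exact: num_lt_le (num_ltxSx k).
exists v; split; first by apply/n_le/(num_le_lt_trans (pr_r k v) Hkv.1).
exists (step p k v); split; first exact: pr_r.
by split; [exact: sub|split=> //; apply/HC].
Qed.

Let coded_inv p u b n k v : computation p u b n -> coded u b n (pr k v) ->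
  (k = 0 /\ v = base p) \/
  exists k' v', [/\ k = k' + 1, v' < n, coded u b n (pr k' v') & v = step p k' v'].
Proof.
move=> Hc Hkv; case: (Hc _ Hkv.1 Hkv) => [[w [_ [/pr_inj [-> ->] /HB ->]]]|]; first by left.
move=> [k' [_ [v' [v'n [w [_ [H1 [/pr_inj [-> ->] /HC ->]]]]]]]]; right.
by exists k', v'.
Qed.

Let computes_unique p k v v' : computes p k v -> computes p k v' -> v = v'.
Proof.
move=> [u [b [n [Hc Hkv]]]] [u' [b' [n' [Hc' Hkv']]]].
(* For two fixed computations, agreement at [k] is a bounded statement, so induction applies. *)
suff H : forall x, x < n -> forall x', x' < n' ->
    coded u b n (pr k x) -> coded u' b' n' (pr k x') -> x = x'.
  apply: H => //; [exact: num_le_lt_trans (pr_r k v) Hkv.1|].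
  exact: num_le_lt_trans (pr_r k v') Hkv'.1.
move: k {Hkv Hkv'}; apply: D0_ind => [|x _ x' _ H H'|k IH x _ x' _ H H'].
- by rewrite /coded /dvd /modulus /pr; dfn.
- case: (coded_inv Hc H) => [[_ ->]|[k [w [/esym/num_succ_neq0//]]]].
  by case: (coded_inv Hc' H') => [[_ ->]|[k [w [/esym/num_succ_neq0//]]]].
- case: (coded_inv Hc H) => [[/num_succ_neq0//]|[j [w [/num_succ_inj <- wn Hw ->]]]].
  case: (coded_inv Hc' H') => [[/num_succ_neq0//]|[j' [w' [/num_succ_inj <- wn' Hw' ->]]]].
  by rewrite (IH _ wn _ wn' Hw Hw').
Qed.

Theorem primitive_recursion : exists F : num M -> num M -> num M,
  [/\ R1b F, forall p, F p 0 = base p & forall p k, F p (k + 1) = step p k (F p k)].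
Proof.
pose F p k := projT1 (cid (computes_exists p k)).
have HF p k : computes p k (F p k) by exact: (projT2 (cid (computes_exists p k))).
exists F; split=> [|p|p k].
- apply: (S1_ext (P := fun c : ctx M 3 => computes c.1.1.2 c.1.2 c.2)) => [[[[? p] k] v]|//].
  by split=> /= [H|->//]; apply: computes_unique H (HF p k).
- have [u [b [n [Hc H]]]] := HF p 0.
  by case: (coded_inv Hc H) => [[_ ->]//|[k [w [/esym/num_succ_neq0//]]]].
- have [u [b [n [Hc H]]]] := HF p (k + 1).
  case: (coded_inv Hc H) => [[/num_succ_neq0//]|[j [w [/num_succ_inj <- wn Hw ->]]]].
  by congr (step p k _); apply: computes_unique (HF p k); exists u, b, n.
Qed.

End PrimitiveRecursion.
End Recursion.

(** * The meaning of the orbit principle *)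

Section RealNotions.
Variable M : rca.
Local Notation Q := (frac_field M).
Local Notation N := (num M).
Local Notation "m <=' n" := (leM m n) (at level 70).
Local Open Scope ring_scope.

Definition is_graph (D : N -> Prop) (X : sets M) (f : N -> Q) : Prop :=
  forall m, elemM m X <-> exists d, D d /\ m = pr d (rcode (f d)).

Definition Cauchy (x : N -> Q) : Prop := forall e, 0 < e ->
  exists k, forall m n, k <=' m -> k <=' n -> `|x m - x n| < e.
Definition Rle (x y : N -> Q) : Prop :=
  forall e, 0 < e -> exists k, forall n, k <=' n -> x n <= y n + e.
Definition Req (x y : N -> Q) : Prop := Rle x y /\ Rle y x.
Definition Rlt (x y : N -> Q) : Prop := Rle x y /\ ~ Req x y.
Definition In01 (x : N -> Q) : Prop := Cauchy x /\ Rle (fun _ => 0) x /\ Rle x (fun _ => 1).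
Definition InBall (r : Q) (x : N -> Q) (q : Q) : Prop := Rlt (fun n => `|x n - q|) (fun _ => r).
Definition InDom (phi : Q -> N -> Q) (x : N -> Q) : Prop := forall e, 0 < e -> exists m, forall q r,
  InBall (io m + 1)^-1 x q -> InBall (io m + 1)^-1 x r ->
  forall i j, addM m (oneM M) <=' i -> addM m (oneM M) <=' j -> `|phi q i - phi r j| < e.
Definition uniformly_Cauchy (y : N -> N -> Q) : Prop := forall e, 0 < e ->
  exists k, forall n i j, k <=' i -> k <=' j -> `|y n i - y n j| < e.

(** Functions of the metatheory occur only together with sets that are their graphs, so that the
    statement speaks about the reals and continuous functions of the model. *)
Definition orbits_exist : Prop :=
  forall F f, is_graph (fun d => exists q i, d = pr (rcode q) i) F f ->
  let phi q i := f (pr (rcode q) i) in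
  (forall X x, is_graph (fun _ => True) X x -> In01 x ->
     InDom phi x /\ In01 (fun i => phi (x i) i)) ->
  forall X x, is_graph (fun _ => True) X x -> In01 x ->
  exists Y g, is_graph (fun d => exists n i, d = pr n i) Y g /\
    let y n i := g (pr n i) in
    uniformly_Cauchy y /\ Req (y (zeroM M)) x /\
    forall n, InDom phi (y n) /\ Req (y (addM n (oneM M))) (fun i => phi (y n i) i).

(** An [fml] is read at the depths of a state.  As a bound variable computes its index from
    the depth, a denotation has to be the same at all deeper states. *)
Record state := State {
  ndepth : nat; sdepth : nat; nenv : nat -> N; senv : nat -> sets M }.

Definition ext (s s' : state) : Prop :=
  (exists k, ndepth s' = (k + ndepth s)%nat /\ forall i, nenv s' (k + i)%nat = nenv s i) /\
  (exists k, sdepth s' = (k + sdepth s)%nat /\ forall i, senv s' (k + i)%nat = senv s i).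

Lemma ext_refl s : ext s s.
Proof. by split; exists 0%N. Qed.

Lemma ext_trans s s' s'' : ext s s' -> ext s' s'' -> ext s s''.
Proof.
move=> [[k [Ek Hk]] [l [El Hl]]] [[k' [Ek' Hk']] [l' [El' Hl']]]; split.
  by exists (k' + k)%N; split=> [|i]; rewrite -addnA ?Hk' ?Hk // Ek' Ek.
by exists (l' + l)%N; split=> [|i]; rewrite -addnA ?Hl' ?Hl // El' El.
Qed.

Definition nden (s : state) (t : nterm) (a : N) : Prop :=
  forall s', ext s s' -> eval (nenv s') (t (ndepth s')) = a.
Definition sden (s : state) (X : svar) (A : sets M) : Prop :=
  forall s', ext s s' -> senv s' (X (sdepth s')) = A.
Definition fden (s : state) (p : fml) (P : Prop) : Prop :=
  forall s', ext s s' -> (sat (nenv s') (senv s') (p (ndepth s') (sdepth s')) <-> P).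

Lemma nden_ext s s' t a : ext s s' -> nden s t a -> nden s' t a.
Proof. by move=> H Ht s'' H'; apply: Ht (ext_trans H H'). Qed.
Lemma sden_ext s s' X A : ext s s' -> sden s X A -> sden s' X A.
Proof. by move=> H HX s'' H'; apply: HX (ext_trans H H'). Qed.
Lemma fden_iff s p (P P' : Prop) : (P <-> P') -> fden s p P -> fden s p P'.
Proof. by move=> E H s' Hs'; rewrite H. Qed.

Lemma nden_0 s : nden s n0 (zeroM M). Proof. by []. Qed.
Lemma nden_1 s : nden s n1 (oneM M). Proof. by []. Qed.
Lemma nden_add s t u a b : nden s t a -> nden s u b -> nden s (nadd t u) (addM a b).
Proof. by move=> Ht Hu s' E /=; rewrite Ht // Hu. Qed.
Lemma nden_mul s t u a b : nden s t a -> nden s u b -> nden s (nmul t u) (mulM a b).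
Proof. by move=> Ht Hu s' E /=; rewrite Ht // Hu. Qed.

Lemma fden_eq s t u a b : nden s t a -> nden s u b -> fden s (f_eq t u) (a = b).
Proof. by move=> Ht Hu s' E /=; rewrite Ht // Hu. Qed.
Lemma fden_lt s t u a b : nden s t a -> nden s u b -> fden s (f_lt t u) (ltM a b).
Proof. by move=> Ht Hu s' E /=; rewrite Ht // Hu. Qed.
Lemma fden_le s t u a b : nden s t a -> nden s u b -> fden s (f_lt t (nadd u n1)) (a <=' b).
Proof. by move=> Ht Hu; apply: fden_lt => //; apply: nden_add. Qed.
Lemma fden_mem s t X a A : nden s t a -> sden s X A -> fden s (f_mem t X) (elemM a A).
Proof. by move=> Ht HX s' E /=; rewrite Ht // HX. Qed.
Lemma fden_not s p P : fden s p P -> fden s (f_not p) (~ P).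
Proof. by move=> Hp s' E /=; rewrite Hp. Qed.
Lemma fden_true s : fden s f_true True.
Proof. by move=> s' E /=; tauto. Qed.

(** The conclusion is interpreted under the hypothesis, e.g. that a set is the graph of a function:
    otherwise its values have no meaning. *)
Lemma fden_imp s p q (P P' : Prop) :
  fden s p P -> (P -> fden s q P') -> fden s (f_imp p q) (P -> P').
Proof.
move=> Hp Hq s' E /=; rewrite (Hp _ E).
by split=> H HP; move: (H HP); rewrite (Hq HP _ E).
Qed.

Lemma fden_and s p q (P P' : Prop) :
  fden s p P -> (P -> fden s q P') -> fden s (f_and p q) (P /\ P').
Proof.
move=> Hp Hq s' E; rewrite /f_and /And /Not /= (Hp _ E).
case: (EM P) => HP; last by tauto.
by rewrite (Hq HP _ E); tauto.
Qed.

Lemma fden_or s p q (P P' : Prop) :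
  fden s p P -> fden s q P' -> fden s (f_or p q) (P \/ P').
Proof.
move=> Hp Hq s' E; rewrite /f_or /Or /Not /= (Hp _ E) (Hq _ E).
by case: (EM P); tauto.
Qed.

Lemma fden_all s (p : nterm -> fml) (P : N -> Prop) :
  (forall s' t x, ext s s' -> nden s' t x -> fden s' (p t) (P x)) ->
  fden s (f_all p) (forall x, P x).
Proof.
move=> H s' E; rewrite /f_all /=.
pose t : nterm := fun d' => Var (Nat.sub d' (S (ndepth s'))).
suff K x : sat (scons x (nenv s')) (senv s') (p t (S (ndepth s')) (sdepth s')) <-> P x.
  by split=> H' x; apply/K/H'.
pose s1 := State (S (ndepth s')) (sdepth s') (scons x (nenv s')) (senv s').
have E1 : ext s' s1 by split; [exists 1%N|exists 0%N].
apply: (H s1 t x (ext_trans E E1) _ s1 (ext_refl _)).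
(* With [k] further quantifiers above it, the variable has index [k], where [s2] still stores
   [x]. *)
move=> s2 [[k [Ek Hk]] _]; rewrite /t Ek /=.
by rewrite (_ : (k + _ - _)%coq_nat = k + 0)%N ?Hk // addn0; lia.
Qed.

Lemma fden_allS s (p : svar -> fml) (P : sets M -> Prop) :
  (forall s' X A, ext s s' -> sden s' X A -> fden s' (p X) (P A)) ->
  fden s (f_allS p) (forall A, P A).
Proof.
move=> H s' E; rewrite /f_allS /=.
pose X : svar := fun e' => Nat.sub e' (S (sdepth s')).
suff K A : sat (nenv s') (scons A (senv s')) (p X (ndepth s') (S (sdepth s'))) <-> P A.
  by split=> H' x; apply/K/H'.
pose s1 := State (ndepth s') (S (sdepth s')) (nenv s') (scons A (senv s')).
have E1 : ext s' s1 by split; [exists 0%N|exists 1%N].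
apply: (H s1 X A (ext_trans E E1) _ s1 (ext_refl _)).
move=> s2 [_ [k [Ek Hk]]]; rewrite /X Ek /=.
by rewrite (_ : (k + _ - _)%coq_nat = k + 0)%N ?Hk // addn0; lia.
Qed.

Lemma fden_ex s (p : nterm -> fml) (P : N -> Prop) :
  (forall s' t x, ext s s' -> nden s' t x -> fden s' (p t) (P x)) ->
  fden s (f_ex p) (exists x, P x).
Proof.
move=> H; apply: (fden_iff (P := ~ forall x, ~ P x)).
  by split=> [/existsNP [x /contrapT]|[x Px] /(_ x)]; [exists x|].
by apply: (fden_not (p := f_all (fun x => f_not (p x)))); apply: fden_all => *;
  apply/fden_not/H.
Qed.

Lemma fden_exS s (p : svar -> fml) (P : sets M -> Prop) :
  (forall s' X A, ext s s' -> sden s' X A -> fden s' (p X) (P A)) ->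
  fden s (f_exS p) (exists A, P A).
Proof.
move=> H; apply: (fden_iff (P := ~ forall x, ~ P x)).
  by split=> [/existsNP [x /contrapT]|[x Px] /(_ x)]; [exists x|].
by apply: (fden_not (p := f_allS (fun x => f_not (p x)))); apply: fden_allS => *;
  apply/fden_not/H.
Qed.

(** * Denotations of fractions and of quantifiers over rationals *)

Definition frden (s : state) (x : Defs.frac) (q : Q) : Prop :=
  exists a b c, [/\ nden s (pos x) a, nden s (neg x) b & nden s (den x) c] /\ frv a b c = q.
(** Unlike [frden], which fixes the value only, this fixes the triple with least code, on which
    membership in a graph depends. *)
Definition ratden (s : state) (x : Defs.frac) (q : Q) : Prop :=
  [/\ nden s (pos x) (cpos q), nden s (neg x) (cneg q) & nden s (den x) (cden q)].

Lemma frden_ext s s' x q : ext s s' -> frden s x q -> frden s' x q.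
Proof.
move=> E [a [b [c [[Ha Hb Hc] H]]]]; exists a, b, c.
by split=> //; split; apply: nden_ext E _.
Qed.

Lemma ratden_ext s s' x q : ext s s' -> ratden s x q -> ratden s' x q.
Proof. by move=> E [Ha Hb Hc]; split; apply: nden_ext E _. Qed.

Lemma ratden_frden s x q : ratden s x q -> frden s x q.
Proof.
by move=> [Ha Hb Hc]; exists (cpos q), (cneg q), (cden q); split=> //; apply: crepK.
Qed.

Lemma nden_npair s t u a b : nden s t a -> nden s u b -> nden s (npair t u) (pr a b).
Proof.
by move=> Ht Hu; do ! (first [apply: nden_add | apply: nden_mul]).
Qed.

Lemma nden_code s x a b c :
  nden s (pos x) a -> nden s (neg x) b -> nden s (den x) c -> nden s (code x) (cd a b c).
Proof. by move=> *; apply: nden_npair => //; apply: nden_npair. Qed.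

Lemma ratden_code s x q : ratden s x q -> nden s (code x) (rcode q).
Proof. by move=> [*]; apply: nden_code. Qed.

Lemma frden_add s x y p q : frden s x p -> frden s y q -> frden s (qadd x y) (p + q).
Proof.
move=> [a [b [c [[Ha Hb Hc] <-]]]] [a' [b' [c' [[Ha' Hb' Hc'] <-]]]].
eexists; eexists; eexists; split.
  by split; do ! (first [eassumption | apply: nden_1 | apply: nden_add | apply: nden_mul]).
rewrite /frv !(ioD, ioM, io1).
have := io_succ_neq0 c; have := io_succ_neq0 c'.
move: (io c) (io c') (io a) (io b) (io a') (io b') => x1 y1 a1 b1 a2 b2 y0 x0.
have xy0 := mulf_neq0 x0 y0.
have E1 : x1 * y1 + x1 + y1 + 1 = (x1 + 1) * (y1 + 1) by ring.
by rewrite E1; field; rewrite x0 y0.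
Qed.

Lemma frden_opp s x p : frden s x p -> frden s (qopp x) (- p).
Proof.
move=> [a [b [c [[Ha Hb Hc] <-]]]]; exists b, a, c; split=> //.
by rewrite /frv -mulNr opprB.
Qed.

Lemma frden_sub s x y p q : frden s x p -> frden s y q -> frden s (qsub x y) (p - q).
Proof. by move=> Hx Hy; apply/frden_add/frden_opp. Qed.

Lemma fden_qeq s x y p q : frden s x p -> frden s y q -> fden s (qeq x y) (p = q).
Proof.
move=> [a [b [c [[Ha Hb Hc] <-]]]] [a' [b' [c' [[Ha' Hb' Hc'] <-]]]].
apply: (fden_iff (qeqM_frv _ _ _ _ _ _)).
by apply: fden_eq; do ! (first [eassumption | apply: nden_1 | apply: nden_add | apply: nden_mul]).
Qed.

Lemma fden_qlt s x y p q : frden s x p -> frden s y q -> fden s (qlt x y) (p < q).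
Proof.
move=> [a [b [c [[Ha Hb Hc] <-]]]] [a' [b' [c' [[Ha' Hb' Hc'] <-]]]].
apply: (fden_iff (iff_sym (frv_lt _ _ _ _ _ _))).
by apply: fden_lt; do ! (first [eassumption | apply: nden_1 | apply: nden_add | apply: nden_mul]).
Qed.

Lemma fden_qle s x y p q : frden s x p -> frden s y q -> fden s (qle x y) (p <= q).
Proof.
move=> [a [b [c [[Ha Hb Hc] <-]]]] [a' [b' [c' [[Ha' Hb' Hc'] <-]]]].
apply: (fden_iff (P := addM (mulM a (addM c' (oneM M))) (mulM b' (addM c (oneM M))) <='
  addM (mulM a' (addM c (oneM M))) (mulM b (addM c' (oneM M))))).
  rewrite -num_not_lt leNgt -(rwP negP).
  by have E := frv_lt a' b' c' a b c; split=> H /E.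
by apply: fden_le; do ! (first [eassumption | apply: nden_1 | apply: nden_add | apply: nden_mul]).
Qed.

Lemma frden_q0 s : frden s q0 0.
Proof.
exists (zeroM M), (zeroM M), (zeroM M); split=> //.
by rewrite /frv io0 subr0 mul0r.
Qed.

Lemma frden_q1 s : frden s q1 1.
Proof.
exists (oneM M), (zeroM M), (zeroM M); split=> //.
by rewrite /frv io0 io1 subr0 add0r divr1.
Qed.

Lemma frden_qinv_succ s t m : nden s t m -> frden s (qinv_succ t) (io m + 1)^-1.
Proof.
move=> Ht; exists (oneM M), (zeroM M), m; split=> //.
by rewrite /frv io0 io1 subr0 mul1r.
Qed.

Lemma fden_qabs s x k q (K : Prop) : frden s x q ->
  (forall s' y, ext s s' -> frden s' y `|q| -> fden s' (k y) K) -> fden s (qabs x k) K.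
Proof.
move=> [a [b [c [[Ha Hb Hc] Eq]]]] Hk.
apply: (fden_iff (P := exists d, (a = addM b d \/ b = addM a d) /\ K)).
  split=> [[d []//]|HK].
  case: (num_lt_total a b) => [/num_lt_le/num_le_exists [d ->]|
    [->|/num_lt_le/num_le_exists [d ->]]].
  - by exists d; split=> //; right.
  - by exists (zeroM M); split=> //; left; rewrite num_addx0.
  - by exists d; split=> //; left.
apply: fden_ex => s' t d E Ht; apply: fden_and.
  by apply: fden_or; apply: fden_eq; try apply: nden_add => //; apply: nden_ext E _.
move=> H; apply: Hk => //; exists d, (zeroM M), c; split.
  by split=> //; apply: nden_ext E _.
have d0 := io_ge0 d; have c0 := io_succ_gt0 c.
rewrite -Eq /frv io0 subr0 normrM normfV (gtr0_norm c0); congr (_ / _).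
case: H => ->; rewrite ioD.
  by rewrite (_ : _ - _ = io d) ?ger0_norm //; ring.
by rewrite (_ : _ - _ = - io d) ?normrN ?ger0_norm //; ring.
Qed.

Lemma fden_qdist_lt s x y z p q r : frden s x p -> frden s y q -> frden s z r ->
  fden s (qdist_lt x y z) (`|p - q| < r).
Proof.
move=> Hx Hy Hz; apply: fden_qabs; first exact: frden_sub Hx Hy.
by move=> s' d E Hd; apply: fden_qlt => //; apply: frden_ext E _.
Qed.

Lemma fden_all_frac s (p : Defs.frac -> fml) (P : N -> N -> N -> Prop) :
  (forall s' x a b c, ext s s' -> nden s' (pos x) a -> nden s' (neg x) b ->
     nden s' (den x) c -> fden s' (p x) (P a b c)) ->
  fden s (all_frac p) (forall a b c, P a b c).
Proof.
move=> H; apply: fden_all => s1 t1 a E1 H1; apply: fden_all => s2 t2 b E2 H2.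
apply: fden_all => s3 t3 c E3 H3.
apply: H => //=; first exact: ext_trans E1 (ext_trans E2 E3).
  exact: nden_ext (ext_trans E2 E3) _.
exact: nden_ext E3 _.
Qed.

Lemma fden_ex_frac s (p : Defs.frac -> fml) (P : N -> N -> N -> Prop) :
  (forall s' x a b c, ext s s' -> nden s' (pos x) a -> nden s' (neg x) b ->
     nden s' (den x) c -> fden s' (p x) (P a b c)) ->
  fden s (ex_frac p) (exists a b c, P a b c).
Proof.
move=> H; apply: fden_ex => s1 t1 a E1 H1; apply: fden_ex => s2 t2 b E2 H2.
apply: fden_ex => s3 t3 c E3 H3.
apply: H => //=; first exact: ext_trans E1 (ext_trans E2 E3).
  exact: nden_ext (ext_trans E2 E3) _.
exact: nden_ext E3 _.
Qed.

Lemma fden_is_rat s x a b c : nden s (pos x) a -> nden s (neg x) b -> nden s (den x) c ->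
  fden s (is_rat x) (iscan a b c).
Proof.
move=> Ha Hb Hc; apply: (fden_iff (iff_sym (iscanP a b c))).
apply: fden_all_frac => s' y a' b' c' E Ha' Hb' Hc'; apply: fden_imp.
  apply: fden_lt; first exact: nden_code.
  exact: nden_ext E (nden_code Ha Hb Hc).
move=> _; apply/fden_not/fden_qeq; first by exists a', b', c'.
by apply: frden_ext E _; exists a, b, c.
Qed.

Lemma iscan_ratden s x a b c : nden s (pos x) a -> nden s (neg x) b -> nden s (den x) c ->
  iscan a b c -> ratden s x (frv a b c).
Proof. by move=> Ha Hb Hc /rcodeE /cd_inj [E1 E2 E3]; split; rewrite -?E1 -?E2 -?E3. Qed.

Lemma fden_all_rat s (p : Defs.frac -> fml) (P : Q -> Prop) :
  (forall s' x q, ext s s' -> ratden s' x q -> fden s' (p x) (P q)) ->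
  fden s (all_rat p) (forall q, P q).
Proof.
move=> H; apply: (fden_iff (P := forall a b c, iscan a b c -> P (frv a b c))).
  split=> [H' q|H' a b c _]; last exact: H'.
  by rewrite -(crepK q); apply: H'; case: (crepP q).
apply: fden_all_frac => s' x a b c E Ha Hb Hc; apply: fden_imp; first exact: fden_is_rat.
by move=> can; apply: H => //; apply: iscan_ratden.
Qed.

Lemma fden_ex_rat s (p : Defs.frac -> fml) (P : Q -> Prop) :
  (forall s' x q, ext s s' -> ratden s' x q -> fden s' (p x) (P q)) ->
  fden s (ex_rat p) (exists q, P q).
Proof.
move=> H; apply: (fden_iff (P := exists a b c, iscan a b c /\ P (frv a b c))).
  split=> [[a [b [c [_ HP]]]]|[q HP]]; first by exists (frv a b c).
  by exists (cpos q), (cneg q), (cden q); rewrite crepK; case: (crepP q).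
apply: fden_ex_frac => s' x a b c E Ha Hb Hc; apply: fden_and; first exact: fden_is_rat.
by move=> can; apply: H => //; apply: iscan_ratden.
Qed.

Lemma fden_all_posrat s (p : Defs.frac -> fml) (P : Q -> Prop) :
  (forall s' x q, ext s s' -> frden s' x q -> fden s' (p x) (P q)) ->
  fden s (all_posrat p) (forall q, 0 < q -> P q).
Proof.
move=> H; apply: fden_all_rat => s' x q E /ratden_frden Hx; apply: fden_imp.
  exact: fden_qlt (frden_q0 _) Hx.
by move=> _; apply: H.
Qed.

Lemma fden_is_fun s (D : nterm -> fml) X (D' : N -> Prop) A :
  (forall s' t d, ext s s' -> nden s' t d -> fden s' (D t) (D' d)) -> sden s X A ->
  fden s (is_fun D X) (exists f, is_graph D' A f).
Proof.
move=> HD HX.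
apply: (fden_iff (P := (forall m, elemM m A -> exists d, D' d /\ exists q, m = pr d (rcode q)) /\
  (forall d, D' d -> exists q, elemM (pr d (rcode q)) A /\
     forall r, elemM (pr d (rcode r)) A -> rcode r = rcode q))).
  split=> [[H1 H2]|[f Hf]].
    (* Outside [D'] the function may take any value, as its graph is restricted to [D']. *)
    pose f d : Q := if pselect (exists q, elemM (pr d (rcode q)) A) is left H
      then projT1 (cid H) else 0.
    have Hf d : D' d -> elemM (pr d (rcode (f d))) A.
      move=> /H2 [q [Hq _]]; rewrite /f; case: pselect => [H|[]]; last by exists q.
      exact: projT2 (cid H).
    exists f => m; split=> [Hm|[d [Dd ->]]]; last exact: Hf.
    have [d [Dd [q Em]]] := H1 m Hm; exists d; split=> //; rewrite Em.
    have [r [_ Hr]] := H2 d Dd; congr pr.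
    by rewrite (Hr q) -?Em // (Hr (f d)) //; apply: Hf.
  split=> [m /Hf [d [Dd ->]]|d Dd]; first by exists d; split=> //; exists (f d).
  exists (f d); split; first by apply/Hf; exists d.
  by move=> r /Hf [d' [_ /pr_inj [<- ->]]].
apply: fden_and.
  apply: fden_all => s1 t m E1 Ht; apply: fden_imp; first exact: fden_mem (sden_ext E1 HX).
  move=> _; apply: fden_ex => s2 u d E2 Hu; apply: fden_and.
    exact: HD (ext_trans E1 E2) Hu.
  move=> _; apply: fden_ex_rat => s3 q' q E3 Hq; apply: fden_eq.
    exact: nden_ext (ext_trans E2 E3) Ht.
  by apply: nden_npair (nden_ext E3 Hu) (ratden_code Hq).
move=> _; apply: fden_all => s1 t d E1 Ht; apply: fden_imp; first exact: HD.
move=> _; apply: fden_ex_rat => s2 q' q E2 Hq; apply: fden_and.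
  apply: fden_mem (sden_ext (ext_trans E1 E2) HX).
  by apply: nden_npair (nden_ext E2 Ht) (ratden_code Hq).
move=> _; apply: fden_all_rat => s3 r' r E3 Hr; apply: fden_imp.
  apply: fden_mem (sden_ext (ext_trans E1 (ext_trans E2 E3)) HX).
  by apply: nden_npair (nden_ext (ext_trans E2 E3) Ht) (ratden_code Hr).
by move=> _; apply: fden_eq (ratden_code Hr) (ratden_code (ratden_ext E3 Hq)).
Qed.

Lemma fden_value s X t k D A f d (K : Prop) : is_graph D A f -> D d ->
  sden s X A -> nden s t d ->
  (forall s' x, ext s s' -> ratden s' x (f d) -> fden s' (k x) K) -> fden s (value X t k) K.
Proof.
move=> Hf Dd HX Ht Hk.
apply: (fden_iff (P := exists q, elemM (pr d (rcode q)) A /\ K)).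
  split=> [[q []//]|HK]; exists (f d); split=> //; apply/Hf; by exists d.
apply: fden_ex_rat => s' x q E Hx; apply: fden_and.
  by apply: fden_mem (sden_ext E HX); apply: nden_npair (nden_ext E Ht) (ratden_code Hx).
move=> /Hf [d' [_ /pr_inj [Ed /rcode_inj Eq]]]; apply: Hk => //.
by rewrite Ed -Eq.
Qed.

(** * Denotations of sequences and of notions about reals *)

Definition rden (s : state) (x : rseq) (f : N -> Q) : Prop :=
  forall s' t a k (K : Prop), ext s s' -> nden s' t a ->
  (forall s'' y, ext s' s'' -> frden s'' y (f a) -> fden s'' (k y) K) -> fden s' (x t k) K.

(** Sequences are given in continuation-passing style: applied to [k], they mean whatever [k] means
    at the value. Here [k] may rely on a least code, as [ratsden_app] does; for [rden] it sees an
    arbitrary fraction. *)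
Definition ratsden (s : state) (x : rseq) (f : N -> Q) : Prop :=
  forall s' t a k (K : Prop), ext s s' -> nden s' t a ->
  (forall s'' y, ext s' s'' -> ratden s'' y (f a) -> fden s'' (k y) K) -> fden s' (x t k) K.

Lemma ratsden_rden s x f : ratsden s x f -> rden s x f.
Proof. by move=> H s' t a k K E Ht Hk; apply: H E Ht _ => s'' y E' /ratden_frden; apply: Hk. Qed.

Lemma rden_ext s s' x f : ext s s' -> rden s x f -> rden s' x f.
Proof. by move=> E H s'' t a k K E'; apply: H; apply: ext_trans E E'. Qed.

Lemma ratsden_seq_of s X A f : is_graph (fun _ => True) A f -> sden s X A ->
  ratsden s (seq_of X) f.
Proof.
move=> Hf HX s' t a k K E Ht Hk; exact: (fden_value Hf I (sden_ext E HX) Ht Hk).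
Qed.

Lemma rden_const s x q : frden s x q -> rden s (Defs.const x) (fun _ => q).
Proof. by move=> Hx s' t a k K E Ht; apply; [exact: ext_refl|apply: frden_ext E Hx]. Qed.

Lemma rden_rdist s x y f g : rden s x f -> rden s y g ->
  rden s (rdist x y) (fun n => `|f n - g n|).
Proof.
move=> Hx Hy s' t a k K E Ht Hk; apply: (Hx _ _ _ _ _ E Ht) => s1 p E1 Hp.
apply: (Hy _ _ _ _ _ (ext_trans E E1) (nden_ext E1 Ht)) => s2 q E2 Hq.
apply: fden_qabs; first exact: frden_sub (frden_ext E2 Hp) Hq.
by move=> s3 z E3; apply: Hk; apply: ext_trans E1 (ext_trans E2 E3).
Qed.

Lemma ratsden_row s Y A g t n : is_graph (fun d => exists n i, d = pr n i) A g ->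
  sden s Y A -> nden s t n -> ratsden s (Defs.row Y t) (fun i => g (pr n i)).
Proof.
move=> Hg HY Ht s' u i k K E Hu Hk.
have Hd := nden_npair (nden_ext E Ht) Hu.
by apply: (fden_value Hg _ (sden_ext E HY) Hd Hk); exists n, i.
Qed.

Lemma ratsden_fval s F A f q' q : is_graph (fun d => exists q i, d = pr (rcode q) i) A f ->
  sden s F A -> ratden s q' q -> ratsden s (fval F q') (fun i => f (pr (rcode q) i)).
Proof.
move=> Hg HF Hq s' u i k K E Hu Hk.
have Hd := nden_npair (ratden_code (ratden_ext E Hq)) Hu.
by apply: (fden_value Hg _ (sden_ext E HF) Hd Hk); exists q, i.
Qed.

Lemma ratsden_app s F A f x g : is_graph (fun d => exists q i, d = pr (rcode q) i) A f ->
  sden s F A -> ratsden s x g -> ratsden s (Defs.app F x) (fun i => f (pr (rcode (g i)) i)).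
Proof.
move=> Hf HF Hx s' t i k K E Ht Hk; apply: (Hx _ _ _ _ _ E Ht) => s1 q E1 Hq.
apply: (ratsden_fval Hf (sden_ext (ext_trans E E1) HF) Hq (ext_refl _) (nden_ext E1 Ht)).
by move=> s2 y E2; apply: Hk; apply: ext_trans E1 E2.
Qed.

Lemma fden_cauchy s x f : rden s x f -> fden s (cauchy x) (Cauchy f).
Proof.
move=> Hx; apply: fden_all_posrat => s1 e' e E1 He; apply: fden_ex => s2 k' k E2 Hk.
apply: fden_all => s3 m' m E3 Hm; apply: fden_all => s4 n' n E4 Hn.
have Hm4 := nden_ext E4 Hm; have Hk4 := nden_ext (ext_trans E3 E4) Hk.
have E34 := ext_trans E3 E4; have E24 := ext_trans E2 E34; have E14 := ext_trans E1 E24.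
apply: fden_imp => [|_]; first exact: fden_le.
apply: fden_imp => [|_]; first exact: fden_le.
apply: (Hx _ _ _ _ _ E14 Hm4) => s5 p E5 Hp.
apply: (Hx _ _ _ _ _ (ext_trans E14 E5) (nden_ext E5 Hn)) => s6 q E6 Hq.
apply: fden_qdist_lt => //; first exact: frden_ext E6 Hp.
exact: frden_ext (ext_trans E24 (ext_trans E5 E6)) He.
Qed.

Lemma fden_rle s x y f g : rden s x f -> rden s y g -> fden s (rle x y) (Rle f g).
Proof.
move=> Hx Hy; apply: fden_all_posrat => s1 e' e E1 He; apply: fden_ex => s2 k' k E2 Hk.
apply: fden_all => s3 n' n E3 Hn.
have E23 := ext_trans E2 E3; have E13 := ext_trans E1 E23.
apply: fden_imp => [|_]; first by apply: fden_le => //; apply: nden_ext E3 Hk.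
apply: (Hx _ _ _ _ _ E13 Hn) => s4 p E4 Hp.
apply: (Hy _ _ _ _ _ (ext_trans E13 E4) (nden_ext E4 Hn)) => s5 q E5 Hq.
apply: fden_qle; first exact: frden_ext E5 Hp.
by apply: frden_add => //; apply: frden_ext (ext_trans E23 (ext_trans E4 E5)) He.
Qed.

Lemma fden_req s x y f g : rden s x f -> rden s y g -> fden s (req x y) (Req f g).
Proof. by move=> Hx Hy; apply: fden_and => [|_]; apply: fden_rle. Qed.

Lemma fden_rlt s x y f g : rden s x f -> rden s y g -> fden s (rlt x y) (Rlt f g).
Proof.
by move=> Hx Hy; apply: fden_and => [|_]; [apply: fden_rle|apply/fden_not/fden_req].
Qed.

Lemma fden_in_unit_interval s x f : rden s x f -> fden s (in_unit_interval x) (In01 f).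
Proof.
move=> Hx; apply: fden_and => [|_]; first exact: fden_cauchy.
apply: fden_and => [|_]; apply: fden_rle => //; apply: rden_const.
  exact: frden_q0.
exact: frden_q1.
Qed.

Lemma fden_in_ball s r' r x f q' q : frden s r' r -> rden s x f -> frden s q' q ->
  fden s (in_ball r' x q') (InBall r f q).
Proof.
move=> Hr Hx Hq; apply: fden_rlt; last exact: rden_const.
exact: rden_rdist Hx (rden_const Hq).
Qed.

Lemma fden_in_dom s F A f x g : is_graph (fun d => exists q i, d = pr (rcode q) i) A f ->
  sden s F A -> rden s x g -> fden s (in_dom F x) (InDom (fun q i => f (pr (rcode q) i)) g).
Proof.
move=> Hf HF Hx; apply: fden_all_posrat => s1 e' e E1 He; apply: fden_ex => s2 m' m E2 Hm.
apply: fden_all_rat => s3 q' q E3 Hq; apply: fden_all_rat => s4 r' r E4 Hr.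
have E34 := ext_trans E3 E4; have E24 := ext_trans E2 E34; have E14 := ext_trans E1 E24.
have Hq4 := ratden_ext E4 Hq; have Hm4 := nden_ext E34 Hm.
have Hx4 := rden_ext E14 Hx; have Hd4 := frden_qinv_succ Hm4.
apply: fden_imp => [|_]; first exact: fden_in_ball (ratden_frden Hq4).
apply: fden_imp => [|_]; first exact: fden_in_ball (ratden_frden Hr).
apply: fden_all => s5 i' i E5 Hi; apply: fden_all => s6 j' j E6 Hj.
have E56 := ext_trans E5 E6; have Hi6 := nden_ext E6 Hi.
have Hm6 := nden_add (nden_ext E56 Hm4) (@nden_1 s6).
have E16 := ext_trans E14 E56.
apply: fden_imp => [|_]; first exact: fden_le.
apply: fden_imp => [|_]; first exact: fden_le.
have HF6 := sden_ext E16 HF.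
apply: (ratsden_fval Hf HF6 (ratden_ext E56 Hq4) (ext_refl _) Hi6) => s7 u E7 Hu.
apply: (ratsden_fval Hf (sden_ext E7 HF6) (ratden_ext (ext_trans E56 E7) Hr)
  (ext_refl _) (nden_ext E7 Hj)) => s8 v E8 Hv.
apply: fden_qdist_lt; [exact: frden_ext E8 (ratden_frden Hu)|exact: ratden_frden|].
exact: frden_ext (ext_trans (ext_trans E24 E56) (ext_trans E7 E8)) He.
Qed.

Lemma is_graph_unique (D : N -> Prop) A f g :
  is_graph D A f -> is_graph D A g -> forall d, D d -> f d = g d.
Proof.
move=> Hf Hg d Dd.
have /Hg [d' [_ /pr_inj [<- /rcode_inj //]]] : elemM (pr d (rcode (f d))) A.
by apply/Hf; exists d.
Qed.

Lemma fden_is_real s X A : sden s X A ->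
  fden s (is_real X) (exists f, is_graph (fun _ => True) A f /\ Cauchy f).
Proof.
move=> HX.
have Hfun : fden s (is_fun (fun _ => f_true) X) (exists f, is_graph (fun _ => True) A f).
  by apply: fden_is_fun => // *; apply: fden_true.
(* If the set is no function, its being Cauchy cannot be interpreted, but then the conjunction is
   false anyway. *)
case: (EM (exists f, is_graph (fun _ => True) A f)) => [[f Hf]|nf]; last first.
  apply: (fden_iff (P := (exists f, is_graph (fun _ => True) A f) /\ True)).
    by split=> [[]//|[f [Hf _]]]; case: nf; exists f.
  by apply: fden_and Hfun _.
apply: (fden_iff (P := (exists f, is_graph (fun _ => True) A f) /\ Cauchy f)).
  split=> [[_ H]|[g [Hg Cg]]]; first by exists f.
  split; first by exists f.
  suff -> : f = g by [].
  by apply: functional_extensionality => d; apply: (is_graph_unique Hf Hg).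
apply: fden_and Hfun _ => _; apply: fden_cauchy; apply: ratsden_rden.
exact: (ratsden_seq_of Hf HX).
Qed.

(** * The clauses of the orbit principle *)

Let GF := is_graph (fun d => exists q i, d = pr (rcode q) i).
Let GX := is_graph (fun _ => True).
Let GY := is_graph (fun d => exists n i, d = pr n i).
Let ap (f : N -> Q) (q : Q) (i : N) : Q := f (pr (rcode q) i).

Let GX_unique A f g : GX A f -> GX A g -> f = g.
Proof. by move=> Hf Hg; apply: functional_extensionality => d; apply: (is_graph_unique Hf Hg). Qed.

Let GF_unique A f g : GF A f -> GF A g -> ap f = ap g.
Proof.
move=> Hf Hg; apply: functional_extensionality => q; apply: functional_extensionality => i.
by apply: (is_graph_unique Hf Hg); exists q, i.
Qed.

Let fden_continuous s F X A B : (exists f, GF A f) -> (exists x, GX B x /\ Cauchy x) ->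
  sden s F A -> sden s X B ->
  fden s (f_imp (in_unit_interval (seq_of X))
    (f_and (in_dom F (seq_of X)) (in_unit_interval (Defs.app F (seq_of X)))))
  (forall f x, GF A f -> GX B x -> In01 x -> InDom (ap f) x /\ In01 (fun i => ap f (x i) i)).
Proof.
move=> [f Hf] [x [Hx _]] HF HX.
apply: (fden_iff (P := In01 x -> InDom (ap f) x /\ In01 (fun i => ap f (x i) i))).
  split=> [H f' x' Hf' Hx'|]; last by apply.
  by rewrite (GF_unique Hf' Hf) (GX_unique Hx' Hx).
have Sx := ratsden_seq_of Hx HX; have Rx := ratsden_rden Sx.
apply: fden_imp => [|_]; first exact: fden_in_unit_interval.
apply: fden_and => [|_]; first exact: fden_in_dom Hf HF Rx.
apply: fden_in_unit_interval; apply: ratsden_rden; exact: (ratsden_app Hf HF Sx).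
Qed.

Let fden_is_fun_GF s F A : sden s F A ->
  fden s (is_partial_continuous F) (exists f, GF A f).
Proof.
move=> HF; apply: fden_is_fun => // s1 t d E1 Ht.
apply: fden_ex_rat => s2 q' q E2 Hq; apply: fden_ex => s3 i' i E3 Hi.
apply: fden_eq; first exact: nden_ext (ext_trans E2 E3) Ht.
exact: nden_npair (ratden_code (ratden_ext E3 Hq)) Hi.
Qed.

Let fden_continuous_unit_interval s F A : sden s F A ->
  fden s (continuous_unit_interval F) ((exists f, GF A f) /\
    forall B f x, GF A f -> GX B x -> In01 x -> InDom (ap f) x /\ In01 (fun i => ap f (x i) i)).
Proof.
move=> HF; apply: fden_and => [|ex]; first exact: fden_is_fun_GF.
apply: (fden_iff (P := forall B, (exists x, GX B x /\ Cauchy x) ->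
   forall f x, GF A f -> GX B x -> In01 x -> InDom (ap f) x /\ In01 (fun i => ap f (x i) i))).
  split=> H B; last by move=> _; apply: H.
  by move=> f x Hf Hx ux; apply: (H B) => //; exists x; split=> //; case: ux.
apply: fden_allS => s1 X B E1 HX; apply: fden_imp; first exact: fden_is_real.
by move=> ex'; apply: fden_continuous => //; apply: sden_ext E1 HF.
Qed.

Let orbit f x g : Prop := let y n i := g (pr n i) in
  uniformly_Cauchy y /\ Req (y (zeroM M)) x /\
  forall n, InDom (ap f) (y n) /\ Req (y (addM n (oneM M))) (fun i => ap f (y n i) i).

Let fden_is_orbit s F X Y A B C f x : GF A f -> GX B x ->
  sden s F A -> sden s X B -> sden s Y C ->
  fden s (is_orbit F X Y) (exists g, GY C g /\ orbit f x g).
Proof.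
move=> Hf Hx HF HX HY.
have Hfun : fden s (is_fun (fun d => f_ex (fun n => f_ex (fun i => f_eq d (npair n i)))) Y)
    (exists g, GY C g).
  apply: fden_is_fun => // s1 t d E1 Ht.
  apply: fden_ex => s2 n' n E2 Hn; apply: fden_ex => s3 i' i E3 Hi.
  apply: fden_eq; first exact: nden_ext (ext_trans E2 E3) Ht.
  exact: nden_npair (nden_ext E3 Hn) Hi.
case: (EM (exists g, GY C g)) => [[g Hg]|ng]; last first.
  apply: (fden_iff (P := ((exists g, GY C g) /\ True) /\ True)).
    by split=> [[[]//]|[g [Hg _]]]; case: ng; exists g.
  by apply: fden_and => [|[]//]; apply: fden_and Hfun _.
apply: (fden_iff (P := ((exists g, GY C g) /\ uniformly_Cauchy (fun n i => g (pr n i))) /\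
  (Req (fun i => g (pr (zeroM M) i)) x /\
   forall n, InDom (ap f) (fun i => g (pr n i)) /\
     Req (fun i => g (pr (addM n (oneM M)) i)) (fun i => ap f (g (pr n i)) i)))).
  split=> [[[_ H1] H2]|[g' [Hg' H]]]; first by exists g.
  pose y n i := g' (pr n i).
  have E : y = (fun n i => g (pr n i)).
    apply: functional_extensionality => n; apply: functional_extensionality => i.
    by apply: (is_graph_unique Hg' Hg); exists n, i.
  have := H : uniformly_Cauchy y /\ Req (y (zeroM M)) x /\ forall n,
    InDom (ap f) (y n) /\ Req (y (addM n (oneM M))) (fun i => ap f (y n i) i).
  by rewrite E => -[H1 H2]; split; [split; [exists g|]|].
apply: fden_and => [|_].
  apply: fden_and Hfun _ => _; apply: fden_all_posrat => s1 e' e E1 He.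
  apply: fden_ex => s2 k' k E2 Hk; apply: fden_all => s3 n' n E3 Hn.
  apply: fden_all => s4 i' i E4 Hi; apply: fden_all => s5 j' j E5 Hj.
  have E35 := ext_trans E3 (ext_trans E4 E5); have E25 := ext_trans E2 E35.
  have Hk5 := nden_ext E35 Hk; have Hi5 := nden_ext E5 Hi.
  have Hn5 := nden_ext (ext_trans E4 E5) Hn; have HY5 := sden_ext (ext_trans E1 E25) HY.
  apply: fden_imp => [|_]; first exact: fden_le.
  apply: fden_imp => [|_]; first exact: fden_le.
  have Rn := ratsden_rden (ratsden_row Hg HY5 Hn5).
  apply: (Rn _ _ _ _ _ (ext_refl _) Hi5) => s6 p E6 Hp.
  apply: (Rn _ _ _ _ _ E6 (nden_ext E6 Hj)) => s7 q E7 Hq.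
  apply: fden_qdist_lt; [exact: frden_ext E7 Hp|exact: Hq|].
  exact: frden_ext (ext_trans E25 (ext_trans E6 E7)) He.
apply: fden_and => [|_].
  apply: fden_req; apply: ratsden_rden; last exact: (ratsden_seq_of Hx HX).
  exact: (ratsden_row Hg HY (@nden_0 s)).
apply: fden_all => s1 n' n E1 Hn.
have HY1 := sden_ext E1 HY; have HF1 := sden_ext E1 HF.
have Sn := ratsden_row Hg HY1 Hn.
apply: fden_and => [|_]; first exact: fden_in_dom Hf HF1 (ratsden_rden Sn).
apply: fden_req; apply: ratsden_rden; last exact: (ratsden_app Hf HF1 Sn).
exact: (ratsden_row Hg HY1 (nden_add Hn (@nden_1 _))).
Qed.

Lemma orbit_principle_sat (s : nat -> N) (r : nat -> sets M) :
  sat s r orbit_principle <-> orbits_exist.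
Proof.
pose s0 := State 0 0 s r.
suff H : fden s0 (f_allS (fun F => f_imp (continuous_unit_interval F)
    (f_allS (fun X => f_imp (is_real X) (f_imp (in_unit_interval (seq_of X))
      (f_exS (fun Y => is_orbit F X Y))))))) orbits_exist.
  exact: H (ext_refl s0).
apply: (fden_iff (P := forall A, ((exists f, GF A f) /\ forall B f x, GF A f -> GX B x ->
    In01 x -> InDom (ap f) x /\ In01 (fun i => ap f (x i) i)) ->
  forall B, (exists x, GX B x /\ Cauchy x) -> forall f x, GF A f -> GX B x -> In01 x ->
    exists C g, GY C g /\ orbit f x g)).
  split=> [H F f Hf phi Hc X x Hx ux|H A [ex Hc] B ex' f x Hf Hx ux].
    have [||C [g [Hg Ho]]] := H F _ X _ f x Hf Hx ux.
    - split=> [|B f' x' Hf' Hx' ux']; first by exists f.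
      by rewrite (GF_unique Hf' Hf); apply: Hc Hx' ux'.
    - by exists x; split=> //; case: ux.
    by exists C, g.
  exact: (H A f Hf (fun B' x' Hx' ux' => Hc B' f x' Hf Hx' ux') B x Hx ux).
apply: fden_allS => s1 F A E1 HF; apply: fden_imp; first exact: fden_continuous_unit_interval.
move=> [[f Hf] _]; apply: fden_allS => s2 X B E2 HX.
apply: fden_imp; first exact: fden_is_real.
move=> [x [Hx _]].
apply: (fden_iff (P := In01 x -> exists C g, GY C g /\ orbit f x g)).
  split=> [H f' x' Hf' Hx'|]; last by move=> /(_ f x Hf Hx).
  by rewrite /orbit (GF_unique Hf' Hf) (GX_unique Hx' Hx).
apply: fden_imp => [|_].
  apply: fden_in_unit_interval; apply: ratsden_rden; exact: (ratsden_seq_of Hx HX).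
apply: fden_exS => s3 Y C E3 HY.
apply: fden_is_orbit => //; first exact: sden_ext (ext_trans E2 E3) HF.
exact: sden_ext E3 HX.
Qed.

End RealNotions.

(** * Arithmetical comprehension *)

Definition Sigma_comprehension (M : rca) : Prop :=
  forall P : num M -> Prop, S1 (n := 1) (fun c => P (snd c)) ->
  exists X, forall x, elemM x X <-> P x.

Section ArithmeticalComprehension.
Variable M : rca.

(** Tuples are coded by numbers, so that comprehension for unary predicates applies to predicates of
    any arity. *)
Fixpoint ctx_code (n : nat) : ctx M n -> num M :=
  match n with
  | 0 => fun _ => zeroM M
  | S n => fun c => pr (ctx_code (fst c)) (snd c)
  end.

Lemma ctx_code_inj n : injective (@ctx_code n).
Proof.
elim: n => [|n IH] /=; first by case=> -[].
by move=> [c x] [d y] /pr_inj /= [/IH -> ->].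
Qed.

Lemma DT_ctx_code n : DT (@ctx_code n).
Proof.
elim: n => [|n IH]; first exact: DT_zero.
have H := DT_fst IH; rewrite /= /pr.
have Hs : DT (fun c : ctx M (S n) => snd c) by dfn_term.
by apply: DT_add => //; apply: DT_mul; apply: DT_add.
Qed.

(** Inserts [z] as the oldest coordinate: those of the tuple stay last and can be quantified away
    one by one. *)
Fixpoint glue (n : nat) (z : num M) : ctx M n -> ctx M (S n) :=
  match n with
  | 0 => fun _ => (tt, z)
  | S n => fun c => (glue z (fst c), snd c)
  end.

Fixpoint drop1 (n : nat) : ctx M (S n) -> ctx M n :=
  match n with
  | 0 => fun _ => tt
  | S n => fun c => (@drop1 n (fst c), snd c)
  end.

Fixpoint first1 (n : nat) : ctx M (S n) -> num M :=
  match n with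
  | 0 => fun c => snd c
  | S n => fun c => @first1 n (fst c)
  end.

Lemma glueK n z (c : ctx M n) : drop1 (glue z c) = c /\ first1 (glue z c) = z.
Proof.
by elim: n c => [|n IH] /= => [[]|[c x]] //=; case: (IH c) => -> ->.
Qed.

Lemma proj_first1 n : proj (@first1 n).
Proof. by elim: n => [|n IH]; [apply: proj_snd|apply: proj_fst]. Qed.

Lemma proj_drop1 n (f : ctx M n -> num M) : proj f -> proj (fun c => f (drop1 c)).
Proof.
elim: n f => [|n IH] f; first by move=> _; exact: (@proj_const M 1 (f tt)).
exact: (reindex_up IH).
Qed.

Lemma S1_ex_ctx n (R : ctx M (S n) -> Prop) : S1 R ->
  S1 (n := 1) (fun d => exists c : ctx M n, R (glue (snd d) c)).
Proof.
elim: n R => [|n IH] R HR.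
  apply: (S1_ext (P := fun d : ctx M 1 => R (tt, snd d))).
    by move=> [[] z]; split=> [H|[_ //]]; exists tt.
  apply: (S1_reindex (m := 1) (n := 1) (th := fun d => (tt, snd d)) _ HR).
  by apply: reindex_pair (@proj_snd _ _) => f _; apply: proj_const.
apply: (S1_ext (P := fun d : ctx M 1 => exists c : ctx M n, exists x, R (glue (snd d) c, x))).
  by move=> d; split=> [[c [x H]]|[[c x] H]]; [exists (c, x)|exists c, x].
have HR' : S1 (n := S (S n)) (fun c => R (fst c, snd c)) by apply: S1_ext HR => -[].
have H := S1_ex (n := S n) (P := fun c x => R (c, x)) HR'.
exact: (IH _ H).
Qed.

Section Consequences.
Hypothesis SC : Sigma_comprehension M.

(** The codes of the tuples satisfying [P] form a set, and with this set as a parameter [P] becomes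
    atomic. Iterating this removes all number quantifiers. *)
Lemma S1_D0 n (P : ctx M n -> Prop) : S1 P -> D0 P.
Proof.
move=> HP.
have HR : S1 (n := S n) (fun c => first1 c = ctx_code (drop1 c) /\ P (drop1 c)).
  apply: S1_and; last exact: S1_reindex (@proj_drop1 n) HP.
  apply: S1_eq; apply: R1_DT; first exact/DT_proj/proj_first1.
  have [t [g [Hg Ht]]] := DT_ctx_code n.
  exists t, (fun i c => g i (drop1 c)); split=> [i|c]; [exact: proj_drop1|exact: Ht].
have [X HX] := @SC (fun z => exists c : ctx M n, first1 (glue z c) =
  ctx_code (drop1 (glue z c)) /\ P (drop1 (glue z c))) (S1_ex_ctx HR).
apply: (D0_ext (P := fun c => elemM (ctx_code c) X)) => [c|]; last exact/D0_mem/DT_ctx_code.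
rewrite HX; split=> [[d]|Pc].
  by case: (glueK (ctx_code c) d) => -> -> [/ctx_code_inj ->].
by exists c; case: (glueK (ctx_code c) c) => -> ->.
Qed.

Lemma D0_exists n (P : ctx M n -> num M -> Prop) :
  D0 (n := S n) (fun c => P (fst c) (snd c)) -> D0 (fun c => exists x, P c x).
Proof. by move=> H; apply/S1_D0/S1_ex/D0_S1. Qed.

Lemma D0_forall n (P : ctx M n -> num M -> Prop) :
  D0 (n := S n) (fun c => P (fst c) (snd c)) -> D0 (fun c => forall x, P c x).
Proof.
move=> H; apply: (D0_ext (P := fun c => ~ exists x, ~ P c x)) => [c|].
  by split=> [N x|H' [x]]; [apply: contrapT => N'; apply: N; exists x|apply].
exact/D0_not/D0_exists/D0_not.
Qed.

Lemma D0_arithmetical p n (g : nat -> ctx M n -> num M) (r : nat -> sets M) :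
  arithmetical p -> (forall i, proj (g i)) -> D0 (fun c => sat (M := M) (fun i => g i c) r p).
Proof.
elim: p n g => [s t|s t|t X||p IHp q IHq|p IHp|p _] n g //= Hp Hg.
- by apply: D0_eq; [exists s, g|exists t, g].
- by apply: D0_lt; [exists s, g|exists t, g].
- by apply: D0_mem; exists t, g.
- exact: D0_False.
- by case: Hp => Hp Hq; apply: D0_imp; [apply: IHp|apply: IHq].
apply: D0_forall.
pose g' i (c : ctx M (S n)) := scons (snd c) (fun j => g j (fst c)) i.
apply: (D0_ext (P := fun c => sat (M := M) (fun i => g' i c) r p)) => //.
by apply: IHp => // -[|i]; [apply: proj_snd|apply: proj_fst].
Qed.

Lemma arithmetical_comprehension p (s : nat -> num M) r :
  arithmetical p -> sat s r (comprehension_axiom p).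
Proof.
move=> Hp; apply/sat_comprehension/(D1_comprehension (M := M)).
suff H : D0 (n := 1) (fun c => sat (scons (snd c) s) r p).
  by split; apply: D0_S1 => //; apply: D0_not.
apply: (D0_arithmetical (n := 1) (g := fun i c => scons (snd c) s i)) => // -[|i].
  exact: proj_snd.
exact: proj_const.
Qed.

End Consequences.

Lemma Delta00_arithmetical p : Delta00 p -> arithmetical p.
Proof. by elim=> //=; tauto. Qed.

Lemma ACA_Sigma_comprehension : is_model ACA M -> Sigma_comprehension M.
Proof.
move=> HA P /S1_definable [p [r [g [Sp [Hg Hp]]]]].
have [tau [s Eg]] := unary_env Hg.
have ar : arithmetical (subst (fun i => Var (tau i)) (fun X => X) p).
  have [q Dq] := Sigma01_subst (fun i => Var (tau i)) (fun X => X) Sp.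
  by rewrite /=; split=> //; split=> //; apply: Delta00_arithmetical.
have /sat_comprehension [X HX] := HA _ (ACA_intro _ ar) s r.
exists X => x; rewrite HX -(Hp (tt, x)).
by rewrite -(sat_rename p (s := fun i => g i (tt, x)) (r := r)).
Qed.

End ArithmeticalComprehension.

(** * Sequences of fractions *)

Section Sequences.
Variable M : rca.
Local Notation Q := (frac_field M).
Local Notation N := (num M).
Local Notation "m <=' n" := (leM m n) (at level 70).
Local Notation "m +' n" := (addM m n) (at level 50, left associativity).
Local Open Scope ring_scope.

Lemma leM_addr (m n : N) : m <=' (m +' n).
Proof. by apply/num_le_exists; exists n. Qed.

Lemma leM_addl (m n : N) : n <=' (m +' n).
Proof. by rewrite num_addC; apply: leM_addr. Qed.

Lemma archimedean (e : Q) : 0 < e -> exists k : N, (io k + 1)^-1 <= e.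
Proof.
have [a [b [c ->]]] := fraction_repr e; rewrite -/(io a) -/(io b) -/(io c).
have c0 := io_succ_gt0 c; rewrite pmulr_lgt0 ?invr_gt0 // subr_gt0 -io_gt io_lt => ab.
exists c; rewrite -[X in X <= _]mul1r ler_wpM2r ?invr_ge0 ?(ltW c0) //; lra.
Qed.

Lemma inv_succ_gt0 (k : N) : 0 < (io k + 1)^-1 :> Q.
Proof. by rewrite invr_gt0 io_succ_gt0. Qed.

Lemma inv_succ_le (k l : N) : k <=' l -> (io l + 1)^-1 <= (io k + 1)^-1 :> Q.
Proof. by move=> /io_le kl; rewrite lef_pV2 ?posrE ?io_succ_gt0 // lerD2r. Qed.

Definition Close (x y : N -> Q) : Prop := forall e, 0 < e ->
  exists k, forall n, k <=' n -> `|x n - y n| <= e.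

Lemma Close_sym x y : Close x y -> Close y x.
Proof. by move=> H e /H [k Hk]; exists k => n /Hk; rewrite distrC. Qed.

Lemma Close_trans y x z : Close x y -> Close y z -> Close x z.
Proof.
move=> H1 H2 e e0; have e2 : 0 < e / 2 by lra.
have [k Hk] := H1 _ e2; have [l Hl] := H2 _ e2; exists (k +' l) => n le.
have := Hk n (num_le_trans (leM_addr _ _) le); have := Hl n (num_le_trans (leM_addl _ _) le).
move=> A1 A2; rewrite (_ : x n - z n = (x n - y n) + (y n - z n)); last by ring.
apply: le_trans (ler_normD _ _) _; lra.
Qed.

Lemma Req_Close x y : Req x y <-> Close x y.
Proof.
split=> [[H1 H2] e e0|H].
  have [k Hk] := H1 _ e0; have [l Hl] := H2 _ e0; exists (k +' l) => n le.
  have := Hk n (num_le_trans (leM_addr _ _) le); have := Hl n (num_le_trans (leM_addl _ _) le).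
  by move=> A1 A2; rewrite ler_norml; apply/andP; split; lra.
by split=> e e0; have [k Hk] := H _ e0; exists k => n /Hk; rewrite ler_norml => /andP [??]; lra.
Qed.

Lemma Cauchy_Close x y : Close x y -> Cauchy x -> Cauchy y.
Proof.
move=> H C e e0; have e3 : 0 < e / 4 by lra.
have [k Hk] := H _ e3; have [l Hl] := C _ e3; exists (k +' l) => m n lm ln.
have := Hk m (num_le_trans (leM_addr _ _) lm); have := Hk n (num_le_trans (leM_addr _ _) ln).
have := Hl _ _ (num_le_trans (leM_addl _ _) lm) (num_le_trans (leM_addl _ _) ln).
rewrite !ler_norml !ltr_norml => /andP [??] /andP [??] /andP [??].
by apply/andP; split; lra.
Qed.

Lemma Rle_trans x y z : Rle x y -> Rle y z -> @Rle M x z.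
Proof.
move=> H1 H2 e e0; have e2 : 0 < e / 2 by lra.
have [k Hk] := H1 _ e2; have [l Hl] := H2 _ e2; exists (k +' l) => n le.
have := Hk n (num_le_trans (leM_addr _ _) le); have := Hl n (num_le_trans (leM_addl _ _) le).
lra.
Qed.

Lemma In01_Close x y : Close x y -> In01 x -> In01 y.
Proof.
move=> H [C [H0 H1]]; have [E1 E2] := proj2 (Req_Close _ _) H; split.
  exact: Cauchy_Close H C.
by split; [apply: Rle_trans H0 E1|apply: Rle_trans E2 H1].
Qed.

(** A strict inequality between reals needs a positive gap, hence the smaller radius. *)
Lemma InBall_intro x (q r r' : Q) k : r' < r ->
  (forall n, k <=' n -> `|x n - q| <= r') -> InBall r x q.
Proof.
move=> rr Hk; split=> [e e0|[_ H]].
  by exists k => n /Hk H; lra.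
have [|l Hl] := H ((r - r') / 2); first lra.
have := Hl _ (leM_addl k l); have := Hk _ (leM_addr k l); lra.
Qed.

Lemma InBall_elim x (q r e : Q) : InBall r x q -> 0 < e ->
  exists k, forall n, k <=' n -> `|x n - q| <= r + e.
Proof. by move=> [H _] e0; apply: H. Qed.

Lemma RQ_reindex m n (th : ctx M m -> ctx M n) (f : ctx M n -> Q) :
  (forall h, proj h -> proj (fun c => h (th c))) -> RQ f -> RQ (fun c => f (th c)).
Proof.
move=> Hth [p [q [d [[Hp Hq Hd] E]]]].
exists (fun c => p (th c)), (fun c => q (th c)), (fun c => d (th c)).
by split=> //; split; exact: R1_reindex.
Qed.

Lemma RQ_lift m n (th : ctx M m -> ctx M n) (a : ctx M m -> N) (f : ctx M n -> N -> Q) :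
  (forall h, proj h -> proj (fun c => h (th c))) -> proj a ->
  RQ (n := S n) (fun c => f (fst c) (snd c)) -> RQ (fun c => f (th c) (a c)).
Proof.
move=> Hth Ha; apply: (RQ_reindex (m := m) (n := S n) (th := fun c => (th c, a c))).
exact: reindex_pair.
Qed.

Lemma RQ_if_lt n (f g h h' : ctx M n -> Q) : RQ f -> RQ g -> RQ h -> RQ h' ->
  RQ (fun c => if f c < g c then h c else h' c).
Proof.
move=> Hf Hg Hh Hh'.
have H : RQ (fun c => if pselect (f c < g c) then h c else h' c).
  apply: RQ_if => //; first exact: S1_Qlt.
  by apply: (S1_ext _ (S1_Qle Hg Hf)) => c; rewrite leNgt; split=> /negP.
apply: RQ_ext H => c; case: pselect => H; first by rewrite ifT.
by rewrite ifF //; apply/negP.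
Qed.

Lemma RQ_norm n (f : ctx M n -> Q) : RQ f -> RQ (fun c => `|f c|).
Proof.
move=> Hf; have H := RQ_if_lt Hf (RQ_const n 0) (RQ_opp Hf) Hf.
by apply: RQ_ext H => c; case: ltrgt0P => // ->; rewrite ?normr0.
Qed.

Lemma RQ_min n (f g : ctx M n -> Q) : RQ f -> RQ g -> RQ (fun c => Num.min (f c) (g c)).
Proof. by move=> Hf Hg; apply: RQ_ext (RQ_if_lt Hf Hg Hf Hg) => c; rewrite minElt. Qed.

Definition RQu (x : N -> Q) : Prop := RQ (n := 1) (fun c => x (snd c)).
Definition RQb (x : N -> N -> Q) : Prop := RQ (n := 2) (fun c => x (snd (fst c)) (snd c)).

Lemma RQ_app1 x n (f : ctx M n -> N) : RQu x -> R1 f -> RQ (fun c => x (f c)).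
Proof.
by move=> /RQ_rcode Hx Hf; apply: rcode_RQ; apply: (R1_app1 (F := fun i => rcode (x i))).
Qed.

Lemma RQ_app2 x n (f g : ctx M n -> N) : RQb x -> R1 f -> R1 g -> RQ (fun c => x (f c) (g c)).
Proof.
move=> /RQ_rcode Hx Hf Hg; apply: rcode_RQ.
exact: (R1_app2 (F := fun i j => rcode (x i j))).
Qed.

Lemma is_graph_elem D X (f : N -> Q) d z : is_graph D X f -> D d ->
  elemM (pr d z) X <-> z = rcode (f d).
Proof.
move=> Hf Dd; rewrite (Hf (pr d z)); split=> [[d' [_ /pr_inj [<- ->]]]//|->].
by exists d.
Qed.

Lemma RQu_graph X x : is_graph (fun _ => True) X x -> RQu x.
Proof.
move=> Hx; apply: rcode_RQ.
apply: (S1_ext (P := fun c : ctx M 2 => elemM (pr (snd (fst c)) (snd c)) X)) => [c|].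
  exact: is_graph_elem Hx I.
by rewrite /pr; dfs.
Qed.

Lemma RQb_graph X g : is_graph (fun d => exists n i, d = pr n i) X g ->
  RQb (fun n i => g (pr n i)).
Proof.
move=> Hg; apply: rcode_RQ.
apply: (S1_ext (P := fun c : ctx M 3 => elemM (pr (pr c.1.1.2 c.1.2) c.2) X)) => [c|].
  by apply: is_graph_elem Hg _; do 2 eexists.
by rewrite /pr; dfs.
Qed.

Lemma graph_RQu x : RQu x -> exists X, is_graph (fun _ => True) X x.
Proof.
move=> /RQ_rcode Hx; apply: (graph_set (F := fun i => rcode (x i))) Hx.
by apply: (D0_ext (P := fun _ : ctx M 1 => ~ False)) => [c|]; [tauto|dfn].
Qed.

Lemma graph_RQb y : RQb y ->
  exists Y g, is_graph (fun d => exists n i, d = pr n i) Y g /\ (forall n i, g (pr n i) = y n i).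
Proof.
move=> Hy; pose g d := y (unl d) (unr d).
have Hg : R1u (fun d => rcode (g d)).
  by apply: RQ_rcode; apply: RQ_app2 => //; [apply: (R1_app1 (@R1_unl M))
    |apply: (R1_app1 (@R1_unr M))]; dfr.
have [|Y HY] := graph_set (D := @is_pair M) _ Hg; first by apply: D0_is_pair; dfn_term.
exists Y, g; split=> [m|n i]; last by rewrite /g unlK unrK.
by rewrite HY; split=> -[d [/is_pairP Hd ->]]; exists d.
Qed.

Definition iscode (z : N) : Prop := exists a, ltM a (addM z (oneM M)) /\
  exists b, ltM b (addM z (oneM M)) /\ exists c, ltM c (addM z (oneM M)) /\
  z = cd a b c /\ iscan a b c.

Lemma iscodeP z : iscode z <-> exists q, z = rcode q.
Proof.
split=> [[a [_ [b [_ [c [_ [-> /rcodeE H]]]]]]]|[q ->]]; first by exists (frv a b c).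
have [_ can] := crepP q; have [Ha Hb Hc] := cd_bounds (num_le_refl (rcode q)).
by exists (cpos q); split=> //; exists (cneg q); split=> //; exists (cden q).
Qed.

Lemma D0_iscode n (f : ctx M n -> N) : proj f -> D0 (fun c => iscode (f c)).
Proof.
apply: (D0_unary (P := iscode)); rewrite /iscode /iscan /qeqM /cd /pr; dfn.
Qed.

Definition qval (z : N) : Q :=
  if pselect (exists q, z = rcode q) is left H then projT1 (cid H) else 0.

Lemma qvalK q : qval (rcode q) = q.
Proof.
rewrite /qval; case: pselect => [H|[]]; last by exists q.
by have /rcode_inj := projT2 (cid H).
Qed.

Lemma rcode_qval z : iscode z -> rcode (qval z) = z.
Proof. by move=> /iscodeP [q ->]; rewrite qvalK. Qed.

Lemma RQu_qval : RQu qval.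
Proof.
apply: rcode_RQ.
have H := R1_if (P := fun c : ctx M 1 => iscode (snd c)) (f := fun c => snd c)
  (g := fun _ => rcode (0 : Q)).
apply: R1_ext (H _ _ _ _) => [c||||]; try dfr.
- case: pselect => [/rcode_qval //|nc]; congr rcode; rewrite /qval; case: pselect => // q.
  by case: nc; apply/iscodeP.
- by apply/D0_S1/D0_iscode; dfn_proj.
- by apply/D0_S1/D0_not/D0_iscode; dfn_proj.
Qed.

(** With bounds [1 / (k + 1)] all quantifiers range over numbers, which makes the notion accessible
    to the definability lemmas. *)
Lemma Cauchy_inv_succ (x : N -> Q) : Cauchy x <-> forall k, exists K, forall m n,
  K <=' m -> K <=' n -> `|x m - x n| < (io k + 1)^-1.
Proof.
split=> [H k|H e /archimedean [k ke]]; first exact/H/inv_succ_gt0.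
by have [K HK] := H k; exists K => m n Hm Hn; apply: lt_le_trans ke; apply: HK.
Qed.

Lemma Rle_inv_succ (x y : N -> Q) : Rle x y <-> forall k, exists K, forall n,
  K <=' n -> x n <= y n + (io k + 1)^-1.
Proof.
split=> [H k|H e /archimedean [k ke]]; first exact/H/inv_succ_gt0.
have [K HK] := H k; exists K => n Hn; have := HK n Hn; lra.
Qed.

End Sequences.

(** * Orbits from arithmetical comprehension *)

Section Orbits.
Variable M : rca.
Hypothesis SC : Sigma_comprehension M.
Local Notation Q := (frac_field M).
Local Notation N := (num M).
Local Notation "m <=' n" := (leM m n) (at level 70).
Local Notation "m +' n" := (addM m n) (at level 50, left associativity).
Local Notation "1'" := (oneM M).
Local Open Scope ring_scope.

(** Each of the alternating quantifiers is absorbed by [SC]; this is what makes induction on such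
    statements available. *)
Lemma D0_Cauchy n (x : ctx M n -> N -> Q) :
  RQ (n := S n) (fun c => x (fst c) (snd c)) -> D0 (fun c => Cauchy (x c)).
Proof.
move=> Hx; apply: (D0_ext (fun c => iff_sym (Cauchy_inv_succ (x c)))).
have up (h : ctx M n -> N) : proj h -> proj (n := S (S (S (S n)))) (fun c => h c.1.1.1.1).
  by move=> Hh; exact: (proj_fst (proj_fst (proj_fst (proj_fst Hh)))).
apply: (D0_forall SC); apply: (D0_exists SC); apply: (D0_forall SC); apply: (D0_forall SC).
apply: D0_imp; first by rewrite /leM; dfn.
apply: D0_imp; first by rewrite /leM; dfn.
apply: (S1_D0 SC); apply: S1_Qlt; last by apply: RQ_inv_succ; dfr.
by apply: RQ_norm; apply: RQ_sub; apply: (RQ_lift (f := x) up _ Hx); dfn_proj.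
Qed.

Lemma D0_Rle n (x y : ctx M n -> N -> Q) :
  RQ (n := S n) (fun c => x (fst c) (snd c)) ->
  RQ (n := S n) (fun c => y (fst c) (snd c)) -> D0 (fun c => Rle (x c) (y c)).
Proof.
move=> Hx Hy; apply: (D0_ext (fun c => iff_sym (Rle_inv_succ (x c) (y c)))).
have up (h : ctx M n -> N) : proj h -> proj (n := S (S (S n))) (fun c => h c.1.1.1).
  by move=> Hh; exact: (proj_fst (proj_fst (proj_fst Hh))).
apply: (D0_forall SC); apply: (D0_exists SC); apply: (D0_forall SC).
apply: D0_imp; first by rewrite /leM; dfn.
apply: (S1_D0 SC); apply: S1_Qle.
  by apply: (RQ_lift (f := x) up _ Hx); dfn_proj.
by apply: RQ_add; [apply: (RQ_lift (f := y) up _ Hy); dfn_proj|apply: RQ_inv_succ; dfr].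
Qed.

(** * The iterates of a continuous function *)

Variables (F : sets M) (f : N -> Q).
Hypothesis Ff : is_graph (fun d => exists q i, d = pr (rcode q) i) F f.
Let phi (q : Q) (i : N) : Q := f (pr (rcode q) i).
Hypothesis phi_cont : forall X x, is_graph (fun _ => True) X x -> In01 x ->
  InDom phi x /\ In01 (fun i => phi (x i) i).
Variables (X : sets M) (x : N -> Q).
Hypotheses (Xx : is_graph (fun _ => True) X x) (x01 : In01 x).

(** The recursion is on codes of rationals, with the index [i] of the approximation as parameter.
    All iterates are codes, so they avoid the default branch. *)
Let step (i n v : N) : N := if pselect (iscode v) then rcode (f (pr v i)) else 0%M.

Let R1_step : R1t step.
Proof.
apply: (S1_ext (P := fun c : ctx M 4 => elemM (pr (pr c.1.2 c.1.1.1.2) c.2) F \/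
  (~ iscode c.1.2 /\ c.2 = zeroM M))) => [[[[[u i] n] v] w]|]; last first.
  apply: S1_or; first by rewrite /pr; dfs.
  by apply: S1_and; [apply/D0_S1/D0_not/D0_iscode; dfn_proj|dfs].
rewrite /= /step; case: pselect => [vc|nc].
  have /iscodeP [q Eq] := vc.
  rewrite (is_graph_elem _ Ff); last by exists q, i; rewrite Eq.
  by split=> [[//|[]]|->]; [case; apply/iscodeP; exists q|left].
split=> [[/Ff [d [[q [j ->]] /pr_inj [/pr_inj [Ev _] _]]]|[]]//|->]; last by right.
by case: nc; apply/iscodeP; exists q.
Qed.

Lemma iterates : exists h : N -> N -> Q, [/\ RQb h, forall i, h i (zeroM M) = x i &
  forall i n, h i (n +' 1') = phi (h i n) i].
Proof.
have R1_base : R1u (fun i => rcode (x i)) by apply/RQ_rcode/(RQu_graph Xx).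
have [H [RH H0 HS]] := primitive_recursion R1_base R1_step.
have Hcode i n : iscode (H i n).
  move: n; apply: S1_ind => [||n Hn].
  - apply: (S1_app1 (P := @iscode M)); first by apply/D0_S1/D0_iscode; dfn_proj.
    by apply: (R1_app2 RH); dfr.
  - by rewrite H0; apply/iscodeP; exists (x i).
  - by rewrite HS /step; case: pselect => // vc; apply/iscodeP; eexists.
exists (fun i n => qval (H i n)); split.
- apply: (RQ_app1 (x := @qval M)) => //; exact: RQu_qval.
- by move=> i; rewrite H0 qvalK.
- move=> i n; rewrite HS /step; case: pselect => // vc.
  by rewrite qvalK /phi rcode_qval.
Qed.

Lemma orbit_from_comprehension :
  exists Y g, is_graph (fun d => exists n i, d = pr n i) Y g /\
    let y n i := g (pr n i) in
    uniformly_Cauchy y /\ Req (y (zeroM M)) x /\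
    forall n, InDom phi (y n) /\ Req (y (n +' 1')) (fun i => phi (y n i) i).
Proof.
have [h [Rh h0 hS]] := iterates.
(* The hypothesis on [F] concerns reals that are given by sets of the model. *)
have row_set n : exists Z, is_graph (fun _ => True) Z (fun i => h i n).
  by apply: graph_RQu; apply: RQ_app2 => //; dfr.
have h01 n : In01 (fun i => h i n).
  move: n; apply: D0_ind => [||n Hn].
  - have R2 : RQ (n := 2) (fun c => h (snd c) (snd (fst c))) by apply: RQ_app2 => //; dfr.
    apply: D0_and; first exact: (D0_Cauchy (n := 1) (x := fun c i => h i (snd c))).
    apply: D0_and; first exact: (D0_Rle (n := 1) (x := fun c i => 0)
      (y := fun c i => h i (snd c)) (RQ_const _ 0) R2).
    exact: (D0_Rle (n := 1) (x := fun c i => h i (snd c)) (y := fun c i => 1) R2 (RQ_const _ 1)).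
  - by rewrite (_ : (fun i => _) = x) //; apply: functional_extensionality.
  have [Z HZ] := row_set n; have [_] := phi_cont HZ Hn.
  by congr In01; apply: functional_extensionality => i; rewrite hS.
pose P n k K := forall i, K <=' i -> forall j, K <=' j -> `|h i n - h j n| < (io k + 1)^-1.
have DP : D0 (n := 3) (fun c => P c.1.1.2 c.1.2 c.2).
  rewrite /P; apply: (D0_forall SC); apply: D0_imp; first by rewrite /leM; dfn.
  apply: (D0_forall SC); apply: D0_imp; first by rewrite /leM; dfn.
  apply: (S1_D0 SC); apply: S1_Qlt; last by apply: RQ_inv_succ; dfr.
  by apply/RQ_norm/RQ_sub; apply: RQ_app2 => //; dfr.
have modulus n k : exists K, P n k K /\ forall K', ltM K' K -> ~ P n k K'.
  have [C _] := h01 n; have [K HK] := C _ (inv_succ_gt0 k).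
  apply: (D0_least (x := K)); last by move=> i Hi j Hj; apply: HK.
  apply: (D0_reindex (m := 1) (n := 3) (th := fun c => (tt, n, k, snd c)) _ DP).
  apply: reindex_pair (@proj_snd _ _); apply: reindex_pair (@proj_const _ _ _).
  by apply: reindex_pair (@proj_const _ _ _) => g _; apply: proj_const.
pose mu n k := projT1 (cid (modulus n k)).
have mu_P n k : P n k (mu n k) by case: (projT2 (cid (modulus n k))).
have mu_least n k K : P n k K -> mu n k <=' K.
  move=> HK; apply/num_not_lt => lt.
  by have [_ /(_ K lt)] := projT2 (cid (modulus n k)).
(* A modulus for a finer precision is one for a coarser precision, so the least moduli are
   monotone. *)
have mu_mono n k l : k <=' l -> mu n k <=' mu n l.
  move=> kl; apply: mu_least => i Hi j Hj.
  by apply: lt_le_trans (inv_succ_le kl); apply: mu_P.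
have Rmu : R1b mu.
  apply: (S1_ext (P := fun c : ctx M 3 => P c.1.1.2 c.1.2 c.2 /\
    forall K, ltM K c.2 -> ~ P c.1.1.2 c.1.2 K)) => [[[[u n] k] K] /=|].
    split=> [[HK Hmin]|->]; last exact: (projT2 (cid (modulus n k))).
    by apply: num_le_antisym; [apply/num_not_lt => /Hmin|apply: mu_least].
  apply: D0_S1; apply: D0_and => //; apply: D0_ball; first dfn_term.
  apply: D0_not; apply: (D0_reindex (m := 4) (n := 3) (th := fun c => (c.1.1, c.2)) _ DP).
  by apply: reindex_pair (@proj_snd _ _) => g Hg; exact: (proj_fst (proj_fst Hg)).
pose y n k := h (mu n k) n.
have [Y [g [HY Hg]]] : exists Y g, is_graph (fun d => exists n i, d = pr n i) Y g /\
    (forall n i, g (pr n i) = y n i).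
  apply: (graph_RQb (y := y)); apply: (RQ_app2 (n := 2) (x := h) (f := fun c => mu c.1.2 c.2)
    (g := fun c => c.1.2) Rh); last dfr.
  by apply: (R1_app2 Rmu); dfr.
exists Y, g; split=> //; have -> : (fun n i => g (pr n i)) = y.
  by apply: functional_extensionality => n; apply: functional_extensionality => i.
cbv zeta.
have yh n : Close (fun i => h i n) (y n).
  move=> e /archimedean [k ke]; exists (k +' mu n k) => i le.
  have ki := num_le_trans (leM_addr _ _) le; have mi := num_le_trans (leM_addl _ _) le.
  by apply: le_trans ke; apply/ltW/(mu_P n k); [|exact: mu_mono].
have y01 n := In01_Close (yh n) (h01 n).
have y_dom n : InDom phi (y n).
  have [Z HZ] : exists Z, is_graph (fun _ => True) Z (y n).
    apply: (graph_RQu (x := y n)); apply: (RQ_app2 (n := 1) (x := h) (f := fun c => mu n c.2)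
      (g := fun c => n) Rh); last dfr.
    by apply: (R1_app2 Rmu); dfr.
  by case: (phi_cont HZ (y01 n)).
split; [|split].
- move=> e /archimedean [k ke]; exists k => n i j ki kj; apply: lt_le_trans ke.
  by apply: (mu_P n k); apply: mu_mono.
- apply/Req_Close; have := Close_sym (yh (zeroM M)).
  by congr Close; apply: functional_extensionality.
move=> n; split=> //; apply/Req_Close; apply: Close_trans (Close_sym (yh _)) _ => e e0.
have [m Hm] := y_dom n e e0.
have d0 := inv_succ_gt0 m; set d := _^-1 in d0 Hm.
(* Both [h i n] and [y n i] will lie within [d / 2] of the real [y n]: one [d / 4] is for the
   difference between them, the other for the tail of [y n]. Hence [Hm] compares the two values of
   [phi]. *)
have d4 : 0 < d / 4 by lra.
have [k Hk] := yh n _ d4; have [C _] := y01 n; have [l Hl] := C _ d4.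
exists ((k +' l) +' (m +' 1')) => i le.
have le1 := num_le_trans (leM_addr _ _) le; have mi := num_le_trans (leM_addl _ _) le.
have ki := num_le_trans (leM_addr _ _) le1; have li := num_le_trans (leM_addl _ _) le1.
rewrite hS; apply/ltW/Hm => //; apply: (@InBall_intro _ _ _ _ (d / 2) l); try lra.
  move=> j lj; have := Hl j i lj li; have := Hk i ki.
  rewrite !ler_norml !ltr_norml => /andP [??] /andP [??].
  by apply/andP; split; lra.
move=> j lj; have := Hl j i lj li; rewrite ler_norml ltr_norml => /andP [??].
by apply/andP; split; lra.
Qed.
End Orbits.

Theorem orbits_exist_of_comprehension (M : rca) : Sigma_comprehension M -> orbits_exist M.
Proof.
move=> SC F f Ff phi phi_cont X x Xx x01.
exact: (orbit_from_comprehension SC Ff phi_cont Xx x01).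
Qed.

(** * Comprehension from orbits *)

Section Shift.
Variable R : realFieldType.
Implicit Types q r e w : R.
Local Open Scope ring_scope.

(* The distance of [3 q] to [{0, 2}]: on the Cantor set this is the shift of ternary
   expansions with digits 0 and 2. *)
Definition shift q : R := Num.min `|3 * q| `|3 * q - 2|.

(** A minimum of two functions of slope 3 or -3. *)
Lemma shift_lipschitz q r : `|shift q - shift r| <= 3 * `|q - r|.
Proof.
rewrite /shift !minEle; case: ifP => H1; case: ifP => H2;
  move: H1 H2; do ! (case: ler0P => ?); rewrite ?ler_norml ?ler_normr; lra.
Qed.

Lemma shift_ge0 q : 0 <= shift q.
Proof. by rewrite /shift le_min !normr_ge0. Qed.

Lemma shift_le q e : 0 <= e -> - (e / 3) <= q -> q <= 1 + e / 3 -> shift q <= 1 + e.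
Proof. by rewrite /shift minEle; case: ifP; do ! (case: ler0P => ?); lra. Qed.

Lemma shift_digit0 w : 0 <= 3 * w -> 3 * w <= 1 -> shift w = 3 * w.
Proof. by rewrite /shift minEle; case: ifP; do ! (case: ler0P => ?); lra. Qed.

Lemma shift_digit2 w : 0 <= 3 * w - 2 -> 3 * w - 2 <= 1 -> shift w = 3 * w - 2.
Proof. by rewrite /shift minEle; case: ifP; do ! (case: ler0P => ?); lra. Qed.
End Shift.

Section Comprehension.
Variable M : rca.
Local Notation Q := (frac_field M).
Local Notation N := (num M).
Local Notation "m <=' n" := (leM m n) (at level 70).
Local Notation "m +' n" := (addM m n) (at level 50, left associativity).
Local Notation "1'" := (oneM M).
Local Notation "0'" := (zeroM M).
Local Open Scope ring_scope.

Lemma RQ_shift n (f : ctx M n -> Q) : RQ f -> RQ (fun c => shift (f c)).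
Proof.
move=> Hf; have H3 : RQ (fun c => 3 * f c) by apply: RQ_mul => //; apply: RQ_const.
by apply: RQ_min; apply: RQ_norm => //; apply: RQ_sub => //; apply: RQ_const.
Qed.

Lemma shift_Cauchy (x : N -> Q) : Cauchy x -> Cauchy (fun i => shift (x i)).
Proof.
move=> C e e0; have [|k Hk] := C (e / 3); first lra.
exists k => m n km kn; apply: le_lt_trans (shift_lipschitz _ _) _.
by have := Hk m n km kn; lra.
Qed.

Lemma shift_In01 (x : N -> Q) : In01 x -> In01 (fun i => shift (x i)).
Proof.
move=> [C [H0 H1]]; split; first exact: shift_Cauchy.
split=> e e0; first by exists 0' => n _; have := shift_ge0 (x n); lra.
have e3 : 0 < e / 3 by lra.
have [k Hk] := H0 _ e3; have [l Hl] := H1 _ e3; exists (k +' l) => n le.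
have := Hk n (num_le_trans (leM_addr _ _) le); have := Hl n (num_le_trans (leM_addl _ _) le).
by move=> A1 A2; apply: shift_le; lra.
Qed.

Lemma shift_InDom (x : N -> Q) : InDom (fun q _ => shift q) x.
Proof.
(* Radius and slack of at most [e / 16] each put [q] and [r] within [e / 4] of each other; tripled,
   this is still below [e]. *)
move=> e e0; have e12 : 0 < e / 16 by lra.
have [m Hm] := archimedean e12; exists m => q r Bq Br i j _ _.
have [k Hk] := InBall_elim Bq e12; have [l Hl] := InBall_elim Br e12.
have := Hk _ (leM_addr k l); have := Hl _ (leM_addl k l).
rewrite !ler_norml => /andP [??] /andP [??].
apply: le_lt_trans (shift_lipschitz _ _) _.
suff : `|q - r| <= e / 4 by lra.
by rewrite ler_norml; apply/andP; split; lra.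
Qed.

(** The map takes rationals to rationals, so [F(q)] can be a constant sequence. *)
Lemma shift_set : exists F f,
  is_graph (fun d => exists q (i : N), d = pr (rcode q) i) F f /\
  (fun q i => f (pr (rcode q) i)) = (fun (q : Q) (_ : N) => shift q).
Proof.
pose f (d : N) := shift (qval (unl d)).
have Hf : R1u (fun d => rcode (f d)).
  apply: RQ_rcode; apply: RQ_shift; apply: (RQ_app1 (@RQu_qval M)).
  by apply: (R1_app1 (@R1_unl M)); dfr.
pose D (d : N) := is_pair d /\ exists v, ltM v (d +' 1') /\ (iscode v /\
  exists i, ltM i (d +' 1') /\ d = pr v i).
have [|F HF] := graph_set (D := D) _ Hf.
  apply: D0_and; first by apply: D0_is_pair; dfn_term.
  apply: D0_bex; first dfn_term.
  by apply: D0_and; [apply: D0_iscode; dfn_proj|rewrite /pr; dfn].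
exists F, f; split; last first.
  apply: functional_extensionality => q; apply: functional_extensionality => i.
  by rewrite /f unlK qvalK.
move=> z; rewrite HF; split=> [[d [[_ [v [_ [/iscodeP [q ->] [i [_ ->]]]]]] ->]]|].
  by exists (pr (rcode q) i); split=> //; exists q, i.
move=> [d [[q [i ->]] ->]]; exists (pr (rcode q) i); split=> //; split.
  by apply/is_pairP; do 2 eexists.
exists (rcode q); split; first exact: pr_l.
by split; [apply/iscodeP; exists q|exists i; split; first exact: pr_r].
Qed.

Hypothesis orbits : orbits_exist M.

(** * The real whose digits decide [P] *)

Variables (P : N -> Prop) (S1_P : S1 (n := 1) (fun c => P (snd c))).

Let theta_exists : exists T : N -> N -> Prop,
  D0 (n := 2) (fun c => T c.1.2 c.2) /\ forall n, P n <-> exists v, T n v.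
Proof.
have [T [DT HT]] := S1_P; exists (fun n v => T (tt, n, v)); split=> [|n]; last exact: (HT (tt, n)).
by apply: D0_ext DT => -[[[] n] v].
Qed.

Let T := projT1 (cid theta_exists).

Let D0_T : D0 (n := 2) (fun c => T c.1.2 c.2).
Proof. by case: (projT2 (cid theta_exists)). Qed.

Let P_T n : P n <-> exists v, T n v.
Proof. by case: (projT2 (cid theta_exists)). Qed.

(** The digit of the [i]-th approximation at position [k]. *)
Let found i k : Prop := exists v, ltM v i /\ T k v.
Let digit i k : N := if pselect (found i k) then 1' +' 1' else 0'.

Let D0_found : D0 (n := 2) (fun c => found c.1.2 c.2).
Proof.
apply: D0_bex; first dfn_term.
apply: (D0_reindex (m := 3) (n := 2) (th := fun c => (tt, c.1.2, c.2)) _ D0_T).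
apply: reindex_pair (@proj_snd _ _); apply: reindex_pair (proj_fst (@proj_snd _ _)).
by move=> g _; apply: proj_const.
Qed.

Let R1_digit : R1b digit.
Proof.
by apply: R1_if; [apply: D0_S1|apply/D0_S1/D0_not| |]; dfr.
Qed.

(** [A i k] is the integer with the [k] ternary digits at positions below [k], the most significant
    first. *)
Let digits_exist : exists A : N -> N -> N, [/\ R1b A, forall i, A i 0' = 0' &
  forall i k, A i (k +' 1') = mulM (1' +' 1' +' 1') (A i k) +' digit i k].
Proof.
have H0 : R1u (fun _ => 0') by rewrite /R1u; dfr.
have HS : R1t (fun i k v => mulM (1' +' 1' +' 1') v +' digit i k).
  by apply: R1_add; [dfr|apply: (R1_app2 R1_digit); dfr].
exact: (primitive_recursion H0 HS).
Qed.

(** [B k] is [3 ^ k - 1], since denominators are stored as predecessors. *)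
Let powers_exist : exists B : N -> N, [/\ R1u B, B 0' = 0' &
  forall k, B (k +' 1') = mulM (1' +' 1' +' 1') (B k) +' (1' +' 1')].
Proof.
have H0 : R1u (fun _ => 0') by rewrite /R1u; dfr.
have HS : R1t (fun i k v => mulM (1' +' 1' +' 1') v +' (1' +' 1')) by rewrite /R1t; dfr.
have [B [RB B0 BS]] := primitive_recursion H0 HS.
by exists (B 0'); split=> //; apply: (R1_app2 RB); dfr.
Qed.

Let A := projT1 (cid digits_exist).
Let B := projT1 (cid powers_exist).
Let R1_A : R1b A. Proof. by case: (projT2 (cid digits_exist)). Qed.
Let A0 i : A i 0' = 0'. Proof. by case: (projT2 (cid digits_exist)). Qed.
Let AS i k : A i (k +' 1') = mulM (1' +' 1' +' 1') (A i k) +' digit i k.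
Proof. by case: (projT2 (cid digits_exist)). Qed.
Let R1_B : R1u B. Proof. by case: (projT2 (cid powers_exist)). Qed.
Let B0 : B 0' = 0'. Proof. by case: (projT2 (cid powers_exist)). Qed.
Let BS k : B (k +' 1') = mulM (1' +' 1' +' 1') (B k) +' (1' +' 1').
Proof. by case: (projT2 (cid powers_exist)). Qed.

(* [pw k = 3 ^ k] *)
Let pw (k : N) : Q := io (B k) + 1.
Let a (i k : N) : Q := io (A i k).
Let d (i k : N) : Q := io (digit i k).

Let pw0 : pw 0' = 1. Proof. by rewrite /pw B0 io0 add0r. Qed.
Let pwS k : pw (k +' 1') = 3 * pw k.
Proof. by rewrite /pw BS !(ioD, ioM, io1); ring. Qed.
Let a0 i : a i 0' = 0. Proof. by rewrite /a A0 io0. Qed.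
Let aS i k : a i (k +' 1') = 3 * a i k + d i k.
Proof. by rewrite /a /d AS !(ioD, ioM, io1); ring. Qed.
Let dE i k : d i k = if pselect (found i k) then 2 else 0.
Proof. by rewrite /d /digit; case: pselect => H; rewrite ?ioD ?io1 ?io0. Qed.
Let d_ge0 i k : 0 <= d i k. Proof. exact: io_ge0. Qed.
Let d_le2 i k : d i k <= 2. Proof. by rewrite dE; case: pselect => H /=; lra. Qed.
Let pw_ge1 k : 1 <= pw k. Proof. by have := io_ge0 (B k); rewrite /pw; lra. Qed.
Let pw_gt0 k : 0 < pw k. Proof. by have := pw_ge1 k; lra. Qed.

Let RQ_pw : RQu pw.
Proof. by apply: RQ_add; [apply/RQ_io/(R1_app1 R1_B); dfr|apply: RQ_const]. Qed.
Let RQ_a : RQb a.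
Proof. exact: RQ_io. Qed.

(** The approximations of the point whose ternary digits decide [P]. *)
Let x (i : N) : Q := a i i / pw i.

Let RQ_x : RQu x.
Proof.
apply: RQ_mul; first by apply: (RQ_app2 RQ_a); dfr.
by apply: RQ_inv_succ; apply: (R1_app1 R1_B); dfr.
Qed.

Let a_bound i k : a i k + 1 <= pw k.
Proof.
move: k; apply: S1_ind => [||k IH].
- apply: S1_Qle; last by apply: (RQ_app1 RQ_pw); dfr.
  by apply: RQ_add; [apply: (RQ_app2 RQ_a); dfr|apply: RQ_const].
- by rewrite a0 pw0; lra.
- by rewrite aS pwS; have := d_le2 i k; lra.
Qed.

Let a_mono i j k : i <=' j -> a i k <= a j k.
Proof.
move=> ij; move: k; apply: S1_ind => [||k IH].
- by apply: S1_Qle; apply: (RQ_app2 RQ_a); dfr.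
- by rewrite !a0.
- rewrite !aS; suff : d i k <= d j k by lra.
  rewrite !dE; case: pselect => H1; case: pselect => H2 /=; try lra.
  by case: H2; case: H1 => v [vi Tv]; exists v; split=> //; apply: num_lt_le_trans ij.
Qed.

(** From one approximation to the next, digits can only turn from 0 into 2, and one more digit is
    appended. *)
Let x_mono i j : i <=' j -> x i <= x j.
Proof.
move=> /num_le_exists [l ->]; move: l; apply: S1_ind => [||l IH].
- by apply: S1_Qle; apply: (RQ_app1 RQ_x); dfr.
- by rewrite num_addx0.
apply: le_trans IH _; rewrite num_addA /x pwS aS.
set j' := i +' l; rewrite ler_pdivrMr ?pw_gt0 //.
have p0 := pw_gt0 j'; rewrite (_ : _ / _ * _ = (3 * a (j' +' 1') j' + d (j' +' 1') j') / 3).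
  have := d_ge0 (j' +' 1') j'; have := @a_mono j' (j' +' 1') j' (leM_addr _ _); lra.
by field; rewrite lt0r_neq0.
Qed.

Let x_ge0 i : 0 <= x i.
Proof. by apply: divr_ge0; [exact: io_ge0|exact: ltW]. Qed.

Let x_le1 i : x i <= 1.
Proof. by rewrite ler_pdivrMr // mul1r; have := a_bound i i; lra. Qed.

(* A bounded monotone sequence is Cauchy, by induction on the multiples of [1 / (k + 1)]
   that are exceeded. *)
Let x_Cauchy : Cauchy x.
Proof.
move=> e /archimedean [k ke]; have k0 := inv_succ_gt0 k.
set u := _^-1 in ke k0.
pose S (j : N) := exists i, io j * u <= x i.
have [j [[i Hi] nS]] : exists j, S j /\ ~ S (j +' 1').
  apply: contrapT => nE.
  have H : forall j, S j.
    apply: S1_ind => [||j Sj].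
    - apply: S1_ex; apply: S1_Qle; last by apply: (RQ_app1 RQ_x); dfr.
      by apply: RQ_mul; [apply: RQ_io; dfr|apply: RQ_const].
    - by exists 0'; rewrite io0 mul0r.
    - by apply: contrapT => nS; apply: nE; exists j.
  (* The multiple [(k + 2) * u = 1 + u] exceeds the upper bound 1 of the sequence. *)
  have [i] := H (k +' 1' +' 1'); rewrite !(ioD, io1).
  have Eu : (io k + 1) * u = 1 by rewrite /u mulfV // io_succ_neq0.
  have := x_le1 i; rewrite mulrDl Eu mul1r; lra.
have H n : i <=' n -> io j * u <= x n < io j * u + u.
  move=> ni; apply/andP; split; first exact: le_trans Hi (x_mono ni).
  rewrite ltNge; apply/negP => H; apply: nS; exists n; rewrite ioD io1; lra.
exists i => m n /H /andP [??] /H /andP [??].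
by rewrite ltr_norml; apply/andP; split; lra.
Qed.

Let x_In01 : In01 x.
Proof.
split; first exact: x_Cauchy.
by split=> e e0; exists 0' => n _; [have := x_ge0 n|have := x_le1 n]; lra.
Qed.

Let pw_add k l : pw (k +' l) = pw k * pw l.
Proof.
move: l; apply: S1_ind => [||l IH].
- have H1 : RQ (n := 1) (fun c => pw (k +' snd c)) by apply: (RQ_app1 RQ_pw); dfr.
  have H2 : RQ (n := 1) (fun c => pw k * pw (snd c)).
    by apply: RQ_mul; [apply: RQ_const|apply: (RQ_app1 RQ_pw); dfr].
  apply: (S1_ext _ (S1_and (S1_Qle H1 H2) (S1_Qle H2 H1))) => c.
  by split=> [[? ?]|->//]; apply: le_anti; apply/andP.
- by rewrite num_addx0 pw0 mulr1.
- by rewrite num_addA !pwS IH; ring.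
Qed.

(** The first [k] digits are a prefix of the first [k + l]; the other [l] digits contribute less
    than [3 ^ l]. *)
Let a_add i k l : a i k * pw l <= a i (k +' l) /\ a i (k +' l) + 1 <= (a i k + 1) * pw l.
Proof.
move: l; apply: S1_ind => [||l [IH1 IH2]].
- have H1 : RQ (n := 1) (fun c => a i (k +' snd c)) by apply: (RQ_app2 RQ_a); dfr.
  have H2 q : RQ (n := 1) (fun c => q * pw (snd c)).
    by apply: RQ_mul; [apply: RQ_const|apply: (RQ_app1 RQ_pw); dfr].
  by apply: S1_and; apply: S1_Qle => //; apply: RQ_add => //; apply: RQ_const.
- by rewrite num_addx0 pw0 !mulr1.
- rewrite num_addA aS pwS; have := d_ge0 i (k +' l); have := d_le2 i (k +' l).
  by split; lra.
Qed.

(* The point with digits [k], [k + 1], ... of [x i]. *)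
Let w (i k : N) : Q := pw k * x i - a i k.

Let w_range i k : k <=' i -> 0 <= w i k <= 1.
Proof.
move=> /num_le_exists [l Ei]; have [H1 H2] := a_add i k l; rewrite -Ei in H1 H2.
have pl := pw_gt0 l; have pk := pw_gt0 k.
have -> : w i k = (a i i - a i k * pw l) / pw l.
  rewrite /w /x Ei pw_add -Ei; field.
  by rewrite !lt0r_neq0.
by apply/andP; split; [apply: divr_ge0; lra|rewrite ler_pdivrMr // mul1r; lra].
Qed.

(** The hypothesis ensures that position [k] survives the truncation. Its digit 0 or 2 puts the
    point into the left or right third of the unit interval, where the shift is affine. *)
Let w_step i k : (k +' 1') <=' i -> shift (w i k) = w i (k +' 1') /\
  (found i k -> 2 / 3 <= w i k) /\ (~ found i k -> w i k <= 1 / 3).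
Proof.
move=> ki; have /andP [H0 H1] := w_range ki.
have E : w i (k +' 1') = 3 * w i k - d i k by rewrite /w pwS aS; ring.
move: E H0 H1; rewrite dE; case: pselect => F /= -> H0 H1.
  by rewrite shift_digit2 //; split=> //; split=> // _; lra.
rewrite subr0 in H0 H1 *; rewrite shift_digit0 //; split=> //; split=> // _; lra.
Qed.

(** * Orbits follow the shifted expansions *)

Section Tracking.
Variables (y : N -> N -> Q).
Hypotheses (Ry : RQb y) (y_unif : uniformly_Cauchy y) (y0 : Req (y 0') x).
Hypothesis yS : forall n, Req (y (n +' 1')) (fun i => shift (y n i)).

(** As the shift triples errors, factors with [c 0 = 3] and [c (k + 1) >= 3 * c k + 5] are required,
    and [6 * 3 ^ k - 3] satisfies this. At a fixed index [i] the bound is an [S1] statement about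
    [k]. The disjunct [n < k] ends the induction at [n], since [w_step] fails to apply beyond
    [i]. *)
Let track n i (e : Q) : 0 < e -> n <=' i -> `|y 0' i - x i| <= 3 * e ->
  (forall k, `|y (k +' 1') i - shift (y k i)| <= 5 * e) ->
  `|y n i - w i n| <= (6 * pw n - 3) * e.
Proof.
move=> e0 ni H0 HS.
suff H : forall k, ltM n k \/ `|y k i - w i k| <= (6 * pw k - 3) * e.
  by case: (H n) => // /num_ltxx.
apply: S1_ind => [||k IH].
- apply: S1_or; first by dfs.
  apply: S1_Qle.
    apply/RQ_norm/RQ_sub; first by apply: (RQ_app2 Ry); dfr.
    apply: RQ_sub; last by apply: (RQ_app2 RQ_a); dfr.
    by apply: RQ_mul; [apply: (RQ_app1 RQ_pw); dfr|apply: RQ_const].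
  apply: RQ_mul; last exact: RQ_const.
  apply: RQ_sub; last exact: RQ_const.
  by apply: RQ_mul; [apply: RQ_const|apply: (RQ_app1 RQ_pw); dfr].
- right; rewrite /w pw0 a0 mul1r subr0; lra.
case: (num_lt_total n k) => [nk|nk]; first by left; apply/num_ltxS; left.
case: nk => [->|kn]; first by left; apply: num_ltxSx.
right; case: IH => [nk|IH]; first by case: (num_ltxx (num_lt_trans nk kn)).
have ki : (k +' 1') <=' i.
  by apply: num_le_trans ni; have [z ->] := proj1 (num_lt_exists k n) kn;
    apply/num_le_exists; exists z; rewrite (num_addC z) num_addA.
have [Ew _] := w_step ki.
rewrite -Ew (_ : _ - _ = (y (k +' 1') i - shift (y k i)) + (shift (y k i) - shift (w i k)));
  last by ring.
apply: le_trans (ler_normD _ _) _; rewrite pwS.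
have := HS k; have := shift_lipschitz (y k i) (w i k); move: IH.
have := pw_ge1 k; set p := pw k => p1.
rewrite !mulrBl => IH H1 H2; rewrite -!mulrA; rewrite -!mulrA in IH; lra.
Qed.

(** The index from which the equation for row [k + 1] is accurate depends on [k], but it is visited
    only in passing: uniform convergence leads there and back. The costs are [e + e + e] for row 0,
    and [e + e + 3 * e] for the others, where one leg passes through the shift. *)
Let decide (e : Q) : 0 < e -> exists K, forall i, K <=' i ->
  `|y 0' i - x i| <= 3 * e /\ forall k, `|y (k +' 1') i - shift (y k i)| <= 5 * e.
Proof.
move=> e0; have [K HK] := y_unif e0; have [L HL] := x_Cauchy e0.
exists (K +' L) => i le.
have Ki := num_le_trans (leM_addr _ _) le; have Li := num_le_trans (leM_addl _ _) le.
split=> [|k].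
  have [J HJ] := proj1 (Req_Close _ _) y0 e e0.
  have Jj := leM_addl i J; set j := i +' J in Jj.
  have ij : i <=' j := leM_addr _ _.
  have := HJ j Jj; have := HK 0' i j Ki (num_le_trans Ki ij).
  have := HL i j Li (num_le_trans Li ij); rewrite !ltr_norml !ler_norml.
  by move=> /andP [??] /andP [??] /andP [??]; apply/andP; split; lra.
have [J HJ] := proj1 (Req_Close _ _) (yS k) e e0.
have Jj := leM_addl i J; set j := i +' J in Jj.
have ij : i <=' j := leM_addr _ _.
have := HJ j Jj; have := HK (k +' 1') i j Ki (num_le_trans Ki ij).
have := shift_lipschitz (y k i) (y k j).
have := HK k i j Ki (num_le_trans Ki ij) => H1 H2.
have := le_trans H2 (_ : _ <= 3 * e); rewrite ler_pM2l ?(ltW H1) // => /(_ isT).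
rewrite !ltr_norml !ler_norml.
by move=> /andP [??] /andP [??] /andP [??]; apply/andP; split; lra.
Qed.

(** With [K] fixed, comparing [y n K] with 1/2 is a decidable property of [n], so the comprehension
    of the base theory yields the set. *)
Lemma tracked_comprehension : exists X, forall n, elemM n X <-> P n.
Proof.
(* Together with the tracking error 1/10 this gives 2/15, which is less than the distance 1/6 of 1/2
   from 1/3 and 2/3. *)
have [|K HK] := y_unif (e := 1 / 30); first lra.
suff H (n : N) : 1 / 2 < y n K <-> P n.
  have Rn : RQ (n := 1) (fun c => y (snd c) K) by apply: (RQ_app2 Ry); dfr.
  have [|X HX] := D1_comprehension (P := fun n => 1 / 2 < y n K); last first.
    by exists X => n; rewrite HX H.
  split; first by apply: S1_Qlt => //; apply: RQ_const.
  apply: (S1_ext _ (S1_Qle Rn (RQ_const 1 (1 / 2)))) => c.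
  by rewrite leNgt; split=> /negP.
(* Chosen such that [6 * pw n * e = 1 / 10]. *)
have p1 := pw_ge1 n; pose e := (60 * pw n)^-1.
have e0 : 0 < e by rewrite invr_gt0; lra.
have [L HL] := decide e0.
have close i : K <=' i -> L <=' i -> (n +' 1') <=' i -> `|y n K - w i n| <= 2 / 15.
  move=> Ki Li ni; have [H1 H2] := HL i Li.
  have ni' : n <=' i := num_le_trans (leM_addr _ _) ni.
  have := track e0 ni' H1 H2; have := HK n K i (num_le_refl K) Ki.
  have E : (6 * pw n - 3) * e <= 1 / 10.
    have -> : 1 / 10 = (6 * pw n) * e by rewrite /e; field; rewrite lt0r_neq0.
    by rewrite ler_pM2r //; lra.
  rewrite !ltr_norml !ler_norml => /andP [??] /andP [??].
  by apply/andP; split; lra.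
split=> [Hy|/P_T [v Tv]].
  pose i := (K +' L) +' (n +' 1').
  have ni : (n +' 1') <=' i := leM_addl _ _.
  have Ki : K <=' i := num_le_trans (leM_addr _ _) (leM_addr _ _).
  have Li : L <=' i := num_le_trans (leM_addl _ _) (leM_addr _ _).
  have := close i Ki Li ni; have [_ [_ Hw]] := w_step ni.
  case: (EM (found i n)) => [[v [_ Tv]] _|/Hw H1]; first by apply/P_T; exists v.
  by rewrite ler_norml => /andP [??]; lra.
(* The index also has to exceed the witness [v], so that the digit is already 2 at this stage. *)
pose i := ((K +' L) +' (n +' 1')) +' (v +' 1').
have vi : ltM v i := num_lt_le_trans (num_ltxSx v) (leM_addl _ _).
have le1 : (K +' L) +' (n +' 1') <=' i := leM_addr _ _.
have ni : (n +' 1') <=' i := num_le_trans (leM_addl _ _) le1.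
have le2 : K +' L <=' i := num_le_trans (leM_addr _ _) le1.
have := close i (num_le_trans (leM_addr _ _) le2) (num_le_trans (leM_addl _ _) le2) ni.
have [_ [Hw _]] := w_step ni; have H : 2 / 3 <= w i n by apply: Hw; exists v.
by rewrite ler_norml => /andP [??]; lra.
Qed.
End Tracking.

Lemma S1_set : exists X, forall n, elemM n X <-> P n.
Proof.
have [F [f [HF Ef]]] := shift_set.
have E q i : f (pr (rcode q) i) = shift q.
  exact: (f_equal (fun F => F q i) Ef).
have [X HX] := graph_RQu RQ_x.
have [|Y [g [HY /= [unif [g0 gS]]]]] := orbits HF _ HX x_In01.
  move=> X' x' _ x'01; split; first by rewrite Ef; apply: shift_InDom.
  have -> : (fun i => f (pr (rcode (x' i)) i)) = fun i => shift (x' i).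
    by apply: functional_extensionality => i; apply: E.
  exact: shift_In01.
apply: (tracked_comprehension (RQb_graph HY) unif g0) => n.
have [_ H] := gS n; move: H; congr Req; apply: functional_extensionality => i.
by rewrite E.
Qed.
End Comprehension.

Theorem comprehension_of_orbits_exist (M : rca) : orbits_exist M -> Sigma_comprehension M.
Proof. by move=> orbits P S1_P; apply: S1_set. Qed.

(** * The equivalence *)

Theorem proposition7p21 :
  equivalent_over RCA0 ACA (eq orbit_principle).
Proof.
split=> p Hp; apply: completeness => M HM s r.
- have HR : is_model RCA0 M by move=> q Hq; apply: HM; left.
  have HA : is_model ACA M by move=> q Hq; apply: HM; right.
  (* The assignment itself provides the set that an [rca] structure must contain. *)
  rewrite -Hp; apply/(orbit_principle_sat (M := Rca HR (r 0))).
  by apply/orbits_exist_of_comprehension/ACA_Sigma_comprehension.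
have HR : is_model RCA0 M by move=> q Hq; apply: HM; left.
have HO : sat s r orbit_principle by apply: HM; right.
case: Hp => q ar; apply: (arithmetical_comprehension (M := Rca HR (r 0))) => //.
by apply/comprehension_of_orbits_exist/(orbit_principle_sat (M := Rca HR (r 0)) s r).
Qed.
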